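(* Let $G$ be a group with $H_2(G)=0$, $G_{ab}\stackrel{\wedge}{*}G_{ab}=0$ and $\mathcal D_1S_3(G_{ab})=0$. Then $D_5(G)=\gamma_5(G)$.
   Context: $D_n(G)=G\cap(1+\mathfrak g^n)$, where $\mathfrak g$ is the augmentation ideal of $\mathbb Z[G]$; $\gamma_n(G)$ is the lower central series; $G_{ab}=G/\gamma_2(G)$; $H_2(G)=H_2(G,\mathbb Z)$. For an Abelian group $A$, $\mathrm{Tor}(A,A)$ is generated by symbols $\tau_m(x,y)$ ($x,y\in A$, $0<m\in\mathbb Z$, $mx=my=0$) with relations: additivity in each variable, $\tau_{mn}(x,y)=\tau_m(nx,y)$ if $mnx=my=0$, $\tau_{mn}(x,y)=\tau_m(x,ny)$ if $mx=mny=0$; $A\stackrel{\wedge}{*}A$ is the quotient of $\mathrm{Tor}(A,A)$ by the subgroup generated by all $\tau_m(x,x)$. For an Abelian group $A$, $L_n(A)$ is the $n$-th homogeneous component of the free Lie ring on $A$ over $\mathbb Z$, and $S_n(A)=\mathrm{Coker}(L_n(A)\to A^{\otimes n})$ (the natural map into the tensor algebra). For a functor $T$ from Abelian groups to Abelian groups, $\mathcal D_iT(A)=L_iT(A,0)$ is the Dold–Puppe derived functor: $\mathcal D_iT(A)=\pi_i(T(X))$, where $X$ is a free (in each degree) simplicial Abelian group with $\pi_0(X)=A$ and $\pi_j(X)=0$ for $j>0$. *)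

(* Defs.v *)
From HB Require Import structures.
From mathcomp Require Import all_boot all_order all_algebra.
From mathcomp Require Import finmap boolp classical_sets.
From mathcomp.multinomials Require Import monalg.

Set Implicit Arguments.
Unset Strict Implicit.
Unset Printing Implicit Defensive.

Import GRing.Theory.

Local Open Scope classical_set_scope.
Local Open Scope ring_scope.
Local Open Scope quotient_scope.

(* The types [groupType] and [zmodType] range over all, possibly infinite, groups
   and abelian groups: classically every type carries a choice structure.  The
   free abelian group on K is [{malg K}], with basis [<< k >>]. *)

(* [fab_lift] and [fab_op] are locked to keep unification from unfolding them. *)
HB.lock Definition fab_lift (K : choiceType) (V : zmodType) (f : K -> V)
    (x : {malg K}) : V :=
  \sum_(k <- msupp x) f k *~ x@_k.

HB.lock Definition fab_op (K : choiceType) (op : K -> K -> K)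
    (x y : {malg K}) : {malg K} :=
  fab_lift (fun k => fab_lift (fun l => << op k l >>) y) x.

Section FreeAbelian.
Variables (K : choiceType) (V : zmodType).
Implicit Types f : K -> V.

Lemma fab_liftEw f (d : {fset K}) x : (msupp x `<=` d)%fset ->
  fab_lift f x = \sum_(k <- d) f k *~ x@_k.
Proof.
move=> sxd; rewrite fab_lift.unlock (big_fset_incl _ sxd) //= => k _.
by move=> /mcoeff_outdom ->; rewrite mulr0z.
Qed.

Lemma fab_lift_is_zmod_morphism f : zmod_morphism (fab_lift f).
Proof.
move=> x y; pose d := (msupp x `|` msupp y)%fset.
rewrite (@fab_liftEw f d x) ?fsubsetUl // (@fab_liftEw f d y) ?fsubsetUr //.
rewrite (@fab_liftEw f d (x - y)) ?msuppB_le // -sumrB.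
by apply: eq_bigr => k _; rewrite mcoeffB mulrzBr.
Qed.

HB.instance Definition _ f := GRing.isZmodMorphism.Build {malg K} V (fab_lift f)
  (fab_lift_is_zmod_morphism f).

Lemma fab_lift0 f : fab_lift f 0 = 0.
Proof. exact: raddf0. Qed.

Lemma fab_liftB f x y : fab_lift f (x - y) = fab_lift f x - fab_lift f y.
Proof. exact: raddfB. Qed.

Lemma fab_liftD f x y : fab_lift f (x + y) = fab_lift f x + fab_lift f y.
Proof. exact: raddfD. Qed.

Lemma fab_liftU f k : fab_lift f << k >> = f k.
Proof. by rewrite (fab_liftEw _ msuppU_le) big_seq_fset1 mcoeffUU mulr1z. Qed.

Lemma malg_int (x : {malg K}) k : << x@_k *g k >> = << k >> *~ x@_k :> {malg K}.
Proof. by rewrite -(raddfMz (mkmalgU k)) /= intz. Qed.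

Lemma fab_ext (f g : {additive {malg K} -> V}) :
  (forall k, f << k >> = g << k >>) -> f =1 g.
Proof.
move=> fg x; rewrite [x]monalgE !raddf_sum; apply: eq_bigr => k _.
by rewrite malg_int !raddfMz /= fg.
Qed.

Lemma fab_ind (P : {malg K} -> Prop) :
  P 0 -> (forall x y, P x -> P y -> P (x - y)) -> (forall k, P << k >>) ->
  forall x, P x.
Proof.
move=> P0 PB PU x.
have PN y : P y -> P (- y) by move=> Py; rewrite -sub0r; apply: PB.
have PD y z : P y -> P z -> P (y + z).
  by move=> Py Pz; rewrite -[z]opprK; apply: PB => //; apply: PN.
rewrite [x]monalgE; elim/big_ind: _ => // k _; rewrite malg_int.
have PM n : P (<< k >> *+ n).
  by elim: n => [|n IH]; rewrite ?mulr0n // mulrS; apply: PD.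
by case: (x@_k) => n; [exact: PM | rewrite NegzE mulrNz; apply: PN; exact: PM].
Qed.

End FreeAbelian.

Section FreeAbelianOp.
Variables (K : choiceType) (op : K -> K -> K).

Lemma fab_opUU k l : fab_op op << k >> << l >> = << op k l >>.
Proof. by rewrite fab_op.unlock !fab_liftU. Qed.

Lemma fab_opBl y : {morph fab_op op ^~ y : x1 x2 / x1 - x2}.
Proof. by move=> x1 x2; rewrite fab_op.unlock fab_liftB. Qed.

Lemma fab_opBr x : {morph fab_op op x : y1 y2 / y1 - y2}.
Proof.
have E y : fab_op op x y =
    \sum_(k <- msupp x) fab_lift (fun l => << op k l >>) y *~ x@_k.
  by rewrite fab_op.unlock {1}fab_lift.unlock.
move=> y1 y2; rewrite !E -sumrB; apply: eq_bigr => k _.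
by rewrite raddfB /= mulrzBl.
Qed.

Lemma fab_op0l y : fab_op op 0 y = 0.
Proof. by have := fab_opBl y 0 0; rewrite /= !subrr. Qed.

Lemma fab_op0r x : fab_op op x 0 = 0.
Proof. by have := fab_opBr x 0 0; rewrite /= !subrr. Qed.

Lemma fab_opDl : left_distributive (fab_op op) +%R.
Proof.
move=> x y z; have := fab_opBl z (x + y) y; rewrite /= addrK => ->.
by rewrite subrK.
Qed.

Lemma fab_opDr : right_distributive (fab_op op) +%R.
Proof.
move=> x y z; have := fab_opBr x (y + z) z; rewrite /= addrK => ->.
by rewrite subrK.
Qed.

Lemma fab_opA : associative op -> associative (fab_op op).
Proof.
move=> opA x y z; elim/fab_ind: x => [|a b Ea Eb|g]; first by rewrite !fab_op0l.
  by rewrite !fab_opBl Ea Eb.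
elim/fab_ind: y => [|a b Ea Eb|h].
- by rewrite fab_op0l fab_op0r fab_op0l.
- by rewrite fab_opBl fab_opBr fab_opBr fab_opBl Ea Eb.
elim/fab_ind: z => [|a b Ea Eb|k]; first by rewrite !fab_op0r.
  rewrite (fab_opBr << h >>) (fab_opBr << g >>) (fab_opBr (fab_op _ _ _)).
  exact (f_equal2 (fun s t => s - t) Ea Eb).
by rewrite !fab_opUU opA.
Qed.

Lemma fab_op1l e : left_id e op -> left_id << e >> (fab_op op).
Proof.
move=> op1 x; elim/fab_ind: x => [|a b Ea Eb|g]; first by rewrite fab_op0r.
  by rewrite fab_opBr Ea Eb.
by rewrite fab_opUU op1.
Qed.

Lemma fab_op1r e : right_id e op -> right_id << e >> (fab_op op).
Proof.
move=> op1 x; elim/fab_ind: x => [|a b Ea Eb|g]; first by rewrite fab_op0l.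
  by rewrite fab_opBl Ea Eb.
by rewrite fab_opUU op1.
Qed.

End FreeAbelianOp.

Section Generated.
Variables (V : zmodType) (P : V -> Prop).

Inductive zgenerated : V -> Prop :=
| zgen_in x of P x : zgenerated x
| zgen_0 : zgenerated 0
| zgen_B x y of zgenerated x & zgenerated y : zgenerated (x - y).

Definition zspan : {pred V} := [pred x | `[< zgenerated x >]].

Lemma zspanP x : reflect (zgenerated x) (x \in zspan).
Proof. exact: asboolP. Qed.

Lemma zspan_closed : zmod_closed zspan.
Proof.
split=> [|x y /zspanP Zx /zspanP Zy]; apply/zspanP; first exact: zgen_0.
exact: zgen_B.
Qed.

HB.instance Definition _ := GRing.isZmodClosed.Build V zspan zspan_closed.

Definition zquot : Type := Quotient.quot zspan.
HB.instance Definition _ := GRing.Zmodule.on zquot.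

Definition zproj (x : V) : zquot := \pi_(Quotient.quot zspan) x.

Lemma zproj_is_zmod_morphism : zmod_morphism zproj.
Proof. exact: (raddfB \pi_(Quotient.quot zspan)). Qed.

HB.instance Definition _ := GRing.isZmodMorphism.Build V zquot zproj
  zproj_is_zmod_morphism.

End Generated.

Section QuotientTheory.
Variables (V : zmodType) (P : V -> Prop).

Lemma zproj_surj (q : zquot P) : exists x, q = zproj P x.
Proof. by exists (repr (q : Quotient.quot (zspan P))); rewrite /zproj reprK. Qed.

Lemma zproj_eq0 x : (zproj P x = 0) <-> zgenerated P x.
Proof.
rewrite -(raddf0 (zproj P)) -{2}[x]subr0; split.
  by move=> E; apply/zspanP; rewrite Quotient.idealrBE; apply/eqP; exact: E.
by move=> /zspanP; rewrite Quotient.idealrBE => /eqP.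
Qed.

Lemma zproj_repr x : exists2 y, zgenerated P y &
  repr (zproj P x : Quotient.quot (zspan P)) = x + y.
Proof.
exists (repr (zproj P x : Quotient.quot (zspan P)) - x); last by rewrite addrC subrK.
by apply/zproj_eq0; rewrite raddfB /= {1}/zproj reprK subrr.
Qed.

Variables (W : zmodType) (f : {additive V -> W}).
Hypothesis fP : forall x, P x -> f x = 0.

Lemma zgenerated_ker x : zgenerated P x -> f x = 0.
Proof.
elim=> [y /fP //||y z _ fy _ fz]; first by rewrite raddf0.
by rewrite raddfB fy fz subrr.
Qed.

Definition zlift_def of (forall x, P x -> f x = 0) := fun q : zquot P =>
  f (repr (q : Quotient.quot (zspan P))).
Definition zlift := zlift_def fP.

Lemma zliftE x : zlift (zproj P x) = f x.
Proof.
by rewrite /zlift /zlift_def; have [y Py ->] := zproj_repr x;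
  rewrite raddfD /= (zgenerated_ker Py) addr0.
Qed.

Lemma zlift_is_zmod_morphism : zmod_morphism zlift.
Proof.
move=> p q; have [x ->] := zproj_surj p; have [y ->] := zproj_surj q.
by rewrite -raddfB !zliftE raddfB.
Qed.

HB.instance Definition _ := GRing.isZmodMorphism.Build (zquot P) W zlift
  zlift_is_zmod_morphism.

End QuotientTheory.

Section Subgroup.
Variables (V : zmodType) (Z : zmodClosed V).

Definition zsub : Type := {x : V | x \in Z}.
HB.instance Definition _ := SubChoice.on zsub.
HB.instance Definition _ := [SubChoice_isSubZmodule of zsub by <:].

(** [subquot B] is the quotient of Z by the subgroup generated by the elements
    of B that lie in Z. *)
Definition subquot (B : V -> Prop) : zmodType := zquot (fun x : zsub => B (val x)).

End Subgroup.
Arguments subquot {V} Z B.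

Section SubquotMap.
Variables (V W : zmodType) (Z : zmodClosed V) (Z' : zmodClosed W).
Variables (B : V -> Prop) (B' : W -> Prop) (f : {additive V -> W}).
Hypothesis fZ : forall x, x \in Z -> f x \in Z'.
Hypothesis fB : forall x, B x -> B' (f x).

Definition zsub_map (x : zsub Z) : zsub Z' := Sub (f (val x)) (fZ (valP x)).

Lemma zsub_map_is_zmod_morphism : zmod_morphism zsub_map.
Proof. by move=> x y; apply/val_inj; rewrite raddfB /= !raddfB. Qed.

HB.instance Definition _ := GRing.isZmodMorphism.Build (zsub Z) (zsub Z')
  zsub_map zsub_map_is_zmod_morphism.

Lemma subquot_map_subproof (x : zsub Z) :
  B (val x) -> (zproj (fun y : zsub Z' => B' (val y)) \o zsub_map) x = 0.
Proof. by move=> Bx; apply/zproj_eq0; apply: zgen_in; exact: fB. Qed.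

Definition subquot_map : {additive subquot Z B -> subquot Z' B'} :=
  @zlift _ _ _ (zproj _ \o zsub_map) subquot_map_subproof.

End SubquotMap.

Section KernelImage.
Variables (V W : zmodType) (f : {additive V -> W}).

Definition zker : {pred V} := [pred x | f x == 0].

Lemma zker_closed : zmod_closed zker.
Proof.
split=> [|x y /eqP fx /eqP fy]; apply/eqP; rewrite ?raddf0 //.
by rewrite raddfB fx fy subrr.
Qed.

HB.instance Definition _ := GRing.isZmodClosed.Build V zker zker_closed.

Definition zim (y : W) : Prop := exists x, f x = y.

End KernelImage.

Definition zmod_trivial (V : zmodType) : Prop := forall x : V, x = 0.

Definition zmod_isomorphic (V W : zmodType) : Prop :=
  exists f : {additive V -> W}, bijective f.

Definition zmod_free (V : zmodType) : Prop :=
  exists (K : choiceType) (f : {additive {malg K} -> V}), bijective f.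

Section GroupRing.
Variable G : groupType.

Definition group_ring : Type := {malg G}.
HB.instance Definition _ := GRing.Zmodule.on group_ring.

Definition gr_mul : group_ring -> group_ring -> group_ring :=
  fab_op (fun g h : G => (g * h)%g).

Definition gr_of (g : G) : group_ring := << g >>.

Lemma gr_mulA : associative gr_mul.
Proof. exact: (fab_opA (@mulgA G)). Qed.

Lemma gr_mul1l : left_id (gr_of 1%g) gr_mul.
Proof. exact: (fab_op1l (@mul1g G)). Qed.

Lemma gr_mul1r : right_id (gr_of 1%g) gr_mul.
Proof. exact: (fab_op1r (@mulg1 G)). Qed.

Lemma gr_mulDl : left_distributive gr_mul +%R.
Proof. exact: fab_opDl. Qed.

Lemma gr_mulDr : right_distributive gr_mul +%R.
Proof. exact: fab_opDr. Qed.

Lemma gr_1_neq0 : gr_of 1%g != 0.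
Proof. by rewrite monalgU_eq0 oner_eq0. Qed.

HB.instance Definition _ := GRing.Zmodule_isNzRing.Build group_ring
  gr_mulA gr_mul1l gr_mul1r gr_mulDl gr_mulDr gr_1_neq0.

Definition augmentation : group_ring -> int := fab_lift (fun=> 1).

Definition aug_ideal (x : group_ring) : Prop := augmentation x = 0.

End GroupRing.

Section IdealPower.
Variable R : nzRingType.

Definition ideal_mul (I J : R -> Prop) : R -> Prop :=
  zgenerated (fun z => exists x y, [/\ I x, J y & z = x * y]).

Fixpoint ideal_exp (I : R -> Prop) (n : nat) : R -> Prop :=
  if n is n'.+1 then ideal_mul I (ideal_exp I n') else fun=> True.

End IdealPower.

(** The intersection of G with 1 + g^n, where g is the augmentation ideal. *)
Definition dimension_subgroup (G : groupType) (n : nat) : set G :=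
  [set g | ideal_exp (@aug_ideal G) n (gr_of g - 1)].
Arguments dimension_subgroup : clear implicits.

Section LowerCentral.
Variable G : groupType.

Inductive ggenerated (P : set G) : set G :=
| ggen_in x of P x : ggenerated P x
| ggen_1 : ggenerated P 1%g
| ggen_M x y of ggenerated P x & ggenerated P y : ggenerated P (x * y)%g
| ggen_V x of ggenerated P x : ggenerated P (x^-1)%g.

Definition commutator_subgroup (H K : set G) : set G :=
  ggenerated [set z | exists x y, [/\ H x, K y & z = [~ x, y]%g]].

(** Indexed so that [lower_central 1] is G; [lower_central 0] is G too. *)
Definition lower_central (n : nat) : set G :=
  iter n.-1 (fun H => commutator_subgroup H [set: G]) [set: G].

End LowerCentral.
Arguments lower_central : clear implicits.

Section Abelianization.
Variable G : groupType.

Let gamma2 : set G := lower_central G 2.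

Lemma gamma2R (x y : G) : gamma2 [~ x, y]%g.
Proof. by apply: ggen_in; exists x, y. Qed.

Lemma gamma2J (x y : G) : gamma2 x -> gamma2 (x ^ y)%g.
Proof.
move=> Gx; have -> : (x ^ y = x * [~ x, y])%g by rewrite /commg mulVKg.
by apply: ggen_M => //; apply: gamma2R.
Qed.

Definition ab_equiv (x y : G) : bool := `[< gamma2 (x^-1 * y)%g >].

Lemma ab_equiv_is_equiv : equiv_class_of ab_equiv.
Proof.
split=> [x|x y|y x z].
- by apply/asboolP; rewrite mulVg; apply: ggen_1.
- have sym (a b : G) : ab_equiv a b -> ab_equiv b a.
    move=> /asboolP ab; apply/asboolP.
    by rewrite -[(b^-1 * a)%g]invgK invgM invgK; apply: ggen_V.
  by apply/idP/idP; apply: sym.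
- move=> /asboolP xy /asboolP yz; apply/asboolP.
  have -> : (x^-1 * z = (x^-1 * y) * (y^-1 * z))%g by rewrite mulgA mulgK.
  exact: ggen_M.
Qed.

Canonical ab_equiv_equiv := EquivRelPack ab_equiv_is_equiv.
Canonical ab_equiv_encModRel := defaultEncModRel ab_equiv.

Definition abelianization : Type := {eq_quot ab_equiv}.
HB.instance Definition _ : EqQuotient G ab_equiv abelianization :=
  EqQuotient.on abelianization.
HB.instance Definition _ := Choice.on abelianization.

Definition ab_zero : abelianization := lift_cst abelianization 1%g.
Definition ab_add := lift_op2 abelianization (fun x y : G => (x * y)%g).
Definition ab_opp := lift_op1 abelianization (fun x : G => (x^-1)%g).

Canonical pi_ab_zero_morph := PiConst ab_zero.

Lemma ab_equivP (x y : G) : reflect (gamma2 (x^-1 * y)%g)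
  (\pi_abelianization x == \pi_abelianization y).
Proof. by rewrite piE; apply: asboolP. Qed.

Lemma ab_repr (x : G) : gamma2 (x^-1 * repr (\pi_abelianization x))%g.
Proof. by apply/ab_equivP; rewrite reprK. Qed.

Lemma pi_ab_opp : {morph \pi : x / (x^-1)%g >-> ab_opp x}.
Proof.
move=> x; unlock ab_opp; apply/eqP/ab_equivP.
set y := repr _; have xy : gamma2 (x^-1 * y)%g := ab_repr x.
have -> : (x^-1^-1 * y^-1 = ((x^-1 * y)^-1) ^ x^-1)%g.
  by rewrite conjgE invgM !invgK mulgK.
by apply: gamma2J; apply: ggen_V.
Qed.
Canonical pi_ab_opp_morph := PiMorph1 pi_ab_opp.

Lemma pi_ab_add : {morph \pi : x y / (x * y)%g >-> ab_add x y}.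
Proof.
move=> x y; unlock ab_add; apply/eqP/ab_equivP.
set x' := repr (_ x); set y' := repr _.
have xx' : gamma2 (x^-1 * x')%g := ab_repr x.
have yy' : gamma2 (y^-1 * y')%g := ab_repr y.
have -> : ((x * y)^-1 * (x' * y') = (x^-1 * x') ^ y * (y^-1 * y'))%g.
  by rewrite conjgE invgM !mulgA mulgK.
by apply: ggen_M => //; apply: gamma2J.
Qed.
Canonical pi_ab_add_morph := PiMorph2 pi_ab_add.

Lemma ab_addA : associative ab_add.
Proof. by move=> x y z; rewrite -[x]reprK -[y]reprK -[z]reprK !piE mulgA. Qed.

Lemma ab_addC : commutative ab_add.
Proof.
move=> x y; rewrite -[x]reprK -[y]reprK -!pi_ab_add; apply/eqP/ab_equivP.
set a := repr x; set b := repr y.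
have -> : ((a * b)^-1 * (b * a) = [~ b, a])%g.
  by rewrite /commg /conjg invgM !mulgA.
exact: gamma2R.
Qed.

Lemma ab_add0 : left_id ab_zero ab_add.
Proof. by move=> x; rewrite -[x]reprK !piE mul1g. Qed.

Lemma ab_addN : left_inverse ab_zero ab_opp ab_add.
Proof. by move=> x; rewrite -[x]reprK !piE mulVg. Qed.

HB.instance Definition _ := GRing.isZmodule.Build abelianization
  ab_addA ab_addC ab_add0 ab_addN.

End Abelianization.

Section GroupHomology.
Variable G : groupType.

Definition bar (n : nat) : zmodType := {malg {ffun 'I_n -> G}}.

(** The i-th face of (g_0, ..., g_n): drop g_0 if i = 0, drop g_n if i = n + 1,
    and multiply g_(i-1) and g_i otherwise.  Here [lift ord_max j] and
    [lift ord0 j] are the indices j and j + 1 in ['I_n.+1]. *)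
Definition bar_face n (i : 'I_n.+2) (g : {ffun 'I_n.+1 -> G}) : {ffun 'I_n -> G} :=
  [ffun j : 'I_n => if (j.+1 < i)%N then g (lift ord_max j)
    else if (j.+1 == i)%N then (g (lift ord_max j) * g (lift ord0 j))%g
    else g (lift ord0 j)].

Definition bar_diff n : {additive bar n.+1 -> bar n} :=
  fab_lift (fun g => \sum_(i < n.+2) (-1) ^+ i *: << bar_face i g >>).

Definition bar_cycle n : {pred bar n} :=
  if n is n'.+1 then zker (bar_diff n') else predT.

Arguments bar_cycle : clear implicits.

Lemma bar_cycle_closed n : zmod_closed (bar_cycle n).
Proof. by case: n => [|n] //=; exact: zker_closed. Qed.

HB.instance Definition _ n :=
  GRing.isZmodClosed.Build (bar n) (bar_cycle n) (bar_cycle_closed n).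

Definition group_homology (n : nat) : zmodType :=
  subquot (bar_cycle n) (zim (bar_diff n)).

End GroupHomology.
Arguments group_homology : clear implicits.

Section Tor.
Variable A : zmodType.

Definition tor_ok (m : nat) (x y : A) : bool :=
  [&& (0 < m)%N, x *+ m == 0 & y *+ m == 0].

Definition tor_symbol := {s : nat * A * A | tor_ok s.1.1 s.1.2 s.2}.

Definition tor_sym m x y (h : tor_ok m x y) : {malg tor_symbol} :=
  << exist _ (m, x, y) h >>.

Inductive tor_rel : {malg tor_symbol} -> Prop :=
| tor_addl m x1 x2 y (h : tor_ok m (x1 + x2) y)
    (h1 : tor_ok m x1 y) (h2 : tor_ok m x2 y) :
    tor_rel (tor_sym h - tor_sym h1 - tor_sym h2)
| tor_addr m x y1 y2 (h : tor_ok m x (y1 + y2))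
    (h1 : tor_ok m x y1) (h2 : tor_ok m x y2) :
    tor_rel (tor_sym h - tor_sym h1 - tor_sym h2)
| tor_mull m n x y (h : tor_ok (m * n)%N x y) (h' : tor_ok m (x *+ n) y) :
    tor_rel (tor_sym h - tor_sym h')
| tor_mulr m n x y (h : tor_ok (m * n)%N x y) (h' : tor_ok m x (y *+ n)) :
    tor_rel (tor_sym h - tor_sym h').

Definition Tor : zmodType := zquot tor_rel.

Definition tau m x y (h : tor_ok m x y) : Tor := zproj tor_rel (tor_sym h).

(** The quotient of Tor(A, A) by the subgroup generated by all tau_m(x, x). *)
Definition ext_tor : zmodType :=
  zquot (fun t : Tor => exists m x (h : tor_ok m x x), t = tau h).

End Tor.

(** The free ring on the set A is [{malg {fmonom A}}]; the tensor algebra of the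
    abelian group A is its quotient by the two-sided ideal that makes the
    generators additive. *)
Section Tensor.
Variable A : zmodType.

Definition tens_gen (a : A) : {malg {fmonom A}} := << FMonom [:: a] >>.

Inductive tens_rel : {malg {fmonom A}} -> Prop :=
| tens_add a b : tens_rel (tens_gen (a + b) - tens_gen a - tens_gen b)
| tens_mull x r of tens_rel r : tens_rel (x * r)
| tens_mulr x r of tens_rel r : tens_rel (r * x).

Definition tensor_algebra : zmodType := zquot tens_rel.

(** The n-th tensor power of A, as the degree n part of the tensor algebra. *)
Definition tensor_power (n : nat) : {pred tensor_algebra} :=
  zspan (fun t => exists2 w : {fmonom A}, fdeg w = n & t = zproj tens_rel << w >>).

HB.instance Definition _ n := GRing.ZmodClosed.on (tensor_power n).

End Tensor.
Arguments tensor_power : clear implicits.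

Inductive lie_word (A : Type) : Type :=
| lie_leaf of A
| lie_node of lie_word A & lie_word A.

HB.instance Definition _ (A : Type) := gen_eqMixin (lie_word A).
HB.instance Definition _ (A : Type) := gen_choiceMixin (lie_word A).

Fixpoint lie_deg (A : Type) (w : lie_word A) : nat :=
  match w with
  | lie_leaf _ => 1
  | lie_node u v => (lie_deg u + lie_deg v)%N
  end.

(** [{malg (lie_word A)}] with the product [lie_op] is the free nonassociative
    ring on the set A; the free Lie ring on the abelian group A is its quotient
    by the two-sided ideal generated by the Lie identities and the additivity of
    the generators. *)
Section Lie.
Variable A : zmodType.

Definition lie_gen (a : A) : {malg (lie_word A)} := << lie_leaf a >>.
Definition lie_op := fab_op (@lie_node A).

Inductive lie_rel : {malg (lie_word A)} -> Prop :=
| lie_add a b : lie_rel (lie_gen (a + b) - lie_gen a - lie_gen b)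
| lie_alt x : lie_rel (lie_op x x)
| lie_jacobi x y z :
    lie_rel (lie_op x (lie_op y z) + lie_op y (lie_op z x) + lie_op z (lie_op x y))
| lie_idl x r of lie_rel r : lie_rel (lie_op x r)
| lie_idr x r of lie_rel r : lie_rel (lie_op r x).

Definition free_lie : zmodType := zquot lie_rel.

Definition lie_component (n : nat) : {pred free_lie} :=
  zspan (fun t => exists2 w : lie_word A, lie_deg w = n & t = zproj lie_rel << w >>).

(** The natural map to the tensor algebra sends brackets to commutators. *)
Fixpoint lie_expand (w : lie_word A) : {malg {fmonom A}} :=
  match w with
  | lie_leaf a => tens_gen a
  | lie_node u v => lie_expand u * lie_expand v - lie_expand v * lie_expand u
  end.

Lemma commutator_subl (R : nzRingType) (u v w : R) :
  u * w - w * u - (v * w - w * v) = (u - v) * w - w * (u - v).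
Proof.
by rewrite mulrBl mulrBr !opprB addrACA [RHS]addrACA (addrC (- (w * u))).
Qed.

Lemma commutator_subr (R : nzRingType) (u v w : R) :
  w * u - u * w - (w * v - v * w) = w * (u - v) - (u - v) * w.
Proof.
by rewrite mulrBl mulrBr !opprB addrACA [RHS]addrACA (addrC (- (u * w))).
Qed.

Lemma commutator_jacobi (R : nzRingType) (a b c : R) :
  a * (b * c - c * b) - (b * c - c * b) * a
  + (b * (c * a - a * c) - (c * a - a * c) * b)
  + (c * (a * b - b * a) - (a * b - b * a) * c) = 0.
Proof.
rewrite !mulrBr !mulrBl !mulrA !opprB !addrA.
rewrite (ACl ((1*12)*(2*7)*(3*10)*(4*5)*(6*11)*(8*9))) /=.
by rewrite !(addrC (- _)) !subrr !addr0.
Qed.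

Lemma lie_expand_op x y : fab_lift lie_expand (lie_op x y) =
  fab_lift lie_expand x * fab_lift lie_expand y
  - fab_lift lie_expand y * fab_lift lie_expand x.
Proof.
have phiB := fab_liftB lie_expand; have phi0 := fab_lift0 lie_expand.
rewrite /lie_op; elim/fab_ind: x => [|a b Ea Eb|u].
- by rewrite fab_op0l phi0 mul0r mulr0 subrr.
- rewrite fab_opBl 2!phiB.
  exact (etrans (f_equal2 (fun s t => s - t) Ea Eb) (commutator_subl _ _ _)).
elim/fab_ind: y => [|a b Ea Eb|v].
- by rewrite fab_op0r phi0 mul0r mulr0 subrr.
- rewrite fab_opBr 2!phiB.
  exact (etrans (f_equal2 (fun s t => s - t) Ea Eb) (commutator_subr _ _ _)).
by rewrite fab_opUU !fab_liftU.
Qed.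

Lemma tens_mull_gen x r : zgenerated (@tens_rel A) r -> zgenerated (@tens_rel A) (x * r).
Proof.
elim=> [s Rs||s t _ IHs _ IHt]; first by apply: zgen_in; apply: tens_mull.
  by rewrite mulr0; apply: zgen_0.
rewrite mulrBr; exact (zgen_B IHs IHt).
Qed.

Lemma tens_mulr_gen x r : zgenerated (@tens_rel A) r -> zgenerated (@tens_rel A) (r * x).
Proof.
elim=> [s Rs||s t _ IHs _ IHt]; first by apply: zgen_in; apply: tens_mulr.
  by rewrite mul0r; apply: zgen_0.
rewrite mulrBl; exact (zgen_B IHs IHt).
Qed.

Lemma lie_expand_rel r : lie_rel r -> zgenerated (@tens_rel A) (fab_lift lie_expand r).
Proof.
elim=> {r} [a b|x|x y z|x r _ IH|x r _ IH].
- by rewrite !raddfB /= !fab_liftU; apply: zgen_in; apply: tens_add.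
- by rewrite lie_expand_op subrr; apply: zgen_0.
- rewrite 2!fab_liftD 6!lie_expand_op.
  exact (eq_ind_r (zgenerated _) (zgen_0 _) (commutator_jacobi _ _ _)).
- rewrite lie_expand_op.
  exact (zgen_B (tens_mull_gen _ IH) (tens_mulr_gen _ IH)).
- rewrite lie_expand_op.
  exact (zgen_B (tens_mulr_gen _ IH) (tens_mull_gen _ IH)).
Qed.

Lemma lie_to_tensor_subproof r : lie_rel r ->
  (zproj (@tens_rel A) \o fab_lift lie_expand) r = 0.
Proof. by move=> Rr; apply/zproj_eq0; apply: lie_expand_rel. Qed.

Definition lie_to_tensor : {additive free_lie -> tensor_algebra A} :=
  @zlift _ _ _ (zproj _ \o fab_lift lie_expand) lie_to_tensor_subproof.

(** The cokernel of L_n(A) -> A^{(x) n}; see [lie_to_tensor_component] below. *)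
Definition Sfun (n : nat) : zmodType :=
  subquot (tensor_power A n) (fun t => exists2 x, x \in lie_component n & lie_to_tensor x = t).

End Lie.
Arguments lie_component : clear implicits.
Arguments lie_to_tensor {A}.

Record zfunctor := ZFunctor {
  fun_obj :> zmodType -> zmodType;
  fun_map : forall A B : zmodType,
    {additive A -> B} -> {additive fun_obj A -> fun_obj B};
  fun_map_id : forall (A : zmodType) (f : {additive A -> A}),
    f =1 id -> fun_map f =1 id;
  fun_map_comp : forall (A B C : zmodType) (f : {additive A -> B})
    (g : {additive B -> C}) (h : {additive A -> C}),
    h =1 g \o f -> fun_map h =1 fun_map g \o fun_map f
}.

Section SfunMap.
Variables (A B : zmodType) (f : {additive A -> B}).

Definition fmonom_map (w : {fmonom A}) : {fmonom B} := FMonom (map f w).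

Fixpoint lie_word_map (w : lie_word A) : lie_word B :=
  match w with
  | lie_leaf a => lie_leaf (f a)
  | lie_node u v => lie_node (lie_word_map u) (lie_word_map v)
  end.

Definition free_ring_map : {additive {malg {fmonom A}} -> {malg {fmonom B}}} :=
  fab_lift (fun w => << fmonom_map w >>).

Definition free_lie_map0 : {additive {malg (lie_word A)} -> {malg (lie_word B)}} :=
  fab_lift (fun w => << lie_word_map w >>).

Lemma free_ring_mapM x y : free_ring_map (x * y) = free_ring_map x * free_ring_map y.
Proof.
have phiB s t : free_ring_map (s - t) = free_ring_map s - free_ring_map t.
  exact: raddfB.
elim/fab_ind: x => [|a b Ea Eb|u]; first by rewrite !(mul0r, raddf0).
  rewrite mulrBl 2!phiB.
  exact (etrans (f_equal2 (fun s t => s - t) Ea Eb) (esym (mulrBl _ _ _))).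
elim/fab_ind: y => [|a b Ea Eb|v]; first by rewrite !(mulr0, raddf0).
  rewrite mulrBr 2!phiB.
  exact (etrans (f_equal2 (fun s t => s - t) Ea Eb) (esym (mulrBr _ _ _))).
rewrite malgM_def fgmulUU mulr1 /free_ring_map /= !fab_liftU malgM_def fgmulUU mulr1.
by congr << _ >>; rewrite /fmonom_map /mmul /= /fmmul !fmE /= map_cat.
Qed.

Lemma free_lie_map0_op x y :
  free_lie_map0 (lie_op x y) = lie_op (free_lie_map0 x) (free_lie_map0 y).
Proof.
rewrite /free_lie_map0 /=; set psi := fab_lift _.
have psiB : forall s t, psi (s - t) = psi s - psi t := fab_liftB _.
have psi0 : psi 0 = 0 := fab_lift0 _.
rewrite /lie_op; elim/fab_ind: x => [|a b Ea Eb|u].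
- by rewrite fab_op0l psi0 fab_op0l.
- by rewrite fab_opBl 2!psiB Ea Eb fab_opBl.
elim/fab_ind: y => [|a b Ea Eb|v].
- by rewrite fab_op0r psi0 fab_op0r.
- by rewrite fab_opBr 2!psiB Ea Eb fab_opBr.
by rewrite fab_opUU /psi !fab_liftU fab_opUU.
Qed.

Lemma tens_map_subproof r : tens_rel r ->
  (zproj (@tens_rel B) \o free_ring_map) r = 0.
Proof.
move=> Rr; apply/zproj_eq0; elim: Rr => {r} [a b|x r _ IH|x r _ IH].
- rewrite !raddfB /free_ring_map /= !fab_liftU /fmonom_map /= raddfD.
  by apply: zgen_in; apply: tens_add.
- by rewrite free_ring_mapM; apply: tens_mull_gen.
- by rewrite free_ring_mapM; apply: tens_mulr_gen.
Qed.

Definition tens_map : {additive tensor_algebra A -> tensor_algebra B} :=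
  @zlift _ _ _ (zproj _ \o free_ring_map) tens_map_subproof.

Lemma tens_mapE x : tens_map (zproj _ x) = zproj _ (free_ring_map x).
Proof. exact: zliftE. Qed.

Lemma lie_map_subproof r : lie_rel r ->
  (zproj (@lie_rel B) \o free_lie_map0) r = 0.
Proof.
have idl (x s : {malg (lie_word B)}) :
  zgenerated (@lie_rel B) s -> zgenerated (@lie_rel B) (lie_op x s).
  elim=> [t Rt||t u _ IHt _ IHu]; first by apply: zgen_in; apply: lie_idl.
    by rewrite /lie_op fab_op0r; apply: zgen_0.
  by rewrite /lie_op fab_opBr; apply: zgen_B.
have idr (x s : {malg (lie_word B)}) :
  zgenerated (@lie_rel B) s -> zgenerated (@lie_rel B) (lie_op s x).
  elim=> [t Rt||t u _ IHt _ IHu]; first by apply: zgen_in; apply: lie_idr.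
    by rewrite /lie_op fab_op0l; apply: zgen_0.
  by rewrite /lie_op fab_opBl; apply: zgen_B.
move=> Rr; apply/zproj_eq0; elim: Rr => {r} [a b|x|x y z|x r _ IH|x r _ IH].
- rewrite !raddfB /free_lie_map0 /= !fab_liftU /= raddfD.
  by apply: zgen_in; apply: lie_add.
- by rewrite free_lie_map0_op; apply: zgen_in; apply: lie_alt.
- by rewrite !raddfD !free_lie_map0_op; apply: zgen_in; apply: lie_jacobi.
- by rewrite free_lie_map0_op; apply: idl.
- by rewrite free_lie_map0_op; apply: idr.
Qed.

Definition lie_map : {additive free_lie A -> free_lie B} :=
  @zlift _ _ _ (zproj _ \o free_lie_map0) lie_map_subproof.

Lemma lie_mapE x : lie_map (zproj _ x) = zproj _ (free_lie_map0 x).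
Proof. exact: zliftE. Qed.

Lemma lie_to_tensorE (C : zmodType) x :
  lie_to_tensor (zproj (@lie_rel C) x) = zproj _ (fab_lift (@lie_expand C) x).
Proof. exact: zliftE. Qed.

Lemma lie_deg_map w : lie_deg (lie_word_map w) = lie_deg w.
Proof. by elim: w => //= u -> v ->. Qed.

Lemma lie_expand_map x : fab_lift (@lie_expand B) (free_lie_map0 x) =
  free_ring_map (fab_lift (@lie_expand A) x).
Proof.
elim/fab_ind: x => [|x y Ex Ey|w]; first by rewrite !raddf0.
  rewrite (raddfB free_lie_map0) !fab_liftB (raddfB free_ring_map).
  exact (f_equal2 (fun s t => s - t) Ex Ey).
rewrite /free_lie_map0 /= !fab_liftU.
elim: w => [a|u IHu v IHv] /=; first by rewrite /free_ring_map /= fab_liftU.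
rewrite (raddfB free_ring_map) (free_ring_mapM (lie_expand u)).
rewrite (free_ring_mapM (lie_expand v)).
exact (f_equal2 (fun s t => s - t) (f_equal2 *%R IHu IHv) (f_equal2 *%R IHv IHu)).
Qed.

Lemma lie_to_tensor_natural x : lie_to_tensor (lie_map x) = tens_map (lie_to_tensor x).
Proof.
have [y ->] := zproj_surj x.
by rewrite lie_mapE !lie_to_tensorE tens_mapE lie_expand_map.
Qed.

Lemma zspan_map (V W : zmodType) (P : V -> Prop) (Q : W -> Prop)
    (g : {additive V -> W}) : (forall x, P x -> Q (g x)) ->
  forall x, x \in zspan P -> g x \in zspan Q.
Proof.
move=> PQ x /zspanP Px; apply/zspanP.
elim: Px => [y /PQ /zgen_in //||y z _ IHy _ IHz].
  by rewrite raddf0; apply: zgen_0.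
by rewrite raddfB; apply: zgen_B.
Qed.

Lemma tens_map_power n x : x \in tensor_power A n -> tens_map x \in tensor_power B n.
Proof.
apply: zspan_map => _ [w <- ->]; exists (fmonom_map w).
  by rewrite /fdeg size_map.
by rewrite tens_mapE /free_ring_map /= fab_liftU.
Qed.

Lemma lie_map_component n x : x \in lie_component A n -> lie_map x \in lie_component B n.
Proof.
apply: zspan_map => _ [w <- ->]; exists (lie_word_map w); first exact: lie_deg_map.
by rewrite lie_mapE /free_lie_map0 /= fab_liftU.
Qed.

Variable n : nat.

Lemma tens_map_lie t :
  (exists2 x, x \in lie_component A n & lie_to_tensor x = t) ->
  exists2 x, x \in lie_component B n & lie_to_tensor x = tens_map t.
Proof.
case=> x Lx <-; exists (lie_map x); first exact: lie_map_component.
exact: lie_to_tensor_natural.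
Qed.

Definition Sfun_map : {additive Sfun A n -> Sfun B n} :=
  subquot_map (@tens_map_power n) tens_map_lie.

End SfunMap.

Lemma lie_to_tensor_component (A : zmodType) n (x : free_lie A) :
  x \in lie_component A n -> lie_to_tensor x \in tensor_power A n.
Proof.
move=> /zspanP; elim=> [_ [w <- ->]||y z _ IHy _ IHz]; last 2 first.
- by rewrite raddf0 rpred0.
- by rewrite raddfB rpredB.
rewrite lie_to_tensorE fab_liftU.
pose Q k (t : {malg {fmonom A}}) :=
  zgenerated (fun s => exists2 w : {fmonom A}, fdeg w = k & s = << w >>) t.
have QM k l s t : Q k s -> Q l t -> Q (k + l)%N (s * t).
  move=> Qs Qt; elim: Qs => [_ [u uk ->]||a b _ IHa _ IHb]; last 2 first.
  - by rewrite mul0r; apply: zgen_0.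
  - by rewrite mulrBl; exact (zgen_B IHa IHb).
  elim: Qt => [_ [v vl ->]||a b _ IHa _ IHb]; last 2 first.
  - by rewrite mulr0; apply: zgen_0.
  - by rewrite mulrBr; exact (zgen_B IHa IHb).
  apply: zgen_in; exists (mmul u v); last by rewrite malgM_def fgmulUU mulr1.
  by rewrite -uk -vl /fdeg /mmul /= /fmmul fmE /= size_cat.
have : Q (lie_deg w) (lie_expand w).
  elim: w => [a|u IHu v IHv] /=; first by apply: zgen_in; exists (FMonom [:: a]).
  by apply: zgen_B; [|rewrite addnC]; apply: QM.
move=> Qw; apply/zspanP; elim: Qw => [_ [u uk ->]||a b _ IHa _ IHb].
- by apply: zgen_in; exists u.
- by rewrite raddf0; apply: zgen_0.
- by rewrite raddfB; apply: zgen_B.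
Qed.

Lemma Sfun_mapE (A B : zmodType) (f : {additive A -> B}) n
    (x : zsub (tensor_power A n)) :
  Sfun_map f n (zproj _ x) = zproj _ (zsub_map (@tens_map_power _ _ f n) x).
Proof. exact: zliftE. Qed.

Lemma Sfun_map_id n (A : zmodType) (f : {additive A -> A}) :
  f =1 id -> Sfun_map f n =1 id.
Proof.
move=> f1 q; have [x ->] := zproj_surj q; rewrite Sfun_mapE; congr (zproj _ _).
apply/val_inj; change (tens_map f (val x) = val x).
have [y ->] := zproj_surj (val x); rewrite tens_mapE.
congr (zproj _ _); move: y; apply: (@fab_ext _ _ (free_ring_map f) idfun) => w.
rewrite /free_ring_map /= fab_liftU; congr << _ >>.
by case: w => s; rewrite /fmonom_map /= (eq_map f1) map_id.
Qed.

Lemma Sfun_map_comp n (A B C : zmodType) (f : {additive A -> B})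
    (g : {additive B -> C}) (h : {additive A -> C}) :
  h =1 g \o f -> Sfun_map h n =1 Sfun_map g n \o Sfun_map f n.
Proof.
move=> hgf q; rewrite -[RHS]/(Sfun_map g n (Sfun_map f n q)).
have [x ->] := zproj_surj q; rewrite !Sfun_mapE.
congr (zproj _ _); apply/val_inj.
change (tens_map h (val x) = tens_map g (tens_map f (val x))).
have [y ->] := zproj_surj (val x); rewrite !tens_mapE; congr (zproj _ _); move: y.
apply: (@fab_ext _ _ (free_ring_map h) (free_ring_map g \o free_ring_map f)) => w.
rewrite /free_ring_map /= !fab_liftU; congr << _ >>.
by case: w => s; rewrite /fmonom_map /= -map_comp (eq_map hgf).
Qed.

Definition S_ (n : nat) : zfunctor :=
  ZFunctor (@Sfun_map_id n) (@Sfun_map_comp n).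

(** A simplicial abelian group is presented as a contravariant functor on the
    category of the ordinals {0 < ... < n} and monotone maps. *)
Record simplex_map (m n : nat) := SimplexMap {
  simplex_fun :> 'I_m.+1 -> 'I_n.+1;
  simplex_mono : {homo simplex_fun : i j / (i <= j)%N}
}.

Record simplicial_zmod := SimplicialZmod {
  simp_obj :> nat -> zmodType;
  simp_map : forall m n, simplex_map m n -> {additive simp_obj n -> simp_obj m};
  simp_map_id : forall n (a : simplex_map n n), a =1 id -> simp_map a =1 id;
  simp_map_comp : forall m n p (a : simplex_map m n) (b : simplex_map n p)
    (c : simplex_map m p), c =1 b \o a -> simp_map c =1 simp_map a \o simp_map b
}.

Lemma lift_mono n (i : 'I_n.+2) :
  {homo (lift i : 'I_n.+1 -> 'I_n.+2) : j k / (j <= k)%N}.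
Proof. by move=> j k jk; rewrite /= leq_bump2. Qed.

Definition coface n (i : 'I_n.+2) : simplex_map n n.+1 := SimplexMap (@lift_mono n i).

Section HomotopyGroups.
Variable X : simplicial_zmod.

Definition face n (i : 'I_n.+2) : {additive X n.+1 -> X n} := simp_map X (coface i).

Definition moore_cycle (n : nat) : {pred X n} :=
  match n return {pred X n} with
  | 0 => predT
  | n'.+1 => [pred x | [forall i, face i x == 0]]
  end.

Lemma moore_cycle_closed n : zmod_closed (@moore_cycle n).
Proof.
case: n => [|n] //=; split=> [|x y /forallP cx /forallP cy]; apply/forallP => i.
  by rewrite raddf0.
by rewrite raddfB (eqP (cx i)) (eqP (cy i)) subrr.
Qed.

HB.instance Definition _ n :=
  GRing.isZmodClosed.Build (X n) (@moore_cycle n) (@moore_cycle_closed n).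

Definition moore_boundary (n : nat) (x : X n) : Prop :=
  exists2 y : X n.+1, (forall i, i != ord_max -> face i y = 0) & face ord_max y = x.

(** pi_n(X, 0): n-simplices with trivial boundary, up to homotopy rel boundary. *)
Definition homotopy_group (n : nat) : zmodType :=
  subquot (@moore_cycle n) (@moore_boundary n).

End HomotopyGroups.

Section Compose.
Variables (T : zfunctor) (X : simplicial_zmod).

Lemma simp_comp_id n (a : simplex_map n n) :
  a =1 id -> fun_map T (simp_map X a) =1 id.
Proof. by move=> a1; apply: fun_map_id; apply: simp_map_id. Qed.

Lemma simp_comp_comp m n p (a : simplex_map m n) (b : simplex_map n p)
    (c : simplex_map m p) : c =1 b \o a ->
  fun_map T (simp_map X c) =1 fun_map T (simp_map X a) \o fun_map T (simp_map X b).
Proof. by move=> cba; apply: fun_map_comp; apply: simp_map_comp. Qed.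

Definition simp_comp : simplicial_zmod :=
  @SimplicialZmod (fun n => T (X n)) (fun m n a => fun_map T (simp_map X a))
    simp_comp_id simp_comp_comp.

End Compose.

Definition free_simplicial_resolution (X : simplicial_zmod) (A : zmodType) : Prop :=
  [/\ forall n, zmod_free (X n),
      zmod_isomorphic (homotopy_group X 0) A
    & forall j, (0 < j)%N -> zmod_trivial (homotopy_group X j)].

(** The group D_i T(A), computed from a free simplicial resolution X of A; up to
    isomorphism it does not depend on X. *)
Definition derived_functor (i : nat) (T : zfunctor) (X : simplicial_zmod) : zmodType :=
  homotopy_group (simp_comp T X) i.

(* Main.v *)
Require Import Defs.
From mathcomp Require Import all_boot.
From HB Require Import structures.
From mathcomp Require Import all_order all_algebra.
From mathcomp Require Import finmap boolp classical_sets.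
From mathcomp.multinomials Require Import monalg.
From mathcomp Require Import zify.

(** Write A for the abelianization of G and M for the free ring on letters X_g, truncated in
    degrees at least 5; Z[G] is a quotient of the free ring by an ideal [rr].  Let Fs be the
    group generated by the pairs (g, 1 + X_g) in G x M^*, and call an element (1, u) of Fs a
    relator.  If g lies in D_5(G), then X_g lies in [rr], and one shows inductively that some
    (g, u) lies in the n-th term of the lower central series of Fs.  In this step u - 1 is an
    element of [rr] of order n, and the point is that, modulo the products [rk] of more factors,
    it is u' - 1 for a relator (1, u') in the same term: dividing by this relator makes the
    leading term of u vanish in the tensor power of A, and an element of the lower central
    series with this property lies one step further down, up to a relator in 1 + [rk].
    Relators of the required kind exist in degree 2 by H_2(G) = 0, in degree 3 because Tor(A, A)
    is spanned by the symbols tau_m(x, x), which give commutators of relators, and in degree 4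
    because D_1 S_3(A) = 0 writes a cycle of tensors, modulo boundaries, as a Lie element, which
    group commutators realise. *)

Set Implicit Arguments.
Unset Strict Implicit.
Unset Printing Implicit Defensive.

Import GRing.Theory.

Local Open Scope classical_set_scope.
Local Open Scope ring_scope.

(** Two obstacles shape the proof. The group A may have torsion, so leading terms live in the tensor
    algebra of a non-free group, and Lie elements of degree 2 to 4 must be detected there; this
    rests on splitting the finitely many elements involved into cyclic pieces. In degree 4 the
    resolution is arbitrary and knows nothing of the letters X_g. Freeness gives maps over A in both
    directions between its degree 0 part and the free abelian group on G, but their composite need
    not be the identity. It is lifted to an endomorphism [eta] of M that fixes every letter modulo
    [rr], and therefore changes an element of order n only by an element of [rk n]. A 1-simplex is
    turned into two elements of Fs with the same component in G. The choice of these elements is not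
    additive, and H_2(G) = 0 is used again to push the defect into a higher [rk]. A tensor on a
    2-simplex then expresses the value of one face through the other two, and those two are Lie
    elements up to tensor relations because S_3 is the cokernel of the Lie part. *)

(** * Additive identities by reflection *)

Section ZmodReflection.

Inductive zexpr := ZVar of nat | ZZero | ZAdd of zexpr & zexpr | ZOpp of zexpr.

Fixpoint zeval (V : zmodType) (env : seq V) (e : zexpr) : V :=
  match e with
  | ZVar n => nth 0 env n
  | ZZero => 0
  | ZAdd a b => zeval env a + zeval env b
  | ZOpp a => - zeval env a
  end.

Fixpoint zcoef (i : nat) (e : zexpr) : int :=
  match e with
  | ZVar n => if n == i then 1 else 0
  | ZZero => 0
  | ZAdd a b => zcoef i a + zcoef i b
  | ZOpp a => - zcoef i a
  end.

Lemma zevalE (V : zmodType) (env : seq V) e :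
  zeval env e = \sum_(i < size env) nth 0 env i *~ zcoef i e.
Proof.
elim: e => [n||a IHa b IHb|a IHa] /=; rewrite ?IHa ?IHb.
- have [ltn|gen] := ltnP n (size env).
    rewrite (bigD1 (Ordinal ltn)) //= eqxx mulr1z big1 ?addr0 // => i ne.
    by rewrite ifN ?mulr0z // eq_sym.
  rewrite nth_default // big1 // => i _; rewrite ifN ?mulr0z //.
  by rewrite neq_ltn (leq_trans (ltn_ord i) gen) orbT.
- by rewrite big1 // => i _; rewrite mulr0z.
- by rewrite -big_split; apply: eq_bigr => i _; rewrite mulrzDr.
- by rewrite -sumrN; apply: eq_bigr => i _; rewrite mulrNz.
Qed.

(** On reified terms the hypothesis is a closed boolean, so [zmod] proves it by computation with
    [isT]. *)
Lemma zeval_eq (V : zmodType) (env : seq V) e1 e2 :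
  all (fun i => zcoef i e1 == zcoef i e2) (iota 0 (size env)) ->
  zeval env e1 = zeval env e2.
Proof.
move=> /allP E; rewrite !zevalE; apply: eq_bigr => i _.
by rewrite (eqP (E i _)) // mem_iota ltn_ord.
Qed.

End ZmodReflection.

(* Syntactic equality, up to the structures carried by the terms. *)
Ltac zhead x := lazymatch x with ?f _ => zhead f | _ => x end.
Ltac zsame x y :=
  first [ constr_eq x y
        | lazymatch x with
          | @GRing.mul _ ?a ?b =>
            lazymatch y with @GRing.mul _ ?c ?d => zsame a c; zsame b d end
          | @GRing.one _ => lazymatch y with @GRing.one _ => idtac end
          | _ => let f := zhead x in let g := zhead y in constr_eq f g; unify x y
          end ].
Ltac zfind x l :=
  lazymatch l with
  | nil => constr:(O)
  | ?y :: ?l' =>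
    match l with
    | _ => let _ := match goal with _ => zsame x y end in constr:(O)
    | _ => let n := zfind x l' in constr:(S n)
    end
  end.
Ltac zmem x l :=
  lazymatch l with
  | nil => constr:(false)
  | ?y :: ?l' =>
    match l with
    | _ => let _ := match goal with _ => zsame x y end in constr:(true)
    | _ => zmem x l'
    end
  end.
Ltac zatoms t l :=
  lazymatch t with
  | @GRing.add _ ?a ?b => let l' := zatoms a l in zatoms b l'
  | @GRing.opp _ ?a => zatoms a l
  | @GRing.zero _ => l
  | _ => lazymatch zmem t l with true => l | false => constr:(t :: l) end
  end.
Ltac zreify t l :=
  lazymatch t with
  | @GRing.add _ ?a ?b =>
    let x := zreify a l in let y := zreify b l in constr:(ZAdd x y)
  | @GRing.opp _ ?a => let x := zreify a l in constr:(ZOpp x)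
  | @GRing.zero _ => constr:(ZZero)
  | _ => let n := zfind t l in constr:(ZVar n)
  end.
Ltac zmod :=
  rewrite ?[_ *+ 2]mulr2n;
  lazymatch goal with
  | |- @eq ?V ?a ?b =>
    let l := zatoms a (@nil V) in let l := zatoms b l in
    let x := zreify a l in let y := zreify b l in
    exact (@zeval_eq _ l x y isT)
  end.
(** Products are fully distributed and reassociated to the left, so that each noncommutative
    monomial becomes one atom for [zmod]. *)
Ltac ncring :=
  rewrite ?(mulrDl, mulrDr, mulrBl, mulrBr, mulNr, mulrN, mulrA, mul1r, mulr1,
            mul0r, mulr0, opprD, opprB, opprK, addrA, expr2);
  zmod.

(** * Additive subgroups as predicates *)

Section Zclosed.
Variable V : zmodType.
Implicit Types (S P : V -> Prop).

(** Subgroups are plain predicates, so membership may be an existential or a congruence. Through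
    [zgen_sub], an induction on generators then amounts to showing that the goal itself is
    closed. *)
Definition zclosed S := S 0 /\ forall x y, S x -> S y -> S (x - y).

Lemma zclosed_gen P : zclosed (zgenerated P).
Proof. by split=> [|x y]; [exact: zgen_0 | exact: zgen_B]. Qed.

Lemma zgen_sub P S : zclosed S -> (forall x, P x -> S x) -> forall x, zgenerated P x -> S x.
Proof. by move=> [S0 SB] PS x; elim=> // y z _ Sy _ Sz; apply: SB. Qed.

Lemma zclosedN S x : zclosed S -> S x -> S (- x).
Proof. by move=> [S0 SB] Sx; rewrite -sub0r; apply: SB. Qed.

Lemma zclosedD S x y : zclosed S -> S x -> S y -> S (x + y).
Proof.
by move=> Sc Sx Sy; rewrite -[y]opprK; apply: (proj2 Sc) => //; apply: zclosedN.
Qed.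

Lemma zclosedMz S x n : zclosed S -> S x -> S (x *~ n).
Proof.
move=> Sc Sx; have SM k : S (x *+ k).
  by elim: k => [|k IH]; [exact: (proj1 Sc) | rewrite mulrS; apply: zclosedD].
by case: n => n; [exact: SM | rewrite NegzE mulrNz; apply: zclosedN => //; exact: SM].
Qed.

Lemma zclosed_sum S (I : Type) (r : seq I) (p : pred I) (F : I -> V) :
  zclosed S -> (forall i, p i -> S (F i)) -> S (\sum_(i <- r | p i) F i).
Proof.
move=> Sc SF; elim/big_ind: _ => //; first exact: (proj1 Sc).
by move=> x y; apply: zclosedD.
Qed.

Lemma zgen_mono P Q : (forall x, P x -> Q x) -> forall x, zgenerated P x -> zgenerated Q x.
Proof.
by move=> PQ; apply: zgen_sub; [exact: zclosed_gen | move=> x /PQ; exact: zgen_in].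
Qed.

Lemma zclosed_id S x : zclosed S -> zgenerated S x -> S x.
Proof. by move=> Sc; apply: zgen_sub. Qed.

Lemma zclosed_eq S x y : zclosed S -> S (x - y) -> S y -> S x.
Proof. by move=> Sc Sxy Sy; rewrite -[x](subrK y); apply: zclosedD. Qed.

End Zclosed.

Lemma zclosed_preim (V W : zmodType) (f : {additive V -> W}) (S : W -> Prop) :
  zclosed S -> zclosed (fun x => S (f x)).
Proof. by move=> [S0 SB]; split=> [|x y]; rewrite ?raddf0 ?raddfB //; apply: SB. Qed.

Lemma zclosed_ker (V W : zmodType) (f : {additive V -> W}) : zclosed (fun x => f x = 0).
Proof. by split=> [|x y]; rewrite ?raddf0 // raddfB => -> ->; rewrite subrr. Qed.

Lemma zclosed_mull (R : pzRingType) (a : R) (S : R -> Prop) :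
  zclosed S -> zclosed (fun x => S (a * x)).
Proof. by move=> [S0 SB]; split=> [|x y]; rewrite ?mulr0 // mulrBr; apply: SB. Qed.

Lemma zclosed_mulr (R : pzRingType) (a : R) (S : R -> Prop) :
  zclosed S -> zclosed (fun x => S (x * a)).
Proof. by move=> [S0 SB]; split=> [|x y]; rewrite ?mul0r // mulrBl; apply: SB. Qed.

Section OneSidedMultiplication.
Variables (R : pzRingType) (a : R).

Definition mul_left (x : R) : R := a * x.
Definition mul_right (x : R) : R := x * a.

Lemma mul_left_is_zmod_morphism : zmod_morphism mul_left.
Proof. exact: mulrBr. Qed.
Lemma mul_right_is_zmod_morphism : zmod_morphism mul_right.
Proof. by move=> x y; exact: mulrBl. Qed.

HB.instance Definition _ := GRing.isZmodMorphism.Build R R mul_left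
  mul_left_is_zmod_morphism.
HB.instance Definition _ := GRing.isZmodMorphism.Build R R mul_right
  mul_right_is_zmod_morphism.

End OneSidedMultiplication.

(** * Quotient rings *)

Section RingQuotient.
Variables (R : nzRingType) (I : R -> Prop).

Definition ideal_closed :=
  [/\ zclosed I, forall a x, I x -> I (a * x) & forall a x, I x -> I (x * a)].

Hypothesis Iid : ideal_closed.

(** The proof that [I] is an ideal is a parameter of the type, so that the ring structure can be
    inferred from the type alone. *)
Definition rquot_def of ideal_closed : Type := zquot I.
Definition rquot := rquot_def Iid.
HB.instance Definition _ := GRing.Zmodule.on rquot.

Let p : R -> rquot := zproj I.

Lemma rquot_eq x y : p x = p y <-> I (x - y).
Proof.
rewrite /p; have [Ic _ _] := Iid; split=> [E|Ixy].
  apply: zclosed_id => //; apply/zproj_eq0; rewrite raddfB /=.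
  by rewrite (E : zproj I x = zproj I y) subrr.
have : zproj I (x - y) = 0 by apply/zproj_eq0/zgen_in.
by rewrite raddfB /= => /eqP; rewrite subr_eq0 => /eqP.
Qed.

Let lft (q : rquot) : R := sval (cid (zproj_surj q)).

Lemma rquot_lftK q : p (lft q) = q.
Proof. by rewrite /p /lft; case: cid => x /= <-. Qed.

Definition rquot_mul (x y : rquot) : rquot := p (lft x * lft y).
Definition rquot_one : rquot := p 1.

Lemma rquot_mulE x y : rquot_mul (p x) (p y) = p (x * y).
Proof.
have [Ic Il Ir] := Iid; apply/rquot_eq.
have E z : I (lft (p z) - z) by apply/rquot_eq; rewrite rquot_lftK.
have -> : lft (p x) * lft (p y) - x * y
  = (lft (p x) - x) * lft (p y) + x * (lft (p y) - y) by ncring.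
by apply: zclosedD => //; [apply: Ir | apply: Il].
Qed.

Lemma rquot_ind (Q : rquot -> Prop) : (forall x, Q (p x)) -> forall q, Q q.
Proof. by move=> Qp q; rewrite -(rquot_lftK q). Qed.

Lemma rquotD x y : p (x + y) = p x + p y.
Proof. exact: (raddfD (zproj I)). Qed.

Lemma rquot_mulA : associative rquot_mul.
Proof.
elim/rquot_ind=> x; elim/rquot_ind=> y; elim/rquot_ind=> z.
by rewrite !rquot_mulE mulrA.
Qed.
Lemma rquot_mul1q : left_id rquot_one rquot_mul.
Proof. by elim/rquot_ind=> x; rewrite rquot_mulE mul1r. Qed.
Lemma rquot_mulq1 : right_id rquot_one rquot_mul.
Proof. by elim/rquot_ind=> x; rewrite rquot_mulE mulr1. Qed.
Lemma rquot_mulDl : left_distributive rquot_mul +%R.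
Proof.
elim/rquot_ind=> x; elim/rquot_ind=> y; elim/rquot_ind=> z.
by rewrite -rquotD !rquot_mulE mulrDl rquotD.
Qed.
Lemma rquot_mulDr : right_distributive rquot_mul +%R.
Proof.
elim/rquot_ind=> x; elim/rquot_ind=> y; elim/rquot_ind=> z.
by rewrite -rquotD !rquot_mulE mulrDr rquotD.
Qed.

HB.instance Definition _ := GRing.Zmodule_isPzRing.Build rquot
  rquot_mulA rquot_mul1q rquot_mulq1 rquot_mulDl rquot_mulDr.

End RingQuotient.

(* The quotient ring, and below the free ring, are sealed by Qed: unfolding their
   operations makes unification diverge. *)
Record quotient_ring (R : nzRingType) (I : R -> Prop) := QuotientRing {
  qr_ring : pzRingType;
  qr_proj : {additive R -> qr_ring};
  qr_projM : forall x y, qr_proj (x * y) = qr_proj x * qr_proj y;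
  qr_proj1 : qr_proj 1 = 1;
  qr_surj : forall q, exists x, q = qr_proj x;
  qr_eq0 : forall x, qr_proj x = 0 <-> I x;
  qr_lift : forall (V : zmodType) (f : {additive R -> V}),
    (forall x, I x -> f x = 0) -> {additive qr_ring -> V};
  qr_liftE : forall (V : zmodType) (f : {additive R -> V}) (fI : forall x, I x -> f x = 0) x,
    qr_lift fI (qr_proj x) = f x
}.

Lemma quotient_ring_of (R : nzRingType) (I : R -> Prop) : ideal_closed I -> quotient_ring I.
Proof.
move=> Iid; pose p : R -> rquot Iid := zproj I.
have pB : zmod_morphism p := raddfB (zproj I).
pose pA := GRing.isZmodMorphism.Build _ _ p pB.
pose pairfil : {additive R -> rquot Iid} := HB.pack p pA.
apply: (@QuotientRing _ _ (rquot Iid) pairfil _ _ _ _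
  (fun V f fI => @zlift R I V f fI)).
- by move=> x y; rewrite -[RHS]/(rquot_mul _ _) rquot_mulE.
- by [].
- exact: zproj_surj.
- move=> x; rewrite -(raddf0 pairfil); split=> [/rquot_eq|Ix]; first by rewrite subr0.
  by apply/rquot_eq; rewrite subr0.
- by move=> V f fI x; exact: zliftE.
Qed.

(** * Free rings *)

Record free_ring (K : choiceType) := FreeRing {
  fr_ring : nzRingType;
  fr_word : seq K -> fr_ring;
  fr_wordM : forall s t, fr_word s * fr_word t = fr_word (s ++ t);
  fr_word0 : fr_word [::] = 1;
  fr_ind : forall P : fr_ring -> Prop,
    zclosed P -> (forall s, P (fr_word s)) -> forall x, P x;
  fr_lift : forall V : zmodType, (seq K -> V) -> {additive fr_ring -> V};
  fr_liftE : forall (V : zmodType) (f : seq K -> V) s, fr_lift f (fr_word s) = f s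
}.

Lemma free_ring_of (K : choiceType) : free_ring K.
Proof.
apply: (@FreeRing K {malg {fmonom K}} (fun s => << FMonom s >>) _ _ _
  (fun V f => fab_lift (fun w : {fmonom K} => f w))).
- by move=> s t; rewrite malgM_def fgmulUU mulr1 /mmul /= /fmmul fmE.
- by congr << _ >>; rewrite /mone /= /fmone fmE.
- by move=> P [P0 PB] Pw; apply: fab_ind => // -[s]; apply: Pw.
- by move=> V f s; exact: fab_liftU.
Qed.

Definition FR (K : choiceType) : nzRingType := fr_ring (free_ring_of K).

Section FreeRing.
Variable K : choiceType.
Notation FR := (FR K).

Definition word : seq K -> FR := @fr_word K (free_ring_of K).

Lemma wordM s t : word s * word t = word (s ++ t). Proof. exact: fr_wordM. Qed.

Lemma word0 : word [::] = 1. Proof. exact: fr_word0. Qed.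

Lemma word_ind (P : FR -> Prop) : zclosed P -> (forall s, P (word s)) -> forall x, P x.
Proof. exact: fr_ind. Qed.

Lemma word_ext (V : zmodType) (f g : {additive FR -> V}) :
  (forall s, f (word s) = g (word s)) -> f =1 g.
Proof.
move=> fg x; apply/eqP; rewrite -subr_eq0; apply/eqP; move: x.
apply: word_ind => [|s]; last by rewrite fg subrr.
split=> [|x y Ex Ey]; first by rewrite (raddf0 f) (raddf0 g) subrr.
rewrite (raddfB f) (raddfB g).
by transitivity (f x - g x - (f y - g y)); [zmod | rewrite Ex Ey subr0].
Qed.

Definition wlift (V : zmodType) (f : seq K -> V) : {additive FR -> V} :=
  fr_lift (free_ring_of K) f.

Lemma wliftE (V : zmodType) (f : seq K -> V) s : wlift f (word s) = f s.
Proof. exact: fr_liftE. Qed.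

End FreeRing.

Section FreeRing.
Variable K : choiceType.
Notation FR := (FR K).

Section Lift.
Variables (S : pzRingType) (phi : K -> S).

Definition frlift : {additive FR -> S} := wlift (fun s => \prod_(k <- s) phi k).

Lemma frliftW s : frlift (word s) = \prod_(k <- s) phi k.
Proof. exact: wliftE. Qed.

Lemma frliftU k : frlift (word [:: k]) = phi k.
Proof. by rewrite frliftW big_seq1. Qed.

Lemma frliftB x y : frlift (x - y) = frlift x - frlift y.
Proof. exact: raddfB. Qed.

Lemma frliftM x y : frlift (x * y) = frlift x * frlift y.
Proof.
elim/word_ind: x => [|s].
  split=> [|a b Ea Eb]; first by rewrite (mul0r y) raddf0 mul0r.
  by rewrite (mulrBl y) !frliftB Ea Eb mulrBl.
elim/word_ind: y => [|t].
  split=> [|a b Ea Eb]; first by rewrite (mulr0 (word s)) raddf0 mulr0.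
  by rewrite (mulrBr (word s)) !frliftB Ea Eb mulrBr.
by rewrite wordM !frliftW big_cat.
Qed.

Lemma frlift1 : frlift 1 = 1.
Proof. by rewrite -word0 frliftW big_nil. Qed.

End Lift.

Definition dg (n : nat) : {additive FR -> FR} :=
  wlift (fun s => if size s == n then word s else 0).

Lemma dgW n s : dg n (word s) = if size s == n then word s else 0.
Proof. exact: wliftE. Qed.

Lemma dgB n x y : dg n (x - y) = dg n x - dg n y.
Proof. exact: raddfB. Qed.

Lemma dgM n x y : dg n (x * y) = \sum_(i < n.+1) dg i x * dg (n - i)%N y.
Proof.
elim/word_ind: x => [|s].
  split=> [|a b Ea Eb].
    by rewrite mul0r raddf0 big1 // => i _; rewrite raddf0 mul0r.
  by rewrite (mulrBl y) dgB Ea Eb -sumrB; apply: eq_bigr => i _; rewrite dgB mulrBl.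
elim/word_ind: y => [|t].
  split=> [|a b Ea Eb].
    by rewrite mulr0 raddf0 big1 // => i _; rewrite raddf0 mulr0.
  by rewrite (mulrBr (word s)) dgB Ea Eb -sumrB; apply: eq_bigr => i _; rewrite dgB mulrBr.
rewrite wordM dgW size_cat; have [le|lt] := leqP (size s) n; last first.
  rewrite ifN; last by rewrite neq_ltn (leq_trans lt (leq_addr _ _)) orbT.
  rewrite big1 // => i _; rewrite dgW ifN ?mul0r // neq_ltn.
  by rewrite (leq_trans (ltn_ord i) lt) orbT.
have lt : (size s < n.+1)%N by [].
rewrite (bigD1 (Ordinal lt)) //= big1 ?addr0 => [|i ne]; last first.
  by rewrite dgW ifN ?mul0r // eq_sym.
rewrite !dgW eqxx; have [<-|ne] := eqVneq (size s + size t)%N n; first by rewrite addKn eqxx wordM.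
by rewrite ifN ?mulr0 //; apply: contra_neq ne => ->; rewrite subnKC.
Qed.

Lemma dg_dg m n x : dg m (dg n x) = if m == n then dg n x else 0.
Proof.
elim/word_ind: x => [|s].
  split=> [|a b Ea Eb]; first by rewrite !raddf0 if_same.
  by rewrite !dgB Ea Eb; case: eqP; rewrite ?subrr.
rewrite dgW; have [<-|_] := eqVneq (size s) n; last by rewrite raddf0 if_same.
by rewrite dgW eq_sym.
Qed.

Definition homog n (x : FR) := zgenerated (fun y => exists2 s, size s = n & y = word s) x.

Lemma homog_closed n : zclosed (homog n).
Proof. exact: zclosed_gen. Qed.

Lemma homog_dg n x : homog n (dg n x).
Proof.
apply: (word_ind (P := fun x => homog n (dg n x))) => [|s].
  exact: (zclosed_preim (dg n) (homog_closed n)).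
rewrite dgW; case: eqP => [<-|_]; last exact: zgen_0.
by apply: zgen_in; exists s.
Qed.

Lemma dg_homog n x : homog n x -> dg n x = x.
Proof.
elim=> [_ [s <- ->]||y z _ Ey _ Ez]; first by rewrite dgW eqxx.
  by rewrite raddf0.
by rewrite dgB Ey Ez.
Qed.

Lemma homogM m n x y : homog m x -> homog n y -> homog (m + n)%N (x * y).
Proof.
move=> hx hy; have : zclosed (fun x => homog (m + n)%N (x * y)).
  have [c0 cB] := homog_closed (m + n)%N.
  by split=> [|a b Ha Hb]; rewrite ?mul0r // mulrBl; apply: cB.
move=> c; apply: (zgen_sub c _ hx) => _ [s <- ->]; elim: hy => [_ [t <- ->]||a b _ Ha _ Hb].
- by rewrite wordM -size_cat; apply: zgen_in; exists (s ++ t).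
- by rewrite mulr0; apply: zgen_0.
- by rewrite mulrBr; apply: zgen_B.
Qed.

Definition low N (x : FR) := forall i, (i < N)%N -> dg i x = 0.

Lemma low_ideal (N : nat) : ideal_closed (low N).
Proof.
split=> [|a x lx i iN|a x lx i iN].
- split=> [i _|x y lx ly i iN]; first by rewrite raddf0.
  by rewrite dgB lx // ly // subrr.
- rewrite dgM big1 // => j _; rewrite lx ?mulr0 //.
  by rewrite (leq_ltn_trans (leq_subr _ _)).
- rewrite dgM big1 // => j _; rewrite lx ?mul0r //.
  by rewrite (leq_ltn_trans _ iN) // -ltnS.
Qed.

Lemma low_word N x : low N x ->
  zgenerated (fun y => exists2 s, (N <= size s)%N & y = word s) x.
Proof.
(* Subtracting the vanishing components makes the claim additive in [x], so it can be checked on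
   words. *)
move=> lx; have -> : x = x - \sum_(i < N) dg i x.
  by rewrite big1 ?subr0 // => i _; rewrite lx.
move: {lx} x; apply: word_ind => [|s].
  split=> [|a b Ha Hb].
    by rewrite big1 ?subr0 => [|i _]; [exact: zgen_0 | exact: raddf0].
  under eq_bigr => i _ do rewrite dgB.
  rewrite sumrB; have := zgen_B Ha Hb; congr (zgenerated _ _); zmod.
have [le|lt] := leqP N (size s).
  rewrite big1 ?subr0; first by apply: zgen_in; exists s.
  move=> i _; rewrite dgW ifN // neq_ltn; have := leq_trans (ltn_ord i) le => ->.
  by rewrite orbT.
rewrite (bigD1 (Ordinal lt)) //= dgW eqxx big1 ?addr0 ?subrr; first exact: zgen_0.
by move=> i ne; rewrite dgW ifN // eq_sym.
Qed.

End FreeRing.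

Arguments dg {K}.

(** * The truncated free ring and its degree filtration *)

Section Truncated.
Variables (K : choiceType) (N : nat).
Notation FR := (FR K).

(** The free ring on K modulo the elements of degree at least N. *)
Definition trunc_quot : quotient_ring (@low K N) := quotient_ring_of (low_ideal K N).
Definition trunc : pzRingType := qr_ring trunc_quot.
Definition tr : {additive FR -> trunc} := qr_proj trunc_quot.

Lemma trM x y : tr (x * y) = tr x * tr y. Proof. exact: qr_projM. Qed.

Lemma tr1 : tr 1 = 1. Proof. exact: qr_proj1. Qed.

Lemma tr_surj x : exists y, x = tr y. Proof. exact: qr_surj. Qed.

Lemma tr_eq0 x : tr x = 0 <-> low N x. Proof. exact: qr_eq0. Qed.

Lemma trunc_ind (P : trunc -> Prop) :
  zclosed P -> (forall s, P (tr (word s))) -> forall x, P x.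
Proof.
move=> Pc Pw x; have [y ->] := tr_surj x.
by apply: (word_ind (zclosed_preim tr Pc)).
Qed.

(** The test [n < N] makes the map vanish on [low N] for every [n], so that components of all
    degrees descend to the truncation. *)
Definition cf0 (n : nat) : {additive FR -> FR} :=
  wlift (fun s => if (size s == n) && (n < N)%N then word s else 0).

Lemma cf0E n x : cf0 n x = if (n < N)%N then dg n x else 0.
Proof.
elim/word_ind: x => [|s].
  split=> [|a b Ea Eb]; first by rewrite !raddf0 if_same.
  by rewrite !raddfB Ea Eb; case: ifP; rewrite ?subrr.
by rewrite /cf0 wliftE dgW; case: (_ < _)%N; rewrite ?andbT ?andbF.
Qed.

Lemma cf_subproof n x : low N x -> cf0 n x = 0.
Proof. by move=> lx; rewrite cf0E; case: ifP => // /lx. Qed.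

Definition cf n : {additive trunc -> FR} := qr_lift trunc_quot (@cf_subproof n).

Lemma cfE n x : cf n (tr x) = if (n < N)%N then dg n x else 0.
Proof. by rewrite -cf0E; apply: qr_liftE. Qed.

Lemma cf_eq0 x : (forall n, cf n x = 0) -> x = 0.
Proof.
have [y ->] := tr_surj x => c0; apply/tr_eq0 => i iN.
by have := c0 i; rewrite cfE iN.
Qed.

Lemma cf_ge n x : (N <= n)%N -> cf n x = 0.
Proof. by have [y ->] := tr_surj x => Nn; rewrite cfE ltnNge Nn. Qed.

Lemma cfM n x y : (n < N)%N -> cf n (x * y) = \sum_(i < n.+1) cf i x * cf (n - i)%N y.
Proof.
have [a ->] := tr_surj x; have [b ->] := tr_surj y => nN.
rewrite -trM cfE nN dgM; apply: eq_bigr => i _.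
by rewrite !cfE (leq_ltn_trans _ nN) 1?(leq_ltn_trans (leq_subr _ _) nN) // -ltnS.
Qed.

Lemma homog_cf n x : homog n (cf n x).
Proof.
have [a ->] := tr_surj x; rewrite cfE; case: ifP => _; first exact: homog_dg.
exact: zgen_0.
Qed.

Lemma tr_cf n x : cf n (tr (cf n x)) = cf n x.
Proof.
have [a ->] := tr_surj x; rewrite (cfE n a); case: ifP => nN.
  by rewrite cfE nN dg_dg eqxx.
by rewrite (raddf0 tr) (raddf0 (cf n)).
Qed.

Definition fil n (x : trunc) := forall i, (i < n)%N -> cf i x = 0.

Lemma fil_closed n : zclosed (fil n).
Proof.
split=> [i _|x y fx fy i iN]; first by rewrite raddf0.
by rewrite raddfB fx // fy // subrr.
Qed.

Lemma filW m n x : (m <= n)%N -> fil n x -> fil m x.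
Proof. by move=> mn fx i im; apply: fx; apply: leq_trans mn. Qed.

Lemma fil0 x : fil 0 x. Proof. by []. Qed.

Lemma filM m n x y : fil m x -> fil n y -> fil (m + n)%N (x * y).
Proof.
move=> fx fy i imn; have [iN|/cf_ge //] := ltnP i N.
rewrite cfM // big1 // => j _; have [/fx -> |mj] := ltnP j m; first by rewrite mul0r.
by rewrite fy ?mulr0 //; have := ltn_ord j; lia.
Qed.

Lemma fil_ge n x : (N <= n)%N -> fil n x -> x = 0.
Proof.
move=> Nn fx; apply: cf_eq0 => i; have [/fx //|/(leq_trans Nn) /cf_ge //] := ltnP i n.
Qed.

Lemma cfM_lead m n x y : (m + n < N)%N -> fil m x -> fil n y ->
  cf (m + n)%N (x * y) = cf m x * cf n y.
Proof.
move=> mnN fx fy; rewrite cfM //.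
have lt : (m < (m + n).+1)%N by rewrite ltnS leq_addr.
rewrite (bigD1 (Ordinal lt)) //= addKn big1 ?addr0 // => j ne.
have [/fx -> |mj] := ltnP j m; first by rewrite mul0r.
have {mj ne} mj : (m < j)%N by rewrite ltn_neqAle mj andbT eq_sym.
by rewrite [cf (_ - _)%N _]fy ?mulr0 //; have := ltn_ord j; lia.
Qed.

Lemma fil_tr n s : (n <= size s)%N -> fil n (tr (word s)).
Proof.
move=> ns i im; rewrite cfE; case: ifP => // _; rewrite dgW ifN // neq_ltn.
by rewrite (leq_trans im ns) orbT.
Qed.

Lemma fil_word n x : fil n x ->
  zgenerated (fun y => exists2 s, (n <= size s)%N & y = tr (word s)) x.
Proof.
(* The representative [a] is known to vanish only below both [n] and [N]; its words that are shorter
   than [n] have length at least [N] and are replaced by 0. *)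
have [a ->] := tr_surj x => fa; pose m := minn n N.
have : low m a.
  move=> i; rewrite leq_min => /andP[iN iN']; have := fa i iN; by rewrite cfE iN'.
move/low_word => h; suff [b lb] : exists2 b, tr a = tr b &
   zgenerated (fun y => exists2 s : seq K, (n <= size s)%N & y = word s) b.
  rewrite lb => {}h; elim: h => [_ [s ns ->]||y z _ Ey _ Ez].
  - by apply: zgen_in; exists s.
  - by rewrite raddf0; apply: zgen_0.
  - by rewrite raddfB; apply: zgen_B.
elim: h {fa} => [_ [s ms ->]||y z _ [b Eb hb] _ [c Ec hc]].
- have [ns|ns] := leqP n (size s); first by exists (word s) => //; apply: zgen_in; exists s.
  exists 0; last exact: zgen_0.
  rewrite raddf0; apply/tr_eq0 => i iN; rewrite dgW ifN // neq_ltn.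
  have : (N <= size s)%N by move: ms; rewrite /m geq_min leqNgt ns.
  by move=> /(leq_trans iN) ->; rewrite orbT.
- by exists 0 => //; apply: zgen_0.
- by exists (b - c); [rewrite !raddfB Eb Ec | apply: zgen_B].
Qed.

Lemma fil_cf n x : fil n (tr (cf n x)).
Proof.
move=> i im; rewrite cfE; case: ifP => // _; have := homog_cf n x.
elim=> [_ [s sn ->]||y z _ Ey _ Ez]; rewrite ?raddf0 ?raddfB ?Ey ?Ez ?subrr //.
by rewrite dgW sn ifN // neq_ltn im orbT.
Qed.

Lemma fil_cf_eq n x : fil n x -> fil n.+1 (x - tr (cf n x)).
Proof.
move=> fx i; rewrite ltnS leq_eqVlt => /orP[/eqP ->|im].
  by rewrite raddfB /= tr_cf subrr.
by rewrite raddfB /= (fx i im) (fil_cf x im) subrr.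
Qed.

Lemma filS n x : fil n x -> cf n x = 0 -> fil n.+1 x.
Proof. by move=> /fil_cf_eq + c0; rewrite c0 raddf0 subr0. Qed.

Section Endo.
Variables (phi : K -> trunc) (phi1 : forall k, fil 1 (phi k)).

Lemma fil_prod s : fil (size s) (\prod_(k <- s) phi k).
Proof.
elim: s => [|k s IH]; rewrite ?big_nil //= big_cons.
by rewrite -add1n; apply: filM.
Qed.

Lemma endo_subproof x : low N x -> frlift phi x = 0.
Proof.
move=> /low_word; elim=> [_ [s ns ->]||y z _ Ey _ Ez]; rewrite ?raddf0 //.
  by rewrite frliftW; apply: fil_ge ns _; apply: fil_prod.
by rewrite raddfB Ey Ez subrr.
Qed.

Definition endo : {additive trunc -> trunc} := qr_lift trunc_quot endo_subproof.

Lemma endoE x : endo (tr x) = frlift phi x.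
Proof. exact: qr_liftE. Qed.

Lemma endoM x y : endo (x * y) = endo x * endo y.
Proof.
have [a ->] := tr_surj x; have [b ->] := tr_surj y.
by rewrite -trM !endoE frliftM.
Qed.

Lemma endo1 : endo 1 = 1.
Proof. by rewrite -{1}tr1 endoE frlift1. Qed.

End Endo.

(** Elements of positive degree are nilpotent, so 1 + x is invertible. *)
Definition geo (x : trunc) : trunc := \sum_(i < N) (- x) ^+ i.

Lemma fil_exp x i : fil 1 x -> fil i (x ^+ i).
Proof.
move=> fx; elim: i => [|i IH]; first exact: fil0.
by rewrite exprS -add1n; apply: filM.
Qed.

Lemma geo_mul x : fil 1 x -> (1 + x) * geo x = 1 /\ geo x * (1 + x) = 1.
Proof.
move=> fx; have nil : (- x) ^+ N = 0.
  apply: (fil_ge (leqnn N)); apply: fil_exp; exact: zclosedN (fil_closed 1) fx.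
have -> : 1 + x = 1 - (- x) by rewrite opprK.
have comm : (1 - - x) * geo x = geo x * (1 - - x).
  rewrite mulrBl mulrBr mul1r mulr1; congr (_ - _).
  by rewrite mulr_sumr mulr_suml; apply: eq_bigr => i _; rewrite -exprS -exprSr.
rewrite -comm; suff E : (1 - - x) * geo x = 1 by [].
by rewrite -opprB mulNr -subrX1 nil sub0r opprK.
Qed.

End Truncated.

Arguments tr {K N}.
Arguments cf {K N}.
Arguments fil_closed {K N} n.
Arguments filW {K N m n x}.

Section SubquotTrivial.
Variables (V : zmodType) (Z : zmodClosed V) (B : V -> Prop).

Lemma subquot_trivial : zclosed B -> zmod_trivial (subquot Z B) ->
  forall x, x \in Z -> B x.
Proof.
move=> Bc triv x Zx; have /zproj_eq0 : zproj (fun y : zsub Z => B (val y)) (Sub x Zx) = 0.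
  exact: triv.
by move/(zgen_sub (zclosed_preim (val : {additive zsub Z -> V}) Bc)); apply.
Qed.

End SubquotTrivial.

Lemma zclosed_zim (V W : zmodType) (f : {additive V -> W}) : zclosed (zim f).
Proof.
split=> [|_ _ [x <-] [y <-]]; first by exists 0; rewrite raddf0.
by exists (x - y); rewrite raddfB.
Qed.

(** * The ideal of relations and its powers *)

Section Relations.
Variable G : groupType.
Notation A := (abelianization G).
Notation M := (trunc G 5).

Definition X (g : G) : M := tr (word [:: g]).

Lemma fil1_X g : fil 1 (X g). Proof. exact: fil_tr. Qed.

Lemma cf0_1 n : (0 < n)%N -> cf n (1 : M) = 0.
Proof. by case: n => // n _; rewrite -tr1 -word0 cfE dgW if_same. Qed.

(** Up to the degree truncation, [rr] is the kernel of the ring map to Z[G]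
    that sends X_g to g - 1. *)
Definition rel (g h : G) : M := (1 + X g) * (1 + X h) - (1 + X (g * h)%g).
Definition rr := zgenerated (fun z => exists a b g h, z = a * rel g h * b).

(** With f the elements of positive degree and r = [rr], this is the sum of the f^i r f^j with i + j
    = k - 1, for positive k. The relator counts as one factor of degree 1: thus [rk 1] is [rr], and
    elements of [rk k] have order at least [k]. *)
Definition rk (k : nat) := zgenerated (fun z => exists i j (a rho b : M),
  [/\ (k <= i + j + 1)%N, fil i a, rr rho, fil j b & z = a * rho * b]).

Lemma rr_closed : zclosed rr. Proof. exact: zclosed_gen. Qed.
Lemma rk_closed k : zclosed (rk k). Proof. exact: zclosed_gen. Qed.

Lemma rr_rel g h : rr (rel g h).
Proof. by apply: zgen_in; exists 1, 1, g, h; rewrite mul1r mulr1. Qed.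

Lemma rr_mull a x : rr x -> rr (a * x).
Proof.
apply: (zgen_sub (zclosed_mull a rr_closed)) => _ [b [c [g [h ->]]]].
by apply: zgen_in; exists (a * b), c, g, h; rewrite !mulrA.
Qed.

Lemma rr_mulr a x : rr x -> rr (x * a).
Proof.
apply: (zgen_sub (zclosed_mulr a rr_closed)) => _ [b [c [g [h ->]]]].
by apply: zgen_in; exists b, (c * a), g, h; rewrite !mulrA.
Qed.

Lemma relE g h : rel g h = X g + X h - X (g * h)%g + X g * X h.
Proof. by rewrite /rel; ncring. Qed.

Lemma rr_fil1 x : rr x -> fil 1 x.
Proof.
apply: (zgen_sub (fil_closed 1)) => _ [a [b [g [h ->]]]].
rewrite -[1%N]/(0 + 1 + 0)%N; apply: filM => //; apply: filM => //.
rewrite relE; have fc := @fil_closed G 5 1.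
apply: (zclosedD fc); last first.
  by apply: (filW (n := 1 + 1)) => //; apply: filM; exact: fil1_X.
by apply: (proj2 fc); [apply: (zclosedD fc) |]; exact: fil1_X.
Qed.

Lemma rkW k l x : (k <= l)%N -> rk l x -> rk k x.
Proof.
move=> kl; apply: zgen_mono => _ [i [j [a [r [b [lij fa Rr fb ->]]]]]].
by exists i, j, a, r, b; split=> //; apply: leq_trans kl lij.
Qed.

Lemma rk_mull k i a x : fil i a -> rk k x -> rk (i + k)%N (a * x).
Proof.
move=> fa; apply: (zgen_sub (zclosed_mull a (rk_closed _))).
move=> _ [i' [j [a' [r [b [lij fa' Rr fb ->]]]]]]; apply: zgen_in.
exists (i + i')%N, j, (a * a'), r, b; split=> //; rewrite ?mulrA //; first lia.
exact: filM.
Qed.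

Lemma rk_mulr k j b x : fil j b -> rk k x -> rk (k + j)%N (x * b).
Proof.
move=> fb; apply: (zgen_sub (zclosed_mulr b (rk_closed _))).
move=> _ [i [j' [a [r [b' [lij fa Rr fb' ->]]]]]]; apply: zgen_in.
exists i, (j' + j)%N, a, r, (b' * b); split=> //; rewrite ?mulrA //; first lia.
exact: filM.
Qed.

Lemma rk_rr k x : rk k x -> rr x.
Proof.
apply: (zgen_sub rr_closed) => _ [i [j [a [r [b [_ _ Rr _ ->]]]]]].
by apply: rr_mulr; apply: rr_mull.
Qed.

Lemma rr_rk x : rr x -> rk 1 x.
Proof.
move=> Rx; apply: zgen_in; exists 0, 0, 1, x, 1; split=> //.
by rewrite mul1r mulr1.
Qed.

Lemma rk_fil k x : rk k x -> fil k x.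
Proof.
apply: (zgen_sub (fil_closed k)) => _ [i [j [a [r [b [kij fa Rr fb ->]]]]]].
apply: (filW kij); rewrite addnAC; apply: filM => //; apply: filM => //; exact: rr_fil1.
Qed.

Lemma rk_mulrr k x y : fil k x -> rr y -> rk k.+1 (x * y).
Proof. by move=> fx Ry; rewrite -addn1; apply: rk_mull => //; apply: rr_rk. Qed.

Lemma rk_rrmul k x y : fil k x -> rr y -> rk k.+1 (y * x).
Proof. by move=> fx Ry; rewrite -add1n; apply: rk_mulr => //; apply: rr_rk. Qed.

Lemma rk_word k x : rk k.+1 x -> zgenerated (fun z => exists u v rho,
  [/\ (size u + size v = k)%N, rr rho & z = tr (word u) * rho * tr (word v)]) x.
Proof.
set P := fun z : M => _; have Pc : zclosed (zgenerated P) := zclosed_gen P.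
apply: (zgen_sub Pc) => _ [i [j [a [r [b [kij fa Rr fb ->]]]]]].
have kij' : (k <= i + j)%N by lia.
have H := zgen_sub (zclosed_mulr r (zclosed_mulr b Pc)).
apply: (H _ _ a (fil_word fa)) => {H} _ [u iu ->].
have H := zgen_sub (zclosed_mull (tr (word u) * r) Pc).
apply: (H _ _ b (fil_word fb)) => {H} _ [v jv ->].
have le : (k <= size u + size v)%N by lia.
(* Exactly [k] outer letters are kept, a prefix of [u] and a suffix of [v]; the surplus is absorbed
   into the relator. *)
pose p := minn (size u) k; apply: zgen_in.
exists (take p u), (drop (size v - (k - p)) v).
exists (tr (word (drop p u)) * r * tr (word (take (size v - (k - p)) v))); split.
- by rewrite size_drop size_takel ?geq_minl //; rewrite /p; lia.
- by apply: rr_mulr; apply: rr_mull.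
- rewrite !mulrA -trM wordM cat_take_drop -mulrA -[RHS]mulrA -trM wordM.
  by rewrite cat_take_drop mulrA.
Qed.

Definition cls (g : G) : A := \pi_(abelianization G)%qT g.

Lemma clsM g h : cls (g * h)%g = cls g + cls h.
Proof. exact: pi_ab_add. Qed.

Lemma cls1 : cls 1%g = 0.
Proof. by apply: (addIr (cls 1%g)); rewrite -clsM mul1g add0r. Qed.

Lemma clsV g : cls (g^-1)%g = - cls g.
Proof. by apply: (addIr (cls g)); rewrite -clsM mulVg cls1 addNr. Qed.

Lemma cls_surj a : exists g, a = cls g.
Proof. by exists (repr a); rewrite /cls reprK. Qed.

Lemma cls_eq0 g : cls g = 0 -> lower_central G 2 g.
Proof.
rewrite -cls1 => /eqP /ab_equivP; rewrite mulg1 => h.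
by rewrite -[g]invgK; apply: ggen_V.
Qed.

Definition lin0 : {additive FR G -> A} :=
  wlift (fun s => if s is [:: g] then cls g else 0).

Lemma lin_subproof x : low 5 x -> lin0 x = 0.
Proof.
move=> /low_word; elim=> [_ [s ns ->]||y z _ Ey _ Ez]; rewrite ?raddf0 //.
  by rewrite /lin0 wliftE; case: s ns => [|g [|h s]].
by rewrite raddfB Ey Ez subrr.
Qed.

Definition lin : {additive M -> A} := qr_lift (trunc_quot G 5) lin_subproof.

Lemma linW s : lin (tr (word s)) = if s is [:: g] then cls g else 0.
Proof. by rewrite /lin qr_liftE /lin0 wliftE. Qed.

Lemma linX g : lin (X g) = cls g. Proof. exact: linW. Qed.

Lemma lin_fil2 x : fil 2 x -> lin x = 0.
Proof.
move=> /fil_word; elim=> [_ [s ns ->]||y z _ Ey _ Ez]; rewrite ?raddf0 //.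
  by rewrite linW; case: s ns => [|g [|h s]].
by rewrite raddfB Ey Ez subrr.
Qed.

Lemma aug_int (x : M) : exists n : int, fil 1 (x - 1 *~ n).
Proof.
have fc := @fil_closed G 5 1.
apply: (trunc_ind (P := fun x : M => exists n : int, fil 1 (x - 1 *~ n))) => [|s].
  split=> [|y z [n fy] [m fz]]; first by exists 0; rewrite mulr0z subr0; case: fc.
  exists (n - m); have := proj2 fc _ _ fy fz; congr (fil _ _).
  by rewrite mulrzBr; zmod.
case: s => [|g s]; first by exists 1; rewrite mulr1z word0 tr1 subrr; case: fc.
by exists 0; rewrite mulr0z subr0; apply: fil_tr.
Qed.

(** Modulo [rk 2], outer factors act on the ideal only through their constant terms. *)
Lemma rr_aug a rho b : rr rho -> exists n : int, rk 2 (a * rho * b - rho *~ n).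
Proof.
move=> Rr; have [n fa] := aug_int a; have [m fb] := aug_int b; exists (n * m).
have -> : a * rho * b - rho *~ (n * m)
    = (a - 1 *~ n) * (rho * b) + (rho * (b - 1 *~ m)) *~ n.
  by rewrite mulrBl mulrzl mulrBr mulrzr mulrzBl -mulrzA (mulrC m) mulrA; zmod.
have c := rk_closed 2; apply: (zclosedD c).
  by apply: rk_mulrr => //; apply: rr_mulr.
by apply: (zclosedMz _ c); apply: rk_rrmul.
Qed.

(** Modulo order 2 the ideal is spanned by the forms X_g + X_h - X_(gh), which vanish in A. *)
Lemma lin_rr x : rr x -> lin x = 0.
Proof.
apply: (zgen_sub (zclosed_ker lin)) => _ [a [b [g [h ->]]]].
have [n r2] := rr_aug a b (rr_rel g h); have /lin_fil2 := rk_fil r2.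
rewrite raddfB raddfMz /= => /eqP; rewrite subr_eq0 => /eqP ->.
rewrite relE (raddfD lin) (raddfB lin) (raddfD lin) !linX.
by rewrite (lin_fil2 (filM (fil1_X g) (fil1_X h))) clsM subrr add0r mul0rz.
Qed.

End Relations.
Arguments lin {G}.

(** * The second homology group *)

Section Hopf.
Variable G : groupType.
Notation M := (trunc G 5).

(** The relation of the cell (g, h) has linear part X_h - X_(gh) + X_g, the bar boundary of the
    cell. Hence the 2-cycles are the combinations of relations that have order 2. *)
Definition bar_rel : {additive bar G 2 -> M} :=
  fab_lift (fun f : {ffun 'I_2 -> G} => rel (f ord0) (f ord_max)).

Lemma bar_relU f : bar_rel << f >> = rel (f ord0) (f ord_max).
Proof. exact: fab_liftU. Qed.

Definition bar1_FR : {additive bar G 1 -> FR G} :=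
  fab_lift (fun f : {ffun 'I_1 -> G} => word [:: f ord0]).

Lemma bar1_FR_inj x : bar1_FR x = 0 -> x = 0.
Proof.
pose back : {additive FR G -> bar G 1} :=
  wlift (fun s => if s is [:: g] then << [ffun=> g] >> else 0).
suff E y : back (bar1_FR y) = y by move=> x0; rewrite -[x]E x0 raddf0.
apply: (@fab_ext _ _ (back \o bar1_FR) idfun) => f /=.
rewrite /bar1_FR /= fab_liftU wliftE; congr << _ >>.
by apply/ffunP => i; rewrite ffunE (ord1 i).
Qed.

Lemma cf1_bar_rel z : cf 1 (bar_rel z) = bar1_FR (bar_diff G 1 z).
Proof.
apply: (@fab_ext _ _ (cf 1 \o bar_rel) (bar1_FR \o bar_diff G 1)) => f /=.
rewrite bar_relU relE /bar_diff /= fab_liftU !big_ord_recr big_ord0 /= add0r.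
rewrite expr0 expr1 sqrrN expr1n scale1r scaleN1r scale1r.
rewrite (raddfD (cf 1)) (raddfB (cf 1)) (raddfD (cf 1)) (filM (fil1_X _) (fil1_X _)) //.
rewrite (raddfD bar1_FR) (raddfB bar1_FR) /bar1_FR /= !fab_liftU !ffunE /=.
rewrite /X !cfE !dgW /= addr0.
have -> : lift ord_max ord0 = ord0 :> 'I_2 by apply/val_inj.
have -> : lift ord0 ord0 = ord_max :> 'I_2 by apply/val_inj.
by zmod.
Qed.

(** Associativity in M turns the boundary of the cell (g, h, k) into
    [rel g h * X k - X g * rel h k], and both terms have one factor beside the relator. *)
Lemma bar_rel_boundary y : rk 2 (bar_rel (bar_diff G 2 y)).
Proof.
have c := rk_closed G 2.
apply: (fab_ind (P := fun y => rk 2 (bar_rel (bar_diff G 2 y)))) => {y} [|x y hx hy|f].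
- by rewrite !raddf0; case: c.
- by rewrite !raddfB; apply: (proj2 c).
rewrite /bar_diff /= fab_liftU !big_ord_recr big_ord0 /= add0r.
rewrite -(signr_odd _ 2) -(signr_odd _ 3) /= expr0 expr1 !scaleN1r !scale1r.
rewrite (raddfB bar_rel) (raddfD bar_rel) (raddfB bar_rel) !bar_relU !ffunE /=.
have -> : lift ord_max ord_max = lift ord0 ord0 :> 'I_3 by apply/val_inj.
set g := f (lift ord_max _); set h := f (lift ord0 ord0); set k := f (lift ord0 _).
rewrite (_ : _ - _ = rel g h * X k - X g * rel h k); last first.
  by rewrite /rel mulgA; ncring.
apply: (proj2 c); first by apply: rk_rrmul (fil1_X k) (rr_rel g h).
by apply: rk_mulrr (fil1_X g) (rr_rel h k).
Qed.

Lemma rr_bar_rel (x : M) : rr x -> exists z, rk 2 (x - bar_rel z).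
Proof.
have c := rk_closed G 2; pose S (x : M) := exists z, rk 2 (x - bar_rel z).
have Sc : zclosed S.
  split=> [|y z [u yu] [v zv]]; first by exists 0; rewrite raddf0 subr0; case: c.
  exists (u - v); have := proj2 c _ _ yu zv; congr (rk _ _).
  by rewrite (raddfB bar_rel); zmod.
apply: (zgen_sub Sc) => _ [a [b [g [h ->]]]].
have [n r2] := rr_aug a b (rr_rel g h).
exists (<< [ffun i : 'I_2 => if i == ord0 then g else h] >> *~ n).
by rewrite raddfMz /= bar_relU !ffunE.
Qed.

Hypothesis H2 : zmod_trivial (group_homology G 2).

(* The Hopf formula in its additive form. *)
Lemma rr_fil2 (x : M) : rr x -> fil 2 x -> rk 2 x.
Proof.
move=> /rr_bar_rel[z r2] fx; have c := rk_closed G 2.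
apply: (zclosed_eq c r2); have fz : fil 2 (bar_rel z).
  have := proj2 (fil_closed 2) _ _ fx (rk_fil r2); congr (fil _ _); zmod.
have /bar1_FR_inj dz : bar1_FR (bar_diff G 1 z) = 0 by rewrite -cf1_bar_rel fz.
have [y <-] : zim (bar_diff G 2) z.
  apply: (subquot_trivial (zclosed_zim (bar_diff G 2)) H2).
  by apply/eqP.
exact: bar_rel_boundary.
Qed.

End Hopf.

Local Open Scope group_scope.

(** * Lower central series *)

Section GroupGeneralities.
Variable T : groupType.
Implicit Types (H N : set T).

Definition gclosed H :=
  [/\ H 1, forall x y, H x -> H y -> H (x * y) & forall x, H x -> H x^-1].

Lemma gclosed_gen H : gclosed (ggenerated H).
Proof. by split=> [|x y|x]; [exact: ggen_1 | exact: ggen_M | exact: ggen_V]. Qed.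

Lemma ggen_sub H N : gclosed N -> (forall x, H x -> N x) -> forall x, ggenerated H x -> N x.
Proof.
move=> [N1 NM NV] HN x.
by elim=> {x} [x /HN||x y _ Nx _ Ny|x _ Nx] //; [apply: (NM) | apply: (NV)].
Qed.

Lemma gclosedR H x y : gclosed H -> H x -> H y -> H [~ x, y].
Proof.
move=> [_ HM HV] Hx Hy; rewrite /commg /conjg.
by repeat first [assumption | apply HM | apply HV].
Qed.

Lemma commMgJ x y z : [~ x * y, z] = [~ x, z] ^ y * [~ y, z] :> T.
Proof. by rewrite !commgEr conjgM mulgA -conjMg mulgK. Qed.

Lemma commgMJ x y z : [~ x, y * z] = [~ x, z] * [~ x, y] ^ z :> T.
Proof. by rewrite !commgEl conjgM -mulgA -conjMg mulVKg. Qed.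

Lemma commgVJ x y : [~ x, y^-1] = ([~ x, y]^-1) ^ y^-1 :> T.
Proof. by rewrite /commg /conjg !invgM !invgK !mulgA mulgV mul1g. Qed.

Lemma conjg_mulR x y : x ^ y = x * [~ x, y] :> T.
Proof. by rewrite /commg mulVKg. Qed.

Lemma Hall_Witt x y z :
  [~ x, y^-1, z] ^ y * [~ y, z^-1, x] ^ z * [~ z, x^-1, y] ^ x = 1 :> T.
Proof.
pose a x y z : T := x * z * y ^ x.
suffices{x y z} hw_aux x y z: [~ x, y^-1, z] ^ y = (a x y z)^-1 * (a y z x).
  by rewrite !hw_aux; move: a {hw_aux} => a; rewrite 2!mulgA !mulgK mulVg.
by rewrite /a /commg /conjg !invgM !invgK !mulgA !(mulVg, mul1g, mulgVK).
Qed.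

End GroupGeneralities.

Section LowerCentralSeries.
Variables (T : groupType) (F : set T).
Hypothesis Fg : gclosed F.

(** Shifted by one with respect to [lower_central]. *)
Definition lc (n : nat) : set T := iter n (fun H => commutator_subgroup H F) F.

Lemma lcS n : lc n.+1 = commutator_subgroup (lc n) F. Proof. by []. Qed.

Lemma lc_closed n : gclosed (lc n).
Proof. by case: n => [|n]; [exact: Fg | exact: gclosed_gen]. Qed.

Lemma lcR n x y : lc n x -> F y -> lc n.+1 [~ x, y].
Proof. by move=> Hx Fy; apply: ggen_in; exists x, y. Qed.

Lemma lc_F n x : lc n x -> F x.
Proof.
elim: n x => // n IH; apply: (ggen_sub Fg) => _ [x [y [/IH Fx Fy ->]]].
exact: gclosedR.
Qed.

Lemma lc_decr n x : lc n.+1 x -> lc n x.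
Proof.
elim: n x => [|n IH]; first exact: lc_F.
apply: (ggen_sub (lc_closed n.+1)) => _ [x [y [/IH Hx Fy ->]]]; exact: lcR.
Qed.

Lemma lcJ n x y : lc n x -> F y -> lc n (x ^ y).
Proof.
move=> Hx Fy; rewrite conjg_mulR; have [_ HM _] := lc_closed n.
by apply: (HM) => //; apply: lc_decr; apply: lcR.
Qed.

Lemma lcW m n x : (m <= n)%N -> lc n x -> lc m x.
Proof. by move/subnKC <-; elim: (n - m)%N => [|k IH]; rewrite ?addn0 ?addnS // => /lc_decr. Qed.

(** Induction on [j]: for y = [a, b], the Hall-Witt identity expresses [[a, b], x] by conjugates and
    inverses of [[b', x'], a] and [[x, a'], b'], with primes for inverses. Both are covered by the
    induction hypothesis at the level of [a]. *)
Lemma lcRR i j x y : lc i x -> lc j y -> lc (i + j).+1 [~ x, y].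
Proof.
elim: j i x y => [|j IH] i x y; first by rewrite addn0; apply: lcR.
move=> Hx; have [H1 HM HV] := lc_closed (i + j.+1).+1; have Fx := lc_F Hx.
have [F1 FM FV] := Fg.
have Nc : gclosed [set y | F y /\ lc (i + j.+1).+1 [~ x, y]].
  split=> [|a b [Fa Ha] [Fb Hb]|a [Fa Ha]]; first by rewrite /= commg1.
  - by split; [exact: FM | rewrite commgMJ; apply: (HM) => //; apply: lcJ].
  - split; first exact: FV.
    by rewrite commgVJ; apply: lcJ; [apply: (HV) | apply: (FV)].
move=> Hy; suff: F y /\ lc (i + j.+1).+1 [~ x, y] by case.
move: y Hy; rewrite lcS; apply: (ggen_sub Nc) => _ [a [b [Ha Fb ->]]].
have Fa := lc_F Ha; split; first exact: gclosedR.
have hw := Hall_Witt a b^-1 x; rewrite invgK in hw.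
rewrite -invgR; apply: (HV).
suff E : lc (i + j.+1).+1 ([~ a, b, x] ^ b^-1).
  by rewrite -(conjgKV b [~ a, b, x]); apply: lcJ; rewrite ?invgK.
have {hw} -> : [~ a, b, x] ^ b^-1 = ([~ b^-1, x^-1, a] ^ x * [~ x, a^-1, b^-1] ^ a)^-1.
  by apply/eqP; rewrite -mulg_eq1 mulgA hw.
apply: (HV); apply: (HM); apply: lcJ => //.
  rewrite addnS -addSn; apply: IH => //; rewrite -invgR.
  have [_ _ HV'] := lc_closed i.+1; apply: (HV'); apply: lcR; last exact: FV.
  by have [_ _ HV''] := lc_closed i; apply: (HV'').
rewrite addnS; apply: lcR; last exact: FV.
by apply: IH => //; have [_ _ HV'] := lc_closed j; apply: (HV').
Qed.

End LowerCentralSeries.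

(** * Abelian quotients of subgroups *)

Section SubgroupQuotient.
Variables (T : groupType) (H N : set T).
Hypotheses (Hg : gclosed H) (Ng : gclosed N).

Definition sgp : {pred T} := [pred x | `[< H x >]].

Lemma sgp_closed : group_closed sgp.
Proof.
have [H1 HM HV] := Hg; split=> [|x y /asboolP Hx /asboolP Hy]; apply/asboolP => //.
by apply: (HM) => //; apply: (HV).
Qed.

Definition sgrp_def of gclosed H : Type := {x : T | x \in sgp}.
Definition sgrp := sgrp_def Hg.
HB.instance Definition _ := SubChoice.on sgrp.
HB.instance Definition _ := SubChoice_isSubGroup.Build T sgp sgrp sgp_closed.

Hypothesis NR : forall x y, H x -> H y -> N [~ x, y].

(** H/N is built as the abelianization of H divided by the image of N; since N contains the
    commutators of H, the kernel is N and nothing more. The class map is total on [T], and only its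
    values on H matter. *)
Lemma subgroup_quotient : exists (Q : zmodType) (c : T -> Q),
  (forall x y, H x -> H y -> c (x * y) = (c x + c y)%R) /\
  (forall x, H x -> c x = 0%R <-> N x).
Proof.
pose p (x : sgrp) : abelianization sgrp := \pi_(abelianization sgrp)%qT x.
have pM x y : p (x * y) = (p x + p y)%R by exact: pi_ab_add.
have p1 : p 1 = 0%R by apply: (addIr (p 1)); rewrite -pM mul1g add0r.
have pV x : p x^-1 = (- p x)%R by apply: (addIr (p x)); rewrite -pM mulVg p1 addNr.
pose P (q : abelianization sgrp) := exists2 x : sgrp, N (val x) & q = p x.
have Hv (x : sgrp) : H (val x) by apply/asboolP/(valP x).
have in_H x : H x -> x \in sgp by move=> Hx; apply/asboolP.
have [N1 NM NV] := Ng; have Pc : zclosed P.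
  split=> [|_ _ [x Nx ->] [y Ny ->]]; first by exists 1; rewrite ?val1.
  by exists (x * y^-1); rewrite ?valM ?gmulfV ?pM ?pV //; apply: (NM) => //; apply: (NV).
pose c (x : T) : zquot P := zproj P (p (insubd (1 : sgrp) x)).
exists (zquot P), c; split=> [x y Hx Hy|x Hx].
  rewrite /c -raddfD -pM; congr (zproj _ (p _)); apply/val_inj.
  have [_ HM _] := Hg; rewrite valM !insubdK //; apply: in_H => //; exact: HM.
rewrite /c; split=> [/zproj_eq0 /(zclosed_id Pc) [y Ny]|Nx]; last first.
  apply/zproj_eq0/zgen_in; exists (insubd (1 : sgrp) x) => //.
  by rewrite insubdK //; apply: in_H.
move=> E; have : lower_central sgrp 2 (y^-1 * insubd (1 : sgrp) x).
  by apply/ab_equivP/eqP; exact: (esym E).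
pose N' : set sgrp := [set z | N (val z)].
have N'g : gclosed N'.
  by split=> [|a b|a]; rewrite /N' /= ?val1 ?valM ?gmulfV //; [apply: (NM) | apply: (NV)].
move/(ggen_sub N'g) => /= h; have {h} : N' (y^-1 * insubd (1 : sgrp) x).
  apply: h => _ [a [b [_ _ ->]]]; change (N (val [~ a, b])).
  by rewrite gmulfR; apply: NR; exact: Hv.
move=> h; have {}h : N (val (y^-1 * insubd (1 : sgrp) x)) := h.
move: h; rewrite valM gmulfV insubdK; last exact: in_H.
by move=> h; rewrite -[x](mulVKg (val y)); apply: (NM).
Qed.

End SubgroupQuotient.

Local Close Scope group_scope.

(** * Smith normal form *)

Section Smith.
Variables (K : choiceType) (A : zmodType) (p : {additive {malg K} -> A}).

Lemma malg_seqE (S : seq K) (x : {malg K}) : uniq S -> {subset msupp x <= S} ->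
  x = \sum_(s <- S) << s >> *~ x@_s.
Proof.
move=> US sub; rewrite {1}[x]monalgE.
transitivity (\sum_(s <- msupp x) (<< s >> : {malg K}) *~ x@_s).
  by apply: eq_bigr => s _; rewrite malg_int.
rewrite [RHS](bigID (mem (msupp x))) /= [X in _ + X]big1 ?addr0; last first.
  by move=> s /mcoeff_outdom ->; rewrite mulr0z.
rewrite -[RHS]big_filter; apply: perm_big; apply: uniq_perm.
- exact: fset_uniq.
- exact: filter_uniq.
- by move=> s; rewrite mem_filter /= andb_idr //; apply: sub.
Qed.

(** The rows of [Bm] are the coordinates of [bs] on [S]. From Bm = L D R, the rows of [R] give the
    new basis [f], the inverse of [R] gives the coordinates [q], and the diagonal of D gives the
    [m i], set to 0 where D has no row. Divisibility is read off Bm R^-1 = L D. *)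
Lemma smith_aux (S : seq K) (bs : seq {malg K}) : uniq S ->
    (forall b, b \in bs -> p b = 0 /\ {subset msupp b <= S}) ->
  exists n (f : 'I_n -> {malg K}) (q : 'I_n -> {additive {malg K} -> int}) (m : 'I_n -> int),
  [/\ forall i, p (f i *~ m i) = 0,
      forall x, x \in S -> << x >> = \sum_i f i *~ q i << x >>
    & forall b, b \in bs -> forall i, exists c, q i b = c * m i].
Proof.
move=> US Hbs; pose n := size S; pose l := size bs.
pose S' := in_tuple S; pose bs' := in_tuple bs.
pose Bm : 'M[int]_(l, n) := \matrix_(i, j) (tnth bs' i)@_(tnth S' j).
have [L UL [R UR [d _ E]]] := int_Smith_normal_form Bm.
set D := \matrix_(i, j) _ in E.
pose f (i : 'I_n) : {malg K} := \sum_j << tnth S' j >> *~ R i j.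
pose q (i : 'I_n) : {additive {malg K} -> int} :=
  fab_lift (fun x => \sum_j (if tnth S' j == x then invmx R j i else 0)).
pose m (i : 'I_n) : int := if (i < l)%N then d`_i else 0.
have qS j i : q i << tnth S' j >> = invmx R j i.
  rewrite /q /= fab_liftU (bigD1 j) //= eqxx big1 ?addr0 // => j' ne.
  rewrite ifN //; apply: contra ne => /eqP /(tuple_uniqP S' US _ _) -> //.
have bE (x : {malg K}) : {subset msupp x <= S} ->
    x = \sum_j << tnth S' j >> *~ x@_(tnth S' j).
  by move=> /(malg_seqE US) {1}->; rewrite (big_tnth _ _ S).
have Dm (k : 'I_l) (j : 'I_n) : D k j = m j *+ (k == j :> nat).
  rewrite mxE /m; case: eqP => [<-|_]; first by rewrite ltn_ord.
  by rewrite !mulr0n.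
exists n, f, q, m; split.
- move=> i; rewrite /m; case: ltnP => [il|_]; last by rewrite mulr0z raddf0.
  have -> : f i *~ d`_i = \sum_(k < l) tnth bs' k *~ invmx L (Ordinal il) k.
    transitivity (\sum_j (<< tnth S' j >> : {malg K}) *~ (D *m R) (Ordinal il) j).
      rewrite /f mulrz_suml; apply: eq_bigr => j _; rewrite -mulrzA; congr (_ *~ _).
      rewrite mxE (bigD1 i) //= big1 ?addr0 => [|k ne]; last first.
        rewrite Dm [(_ == _ :> nat)](_ : _ = false) ?mulr0n ?mul0r //.
        by apply/negbTE; rewrite eq_sym.
      by rewrite Dm /= eqxx mulr1n /m il mulrC.
    have -> : D *m R = invmx L *m Bm by rewrite E -mulmxA mulKmx.
    under eq_bigr => j _ do rewrite mxE mulrz_sumr.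
    rewrite exchange_big /=; apply: eq_bigr => k _.
    rewrite [in RHS](bE (tnth bs' k)); last by case: (Hbs _ (mem_tnth k bs')).
    rewrite mulrz_suml; apply: eq_bigr => j _; rewrite -mulrzA; congr (_ *~ _).
    by rewrite !mxE mulrC.
  rewrite raddf_sum big1 // => k _; rewrite raddfMz /=.
  by case: (Hbs _ (mem_tnth k bs')) => ->; rewrite mul0rz.
- move=> x xS; have [j ->] : exists j, x = tnth S' j.
    by have /tnthP[j ->] : x \in S' by []; exists j.
  under eq_bigr => i _ do rewrite qS /f mulrz_suml.
  rewrite exchange_big /= (bigD1 j) //= [X in _ + X]big1 ?addr0 => [|k ne].
    under eq_bigr => i _ do rewrite -mulrzA mulrC.
    rewrite -mulrz_sumr; have := mulVmx UR; move/matrixP/(_ j j).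
    by rewrite !mxE eqxx => ->; rewrite mulr1z.
  under eq_bigr => i _ do rewrite -mulrzA mulrC.
  rewrite -mulrz_sumr; have := mulVmx UR; move/matrixP/(_ j k).
  by rewrite !mxE eq_sym (negbTE ne) => ->; rewrite mulr0z.
- move=> b bbs i; have /tnthP[k ->] : b \in bs' by [].
  have -> : q i (tnth bs' k) = (L *m D) k i.
    rewrite (bE (tnth bs' k)); last by case: (Hbs _ (mem_tnth k bs')).
    rewrite raddf_sum; transitivity ((Bm *m invmx R) k i).
      rewrite mxE; apply: eq_bigr => j _; rewrite raddfMz /= qS !mxE.
      by rewrite -mulrzr intz mulrC.
    by rewrite E -!mulmxA mulmxV // mulmx1.
  exists (\sum_(j < l) L k j *+ (j == i :> nat)); rewrite mxE mulr_suml.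
  by apply: eq_bigr => j _; rewrite Dm mulrnAr mulrnAl.
Qed.

(** [S] and [bs] are the finite part of a presentation of [A] that a given argument uses. In the
    basis [f] it splits into cyclic pieces: [p (f i)] is killed by [m i], where 0 stands for no
    condition, and the relations only involve multiples of [m i]. *)
Lemma smith_basis (S : seq K) (bs : seq {malg K}) : (forall b, b \in bs -> p b = 0) ->
  exists n (f : 'I_n -> {malg K}) (q : 'I_n -> {additive {malg K} -> int}) (m : 'I_n -> int),
  [/\ forall i, p (f i *~ m i) = 0,
      forall x, x \in S -> << x >> = \sum_i f i *~ q i << x >>,
      forall b, b \in bs -> b = \sum_i f i *~ q i b
    & forall b, b \in bs -> forall i, exists c, q i b = c * m i].
Proof.
(* The letters occurring in [bs] are added to [S], so that the elements of [bs] also have an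
   expansion in [f]. *)
move=> pb; pose S' := undup (S ++ flatten [seq (msupp b : seq K) | b <- bs]).
have sub b : b \in bs -> {subset msupp b <= S'}.
  move=> bbs x xb; rewrite mem_undup mem_cat; apply/orP; right; apply/flattenP.
  by exists (enum_fset (msupp b)) => //; apply/mapP; exists b.
have [|n [f [q [m [Hp HS Hb]]]]] := @smith_aux S' bs (undup_uniq _).
  by move=> b bbs; split; [exact: pb | exact: sub].
exists n, f, q, m; split=> // [x xS|b bbs].
  by apply: HS; rewrite mem_undup mem_cat xS.
rewrite [LHS](malg_seqE (undup_uniq _) (sub b bbs)).
under [RHS]eq_bigr => i _.
  rewrite {1}(malg_seqE (undup_uniq _) (sub b bbs)) raddf_sum mulrz_sumr.
  under eq_bigr => x _ do rewrite raddfMz /= -mulrzr intz mulrzA.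
  over.
rewrite exchange_big /= [LHS]big_seq [RHS]big_seq; apply: eq_bigr => x xS.
by rewrite {1}(HS x xS) mulrz_suml.
Qed.

End Smith.

(** * Lie functions *)

Section LeftNormed.

Definition com (R : pzRingType) (x y : R) := x * y - y * x.

Section Words.
Variable K : choiceType.

Definition lnw (s : seq K) : FR K :=
  if s is a :: s' then foldl (fun x b => com x (word [:: b])) (word [:: a]) s' else 0.

Lemma lnw_rcons s b : (0 < size s)%N -> lnw (rcons s b) = com (lnw s) (word [:: b]).
Proof. by case: s => [//|a s] _; rewrite /lnw /= foldl_rcons. Qed.

(** This is the Dynkin operator. *)
Definition lnl : {additive FR K -> FR K} := wlift lnw.

Lemma lnlW s : lnl (word s) = lnw s. Proof. exact: wliftE. Qed.

Lemma lnlM n y b : homog n.+1 y -> lnl (y * word [:: b]) = com (lnl y) (word [:: b]).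
Proof.
rewrite /com; elim=> [_ [s sn ->]||y1 y2 _ E1 _ E2].
- by rewrite wordM !lnlW cats1 lnw_rcons ?sn.
- by rewrite mul0r !raddf0 mul0r mulr0 subrr.
- by rewrite mulrBl (raddfB lnl) E1 E2 (raddfB lnl); ncring.
Qed.

(* If the first letter occurs only once, the bracket has a single word starting
   with it. *)
Lemma lnw_head x s : x \notin s -> zgenerated (fun z => exists y t,
    [/\ y != x, perm_eq (y :: t) (x :: s) & z = word (y :: t)])
  (lnw (x :: s) - word (x :: s)).
Proof.
elim/last_ind: s => [|s b IH]; first by rewrite subrr => _; exact: zgen_0.
rewrite mem_rcons inE negb_or => /andP[xb xs].
rewrite -rcons_cons lnw_rcons // /com.
set P := fun z : FR K => _; have Pc : zclosed (zgenerated P) := zclosed_gen P.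
rewrite (_ : _ - _ = (lnw (x :: s) - word (x :: s)) * word [:: b]
  - word [:: b] * (lnw (x :: s) - word (x :: s)) - word [:: b] * word (x :: s)); last first.
  by rewrite -cats1 -wordM; ncring.
have PW y t : y != x -> perm_eq (y :: t) (rcons (x :: s) b) -> zgenerated P (word (y :: t)).
  by move=> yx pyt; apply: zgen_in; exists y, t.
have bx : b != x by rewrite eq_sym.
apply: (proj2 Pc); first apply: (proj2 Pc).
- have H := zgen_sub (zclosed_mulr (word [:: b]) Pc); apply: (H _ _ _ (IH xs)) => {H}.
  move=> _ [y [t [yx pyt ->]]]; rewrite wordM; apply: PW => //.
  by apply/permP => q; have := permP pyt q; rewrite -cats1 /= !count_cat /=; lia.
- have H := zgen_sub (zclosed_mull (word [:: b]) Pc); apply: (H _ _ _ (IH xs)) => {H}.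
  move=> _ [y [t [yx pyt ->]]]; rewrite wordM; apply: PW => //.
  by apply/permP => q; have := permP pyt q; rewrite -cats1 /= !count_cat /=; lia.
- by rewrite wordM; apply: PW => //; apply/permP => q; rewrite -cats1 /= !count_cat /=; lia.
Qed.

End Words.

(** The identities of the left-normed brackets of length n <= 4 in a Lie ring. *)
Definition lie_fun (K : Type) (Q : zmodType) (n : nat) (d : seq K -> Q) :=
  [/\ forall a s, (size s).+2 = n -> d (a :: a :: s) = 0,
      forall a b s, (size s).+2 = n -> d (a :: b :: s) = - d (b :: a :: s),
      forall a b c s, (size s).+3 = n ->
        d (a :: b :: c :: s) + d (b :: c :: a :: s) + d (c :: a :: b :: s) = 0,
      n = 4 -> forall a b c e,
        d [:: a; b; c; e] - d [:: a; b; e; c] = d [:: c; e; b; a] - d [:: c; e; a; b]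
    & n = 4 -> forall a b, d [:: a; b; a; b] = d [:: a; b; b; a]].

Lemma lnw_lie (K : choiceType) n : lie_fun n (@lnw K).
Proof.
have foldB (s : seq K) : {morph (fun x => foldl (fun x b => com x (word [:: b])) x s) :
    x y / x - y}.
  elim: s => [|c s IH] x y //=; rewrite -IH; congr (foldl _ _ _); rewrite /com; ncring.
have fold0 (s : seq K) : foldl (fun x b => com x (word [:: b])) 0 s = 0.
  by have := foldB s 0 0; rewrite /= !subrr.
split=> [a s _|a b s _|a b c s _|_ a b c e|_ a b]; rewrite /lnw /=.
- by rewrite -[RHS](fold0 s); congr (foldl _ _ _); rewrite /com subrr.
- by rewrite -sub0r -{1}(fold0 s) -foldB; congr (foldl _ _ _); rewrite /com; ncring.
- have foldD x y : foldl (fun x b => com x (word [:: b])) (x + y) s =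
      foldl (fun x b => com x (word [:: b])) x s + foldl (fun x b => com x (word [:: b])) y s.
    by rewrite -[y in LHS]opprK foldB -sub0r foldB fold0; zmod.
  rewrite -!foldD -[RHS](fold0 s); congr (foldl _ _ _); rewrite /com; ncring.
- by rewrite /com; ncring.
- by rewrite /com; ncring.
Qed.

End LeftNormed.

Section LieUnique.
Variables (k : nat) (Q : zmodType).
Implicit Types (d : seq 'I_k -> Q) (s w : seq 'I_k).

Lemma lie_funB n d1 d2 : lie_fun n d1 -> lie_fun n d2 ->
  lie_fun n (fun s => d1 s - d2 s).
Proof.
move=> [a1 b1 c1 e1 f1] [a2 b2 c2 e2 f2].
split=> [a s ns|a b s ns|a b c s ns|n4 a b c e|n4 a b].
- by rewrite a1 // a2 // subrr.
- by rewrite b1 // b2 //; zmod.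
- transitivity (d1 [:: a, b, c & s] + d1 [:: b, c, a & s] + d1 [:: c, a, b & s]
    - (d2 [:: a, b, c & s] + d2 [:: b, c, a & s] + d2 [:: c, a, b & s])); first by zmod.
  by rewrite c1 // c2 // subrr.
- transitivity (d1 [:: a; b; c; e] - d1 [:: a; b; e; c]
    - (d2 [:: a; b; c; e] - d2 [:: a; b; e; c])); first by zmod.
  by rewrite e1 // e2 //; zmod.
- by rewrite f1 // f2.
Qed.

(** The words on which a Lie function is determined: those that start with the
    least of the letters occurring only once, and, if there is no such letter,
    the words yxxy with x < y. *)
Definition good_head x s :=
  (x \notin s) && all (fun y => (count_mem y s == 1%N) ==> (x < y)%N) s.
Definition good w :=
  if w is x :: s then good_head x s ||
    (if s is [:: a; b; c] then [&& a == b, x == c & (a < x)%N] else false)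
  else false.

Lemma good_head_perm x s t : perm_eq s t -> good_head x s = good_head x t.
Proof.
move=> st; rewrite /good_head (perm_mem st) (perm_all _ st); congr (_ && _).
by apply: eq_all => y; rewrite (permP st).
Qed.

Lemma unique_letter w : (exists2 x, x \in w & count_mem x w = 1%N) ->
  exists x s, perm_eq (x :: s) w /\ good_head x s.
Proof.
case=> x0 x0w cx0; pose P x := (x \in w) && (count_mem x w == 1%N).
have P0 : P x0 by rewrite /P x0w cx0.
case: (arg_minnP (fun x : 'I_k => val x) P0) => x /andP[xw /eqP cx] xmin.
exists x, (rem x w); have pw : perm_eq (x :: rem x w) w by rewrite perm_sym perm_to_rem.
have xs : x \notin rem x w.
  have := permP pw (pred1 x); rewrite /= eqxx cx add1n => -[] /eqP.
  by rewrite -leqn0 leqNgt -has_count has_pred1.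
split=> //; rewrite /good_head xs; apply/allP => y ys; apply/implyP => /eqP cy.
have yx : y != x by apply: contraTneq ys => ->.
rewrite ltn_neqAle eq_sym (inj_eq val_inj) yx; apply: xmin; rewrite /P.
rewrite -(perm_mem pw) inE ys orbT -(permP pw) /= cy.
by rewrite [x == y]eq_sym (negbTE yx).
Qed.

(** If some letter occurs once, antisymmetry, Jacobi and the degree 4 identity move the least such
    letter to the front. Otherwise a word of length at most 4 is a power of one letter or contains
    two letters twice each; either its first two letters agree, or it reduces to a word yxxy. *)
Lemma lie_fun_good n d : (1 < n <= 4)%N -> lie_fun n d ->
  (forall w, size w = n -> good w -> d w = 0) -> forall w, size w = n -> d w = 0.
Proof.
move=> n24 [alt anti jac s4 alt4] dgood w wn.
have alt_eq a b s : (size s).+2 = n -> a = b -> d [:: a, b & s] = 0.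
  by move=> sn ->; apply: alt.
have gd x s w' : good_head x s -> perm_eq (x :: s) w' -> size w' = n ->
    forall t, perm_eq s t -> d (x :: t) = 0.
  move=> gx pw w'n t st; apply: dgood; last by rewrite /= -(good_head_perm x st) gx.
  by rewrite -w'n -(perm_size pw) /= (perm_size st).
have [n1 n4] : (1 < size w)%N /\ (size w <= 4)%N by apply/andP; rewrite wn.
have [/hasP[x0 x0w /eqP cx0]|/hasPn nu] := boolP (has (fun x => count_mem x w == 1%N) w).
  have [|x [s [pw gx]]] := @unique_letter w; first by exists x0.
  have {}gd t : perm_eq (x :: t) w -> d (x :: t) = 0.
    move=> pt; apply: (gd x s w) => //; rewrite -(perm_cons x) perm_sym.
    by rewrite (permPl pt) perm_sym.
  have : x \in w by rewrite -(perm_mem pw) mem_head.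
  have P4 : forall t, (forall q : pred 'I_k, count q (x :: t) = count q w) -> d (x :: t) = 0.
    by move=> t h; apply: gd; apply/permP.
  case: w {gd pw cx0 x0w} wn n1 n4 P4 => [|a [|b [|c [|e [|]]]]] //= wn _ _ P4.
  - rewrite !inE => /orP[] /eqP E; rewrite -E in P4 *; first by apply: P4.
    by rewrite anti // P4 ?oppr0 // => q /=; lia.
  - rewrite !inE => /or3P[] /eqP E; rewrite -E in P4 *; first by apply: P4.
      by rewrite anti // P4 ?oppr0 // => q /=; lia.
    have := jac a b x [::] wn; rewrite (anti b x) // => /eqP.
    by rewrite (P4 [:: b; a]) ?(P4 [:: a; b]) ?oppr0 ?addr0 => [/eqP|q|q] //=; lia.
  - rewrite !inE => /or4P[] /eqP E; rewrite -E in P4 *; first by apply: P4.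
    + by rewrite anti // P4 ?oppr0 // => q /=; lia.
    + have := jac a b x [:: e] wn; rewrite (anti b x) // => /eqP.
      by rewrite (P4 [:: b; a; e]) ?(P4 [:: a; b; e]) ?oppr0 ?addr0 => [/eqP|q|q] //=; lia.
    + have := s4 (esym wn) a b c x; have := jac a b x [:: c] wn.
      rewrite (anti b x) // (anti c x) // (anti c x) //.
      rewrite !P4 ?oppr0 ?addr0 ?subr0 => [|q|q|q|q] /=; try lia.
      by move=> ->; rewrite subr0.
have {}nu y : y \in w -> count_mem y w != 1%N by move=> /nu.
case: w nu wn n1 n4 => [|a [|b [|c [|e [|]]]]] //= nu wn _ _.
all: have [ab|ab] := eqVneq a b; first exact: alt_eq.
all: have := nu a; rewrite inE eqxx => /(_ isT); have := nu b.
all: rewrite !inE !eqxx ?orbT [b == a]eq_sym (negbTE ab) => /(_ isT) //=.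
- by case: (eqVneq c b) => [E|_]; case: (eqVneq c a) => [E'|_] //; rewrite -E -E' eqxx in ab.
have dab (x y : 'I_k) : (x < y)%N -> d [:: y; x; x; y] = 0.
  by move=> xy; apply: dgood; rewrite //= !eqxx xy orbT.
have d4 x y : x != y -> d [:: x; y; y; x] = 0.
  rewrite neq_ltn => /orP[|/dab //] xy.
  by rewrite anti // alt4 // dab // oppr0.
case: (eqVneq c b) => [E|_]; case: (eqVneq c a) => [E'|_] //=.
- by rewrite -E -E' eqxx in ab.
- case: (eqVneq e a) => [E'|_] //; case: (eqVneq e b) => [E''|_] //.
    by rewrite -E' -E'' eqxx in ab.
  by rewrite E E' d4.
- case: (eqVneq e b) => [E|_] //; case: (eqVneq e a) => [E''|_] //.
    by rewrite -E -E'' eqxx in ab.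
  by rewrite E E' alt4 // d4.
- by case: (eqVneq e b) => [E|_] //; case: (eqVneq e a) => [E'|_] //; rewrite -E -E' eqxx in ab.
Qed.

End LieUnique.

Section Detect.
Variables (A Q : zmodType).

Definition trel (a b : A) : FR A := word [:: a + b] - word [:: a] - word [:: b].

(** The elements that vanish in the tensor algebra of A. *)
Definition tens_id := zgenerated (fun z : FR A => exists u v a b,
  z = word u * trel a b * word v).

Definition multiadd n (b : seq A -> Q) := forall u v x y, (size u + (size v).+1 = n)%N ->
  b (u ++ (x + y) :: v) = b (u ++ x :: v) + b (u ++ y :: v).

Lemma tens_id_finite E : tens_id E -> exists rs : seq (A * A),
  zgenerated (fun z => exists u v r, r \in rs /\ z = word u * trel r.1 r.2 * word v) E.
Proof.
elim=> [_ [u [v [a [b ->]]]]||x y _ [rx hx] _ [ry hy]].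
- exists [:: (a, b)]; apply: zgen_in; exists u, v, (a, b); split=> //; exact: mem_head.
- by exists [::]; apply: zgen_0.
exists (rx ++ ry); apply: zgen_B.
  apply: zgen_mono hx => z [u [v [r [rr ->]]]]; exists u, v, r.
  by rewrite mem_cat rr.
apply: zgen_mono hy => z [u [v [r [rr ->]]]]; exists u, v, r.
by rewrite mem_cat rr orbT.
Qed.

Lemma homog_finite (K : choiceType) n (x : FR K) : homog n x -> exists S : seq K,
  zgenerated (fun z => exists s, [/\ size s = n, {subset s <= S} & z = word s]) x.
Proof.
elim=> [_ [s sn ->]||y z _ [S hS] _ [S' hS']].
- by exists s; apply: zgen_in; exists s; split.
- by exists [::]; apply: zgen_0.
exists (S ++ S'); apply: zgen_B.
  apply: zgen_mono hS => t [s [sn sS ->]]; exists s; split=> // a /sS.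
  by rewrite mem_cat => ->.
apply: zgen_mono hS' => t [s [sn sS ->]]; exists s; split=> // a /sS.
by rewrite mem_cat orbC => ->.
Qed.

Section Multiadd.
Variables (n : nat) (b : seq A -> Q).
Hypothesis bm : multiadd n b.

Lemma multiadd0 u v : (size u + (size v).+1 = n)%N -> b (u ++ 0 :: v) = 0.
Proof.
move=> uv; have := bm 0 0 uv; rewrite addr0 => /eqP.
by rewrite -subr_eq0 opprD addNKr oppr_eq0 => /eqP.
Qed.

Lemma multiaddMz u v x m : (size u + (size v).+1 = n)%N ->
  b (u ++ (x *~ m) :: v) = b (u ++ x :: v) *~ m.
Proof.
move=> uv; have bN y : b (u ++ (- y) :: v) = - b (u ++ y :: v).
  by apply: (addIr (b (u ++ y :: v))); rewrite -bm // !addNr multiadd0.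
have bMn (k : nat) : b (u ++ (x *+ k) :: v) = b (u ++ x :: v) *+ k.
  by elim: k => [|k IH]; rewrite ?mulr0n ?multiadd0 // !mulrS bm // IH.
by case: m => k; rewrite ?NegzE ?mulrNz ?bN bMn.
Qed.

Lemma multiadd_sum u v (I : Type) (r : seq I) (F : I -> A) : (size u + (size v).+1 = n)%N ->
  b (u ++ (\sum_(i <- r) F i) :: v) = \sum_(i <- r) b (u ++ F i :: v).
Proof.
move=> uv; elim: r => [|i r IH]; first by rewrite !big_nil multiadd0.
by rewrite !big_cons bm // IH.
Qed.

End Multiadd.

(* The cyclic decomposition of a finitely generated subgroup reduces the claim to words
   in generators e_i of orders m_i, where a retraction of the brackets is explicit. *)
Lemma lie_detect n (b : seq A -> Q) : (1 < n <= 4)%N -> multiadd n b -> lie_fun n b ->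
  forall x, homog n x -> tens_id (lnl A x) -> wlift b x = 0.
Proof.
move=> n24 bm bl x hx /tens_id_finite[rs hE].
have [S {}hx] := homog_finite hx.
pose p : {additive {malg A} -> A} := fab_lift (fun a : A => a).
pose bs := [seq << r.1 + r.2 >> - << r.1 >> - << r.2 >> : {malg A} | r <- rs].
have pU a : p << a >> = a by rewrite /p /= fab_liftU.
have [|k [f [q [m [pm qS _ qb]]]]] := @smith_basis A A p S bs.
  by move=> _ /mapP[r _ ->]; rewrite !raddfB !pU; zmod.
(* The [e i] are cyclic generators, and [ql] lifts an element of [A] to a linear form in letters [i]
   standing for them; [Th] is the induced substitution. *)
pose e i := p (f i); pose ql (a : A) : FR 'I_k := \sum_i word [:: i] *~ q i << a >>.
have em i : e i *~ m i = 0 by have := pm i; rewrite raddfMz.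
have eS a : a \in S -> a = \sum_i e i *~ q i << a >>.
  move=> aS; rewrite -{1}(pU a) {1}(qS a aS) raddf_sum; apply: eq_bigr => i _.
  exact: raddfMz.
pose Th := frlift ql.
have Th1 a : Th (word [:: a]) = ql a by exact: frliftU.
have hql a : homog 1 (ql a).
  apply: zclosed_sum => [|i _]; first exact: homog_closed.
  by apply: zclosedMz (homog_closed _ _ ) _; apply: zgen_in; exists [:: i].
have ThW s : homog (size s) (Th (word s)).
  elim: s => [|a s IH]; first by rewrite word0 frlift1 -word0; apply: zgen_in; exists [::].
  by rewrite -cat1s -wordM frliftM Th1; exact: homogM (hql a) IH.
have lnMql r y a : homog r.+1 y -> lnl _ (y * ql a) = com (lnl _ y) (ql a).
  move=> hy; rewrite /ql /com mulr_sumr mulr_suml mulr_sumr raddf_sum -sumrB.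
  apply: eq_bigr => i _; rewrite mulrzAr raddfMz /= (lnlM _ hy) /com mulrzBl.
  by rewrite mulrzAr mulrzAl.
have Thln s : Th (lnw s) = lnl _ (Th (word s)).
  elim/last_ind: s => [|s a IH].
    by rewrite raddf0 word0 frlift1 -word0 lnlW.
  case: s IH => [_|c s IH].
    rewrite /= Th1 /ql raddf_sum; apply: eq_bigr => i _; by rewrite raddfMz /= lnlW.
  have ThM x' y : Th (x' * y) = Th x' * Th y by exact: frliftM.
  rewrite lnw_rcons // /com (raddfB Th) !ThM Th1 -cats1 -wordM ThM Th1.
  by rewrite (lnMql _ _ _ (ThW (c :: s))) IH.
pose be (w : seq 'I_k) := b (map e w).
(* [rho] recovers [be w] from the bracket of a good word [w]. A word with a good head has
   coefficient 1 in its own bracket. In the bracket of zxxz with x < z the word zxxz cancels, but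
   xxzz has coefficient 1, so the value is stored there. *)
pose rho (w : seq 'I_k) : Q := if size w == n then
    if w is x :: s then if good_head x s then be w else
      if s is [:: y; z; t] then
        if [&& x == y, z == t & (x < z)%N] then be [:: z; x; x; z] else 0
      else 0
    else 0
  else 0.
have bem w i : size w = n -> i \in w -> be w *~ m i = 0.
  move=> wn iw; case/splitPr: iw wn => u v; rewrite size_cat /= => uv.
  rewrite /be map_cat /= -(multiaddMz bm) ?size_map // em.
  by rewrite (multiadd0 bm) // !size_map.
(* Each value of [rho] is killed by the orders of the letters of the word; this makes [rl] vanish on
   the tensor relations at the end. *)
have rhom w i : i \in w -> rho w *~ m i = 0.
  move=> iw; rewrite /rho; case: eqP => [wn|_]; last by rewrite mul0rz.
  case: w iw wn => [//|y s] iw wn; case: ifP => _; first exact: bem.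
  case: s iw wn => [|a [|c [|d [|]]]] iw wn; rewrite ?mul0rz //.
  case: and3P => [[/eqP E /eqP E' _]|_]; last by rewrite mul0rz.
  by apply: bem => //; move: iw; rewrite -E -E' !inE; do 2!case: (i == _).
pose rl := wlift rho; pose bel := wlift (fun w => if size w == n then be w else 0).
(* Both sides are Lie functions of the word, so [lie_fun_good] leaves only the good words. *)
have rhoE : {in [pred w : seq 'I_k | size w == n], forall w, rl (lnw w) = be w}.
  pose d (w : seq 'I_k) := rl (lnw w) - be w.
  have dl : lie_fun n d.
    apply: lie_funB; have [l1 l2 l3 l4 l5] := lnw_lie 'I_k n; last first.
      have [b1 b2 b3 b4 b5] := bl.
      split=> [a s ns|a c s ns|a c g s ns|n4 a c g h|n4 a c]; rewrite /be /=.
      - by rewrite b1 // size_map.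
      - by rewrite b2 // size_map.
      - by rewrite b3 // size_map.
      - by rewrite b4.
      - by rewrite b5.
    split=> [a s ns|a c s ns|a c g s ns|n4 a c g h|n4 a c].
    - by rewrite l1 // raddf0.
    - by rewrite l2 // raddfN.
    - by rewrite -!raddfD l3 // raddf0.
    - by rewrite -!raddfB l4.
    - by rewrite l5.
  move=> w /eqP wn; apply/eqP; rewrite -subr_eq0; apply/eqP.
  apply: (lie_fun_good n24 dl) => // {wn}w wn; rewrite /good.
  case: w wn => [//|y s] wn /orP[gy|]; rewrite /d.
    have /andP[ys /allP gy'] := gy.
    rewrite -[lnw _](subrK (word (y :: s))) raddfD /= {2}/rl wliftE.
    rewrite {1}/rho wn eqxx gy -addrA subrr addr0.
    have := lnw_head ys; elim=> [_ [z [t [zy pt ->]]]||u v _ Eu _ Ev].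
    - have zt : y \in t.
        have : y \in z :: t by rewrite (perm_mem pt) mem_head.
        by rewrite inE eq_sym (negbTE zy).
      have cy : count_mem y t = 1%N.
        have := permP pt (pred1 y); rewrite /= eqxx (negbTE zy) add0n => ->.
        by rewrite (count_memPn ys).
      rewrite /rl wliftE /rho; case: eqP => // tn.
      case: ifP => [/andP[zt' /allP /(_ _ zt)]|_].
        rewrite cy eqxx /= => ltzy.
        have : z \in s.
          have : z \in y :: s by rewrite -(perm_mem pt) mem_head.
          by rewrite inE (negbTE zy).
        move/gy'; have -> : count_mem z s = 1%N.
          have := permP pt (pred1 z); rewrite /= eqxx (count_memPn zt') eq_sym (negbTE zy).
          by rewrite add0n addn0 => <-.
        by rewrite eqxx /= ltnNge ltnW.
      case: t pt zt cy tn => [|a [|c [|g [|]]]] //= pt zt cy tn.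
      case: and3P => [[/eqP E /eqP E' _]|//]; move: cy zt.
      rewrite -E E' !inE (negbTE zy) eq_sym /=; by case: eqP.
    - by rewrite raddf0.
    - by rewrite raddfB /= Eu Ev subrr.
  case: s wn => [|a [|c [|g [|]]]] wn //= /and3P[/eqP <- /eqP <- ay].
  have ne : a != y by rewrite neq_ltn ay.
  rewrite /lnw /= /com !(mulrBl, mulrBr) !wordM /= !(raddfB rl) /rl /= !wliftE /rho -wn /=.
  rewrite /good_head /= !inE !eqxx !orbT /= !(eq_sym y a) (negbTE ne) /= ay.
  rewrite ltnNge (ltnW ay) /= ?orbT ?andbF /=.
  by zmod.
(* The letters are expanded in the [e i] one at a time from the right; [s] holds the part already
   evaluated. *)
have elS u s : (size u + size s = n)%N -> {subset u <= S} ->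
    wlift (fun w => if size w == size u then b (map e w ++ s) else 0) (Th (word u)) = b (u ++ s).
  elim/last_ind: u s => [|u a IH] s us uS.
    by rewrite word0 frlift1 -word0 wliftE.
  have hu : homog (size u) (Th (word u)) by exact: ThW.
  have aS : a \in S by apply: uS; rewrite mem_rcons mem_head.
  have us' : (size u + (size s).+1 = n)%N by rewrite -us size_rcons addSnnS.
  rewrite cat_rcons [in RHS](eS a aS) (multiadd_sum bm) //.
  rewrite -cats1 -wordM.
  have -> : Th (word u * word [:: a]) = Th (word u) * ql a.
    by rewrite -Th1; exact: frliftM.
  rewrite /ql mulr_sumr raddf_sum; apply: eq_bigr => i _.
  rewrite mulrzAr raddfMz (multiaddMz bm) //; congr (_ *~ _).
  rewrite -IH => [||y yu]; last 1 first.
  - by apply: uS; rewrite mem_rcons inE yu orbT.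
  - elim: hu => [_ [w wu ->]||y z _ Ey _ Ez].
    + by rewrite wordM !wliftE !size_cat wu /= !eqxx map_cat -catA.
    + by rewrite mul0r !raddf0.
    + by rewrite mulrBl !raddfB /= Ey Ez.
  - by rewrite -us size_rcons addSnnS.
have bE s : size s = n -> {subset s <= S} -> b s = bel (Th (word s)).
  move=> sn sS; have := elS s [::]; rewrite addn0 cats0 => <- //.
  have := ThW s; elim=> [_ [w ws ->]||y z _ Ey _ Ez].
  + by rewrite /bel !wliftE ws sn eqxx cats0.
  + by rewrite !raddf0.
  + by rewrite !raddfB /= Ey Ez.
have rlE s : size s = n -> {subset s <= S} -> b s = rl (Th (lnw s)).
  move=> sn sS; rewrite bE // Thln; have := ThW s.
  elim=> [_ [w ws ->]||y z _ Ey _ Ez].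
  + by rewrite lnlW rhoE /bel ?wliftE ?inE ws sn eqxx.
  + by rewrite !raddf0.
  + by rewrite !raddfB /= Ey Ez.
have -> : wlift b x = rl (Th (lnl _ x)).
  elim: hx {hE} => [_ [s [sn sS ->]]||y z _ Ey _ Ez].
  + by rewrite lnlW wliftE rlE.
  + by rewrite !raddf0.
  + by rewrite !raddfB /= Ey Ez.
elim: hE => [_ [u [v [r [rr ->]]]]||y z _ Ey _ Ez]; last 2 first.
- by rewrite !raddf0.
- by rewrite !raddfB /= Ey Ez subrr.
have {}qb i : exists c, q i << r.1 + r.2 >> - q i << r.1 >> - q i << r.2 >> = c * m i.
  rewrite -!(raddfB (q i)); apply: qb; apply/mapP; by exists r.
(* The expansion of a relation has coefficients that are multiples of [m i] at the letter [i], and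
   such multiples are killed by [rhom]. *)
have -> : Th (word u * trel r.1 r.2 * word v)
    = \sum_i (Th (word u) * word [:: i] * Th (word v))
        *~ (q i << r.1 + r.2 >> - q i << r.1 >> - q i << r.2 >>).
  have ThM x' y : Th (x' * y) = Th x' * Th y by exact: frliftM.
  rewrite !ThM /trel (raddfB Th) (raddfB Th) !Th1 /ql -!sumrB mulr_sumr mulr_suml.
  apply: eq_bigr => i _; rewrite -!mulrzBr mulrzAr mulrzAl.
  by [].
rewrite raddf_sum big1 // => i _; have [c ->] := qb i.
rewrite mulrC mulrzA raddfMz /= raddfMz /=.
suff -> : rl (Th (word u) * word [:: i] * Th (word v)) *~ m i = 0 by rewrite mul0rz.
have := ThW u; elim=> [_ [w _ ->]||y z _ Ey _ Ez]; last 2 first.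
- by rewrite !mul0r raddf0 mul0rz.
- by rewrite !mulrBl raddfB /= mulrzBl Ey Ez subrr.
have := ThW v; elim=> [_ [w' _ ->]||y z _ Ey _ Ez]; last 2 first.
- by rewrite mulr0 raddf0 mul0rz.
- by rewrite mulrBr raddfB /= mulrzBl Ey Ez subrr.
rewrite !wordM /rl wliftE rhom // !mem_cat mem_seq1 eqxx orbT //.
Qed.

End Detect.

(** * Brackets in filtered groups *)

Lemma tens_id_closed (A : zmodType) : zclosed (@tens_id A).
Proof. exact: zclosed_gen. Qed.

Lemma tens_id_mull (A : zmodType) (y x : FR A) : tens_id x -> tens_id (y * x).
Proof.
have H := zgen_sub (zclosed_mull y (@tens_id_closed A)); apply: H => {x} _ [u [v [a [b ->]]]].
apply: (word_ind (P := fun y => tens_id (y * (word u * trel a b * word v)))) => [|s].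
  exact: zclosed_mulr (@tens_id_closed A).
by rewrite !mulrA wordM; apply: zgen_in; exists (s ++ u), v, a, b.
Qed.

Lemma tens_id_mulr (A : zmodType) (y x : FR A) : tens_id x -> tens_id (x * y).
Proof.
have H := zgen_sub (zclosed_mulr y (@tens_id_closed A)); apply: H => {x} _ [u [v [a [b ->]]]].
apply: (word_ind (P := fun y => tens_id (word u * trel a b * word v * y))) => [|s].
  exact: zclosed_mull (@tens_id_closed A).
by rewrite -mulrA wordM; apply: zgen_in; exists u, (v ++ s), a, b.
Qed.

Section FilteredGroup.
Variables (T : groupType) (F : set T).
Hypothesis Fg : gclosed F.
Notation lc := (lc F).

(** [K n] lies between [lc n.+1] and [lc n] and plays the part of the elements without leading term.
    Two instances occur: [K1], with leading terms over the abelianization, and [lc n.+1] itself,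
    with leading terms over the free abelian group on G. *)
Variable K : nat -> set T.
Hypotheses (Kg : forall n, gclosed (K n))
  (K_lc : forall n x, K n x -> lc n x) (lc_K : forall n x, lc n.+1 x -> K n x)
  (KR : forall n x y, K n x -> F y -> K n.+1 [~ x, y]%g)
  (RK : forall n x y, lc n x -> K 0 y -> K n.+1 [~ x, y]%g).

Let lcM n x y : lc n x -> lc n y -> lc n (x * y)%g.
Proof. by have [_ H _] := lc_closed Fg n; apply: H. Qed.
Let lcV n x : lc n x -> lc n (x^-1)%g.
Proof. by have [_ _ H] := lc_closed Fg n; apply: H. Qed.
Let lc1 n : lc n 1%g. Proof. by have [] := lc_closed Fg n. Qed.
Let FM x y : F x -> F y -> F (x * y)%g. Proof. exact: (@lcM 0). Qed.
Let FV x : F x -> F (x^-1)%g. Proof. exact: (@lcV 0). Qed.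

Let NR n x y : lc n x -> lc n y -> K n [~ x, y]%g.
Proof.
move=> Hx Hy; apply: lc_K; apply: (lcW Fg (n := (n + n).+1)); first by rewrite ltnS leq_addr.
exact: lcRR.
Qed.

Let Qc n := cid (subgroup_quotient (lc_closed Fg n) (Kg n) (@NR n)).
Definition gr_quot n : zmodType := sval (Qc n).
Definition gr_cls n : T -> gr_quot n := sval (cid (svalP (Qc n))).
Notation Q := gr_quot.
Notation c := gr_cls.

Lemma cD n x y : lc n x -> lc n y -> c n (x * y)%g = c n x + c n y.
Proof. by rewrite /c; case: (cid _) => f /= [fD _]; apply: fD. Qed.

Lemma c_eq0 n x : lc n x -> c n x = 0 <-> K n x.
Proof. by rewrite /c; case: (cid _) => f /= [_ f0]; apply: f0. Qed.

Lemma c1 n : c n 1%g = 0.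
Proof. by apply/c_eq0; [exact: lc1 | have [] := Kg n]. Qed.

Lemma cV n x : lc n x -> c n (x^-1)%g = - c n x.
Proof. by move=> Hx; apply: (addIr (c n x)); rewrite -cD ?mulVg ?c1 ?addNr //; apply: lcV. Qed.

Lemma cJ n x y : lc n x -> F y -> c n (x ^ y)%g = c n x.
Proof.
move=> Hx Fy; have Hxy := lcR Hx Fy; rewrite conjg_mulR cD //; last exact: lc_decr.
by rewrite (_ : c n [~ x, y]%g = 0) ?addr0 //; apply/c_eq0; [exact: lc_decr | exact: lc_K].
Qed.

Lemma cK n x y : lc n x -> lc n y -> c n x = c n y -> K n (x^-1 * y)%g.
Proof.
move=> Hx Hy E; apply/c_eq0; first by apply: lcM => //; apply: lcV.
by rewrite cD ?cV ?E ?addNr //; apply: lcV.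
Qed.

Lemma cRMl i j x x' y : lc i x -> lc i x' -> lc j y ->
  c (i + j).+1 [~ x * x', y]%g = c (i + j).+1 [~ x, y]%g + c (i + j).+1 [~ x', y]%g.
Proof.
move=> Hx Hx' Hy; have h := lcRR Fg Hx Hy; have h' := lcRR Fg Hx' Hy.
have Fx' : F x' := lc_F Fg Hx'.
by rewrite commMgJ cD ?cJ //; apply: lcJ.
Qed.

Lemma cRMr i j x y y' : lc i x -> lc j y -> lc j y' ->
  c (i + j).+1 [~ x, y * y']%g = c (i + j).+1 [~ x, y]%g + c (i + j).+1 [~ x, y']%g.
Proof.
move=> Hx Hy Hy'; have h := lcRR Fg Hx Hy; have h' := lcRR Fg Hx Hy'.
have Fy' : F y' := lc_F Fg Hy'.
by rewrite commgMJ cD ?cJ 1?addrC //; apply: lcJ.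
Qed.

Lemma cRN i j x y : lc i x -> lc j y -> c (i + j).+1 [~ y, x]%g = - c (i + j).+1 [~ x, y]%g.
Proof. by move=> Hx Hy; rewrite -invgR cV //; apply: lcRR. Qed.

Lemma cRVl i j x y : lc i x -> lc j y ->
  c (i + j).+1 [~ x^-1, y]%g = - c (i + j).+1 [~ x, y]%g.
Proof.
move=> Hx Hy; apply: (addIr (c (i + j).+1 [~ x, y]%g)).
by rewrite -(cRMl _ Hx Hy) ?mulVg ?comm1g ?c1 ?addNr //; apply: lcV.
Qed.

(** This is the Hall-Witt identity read modulo [K]: conjugations disappear, and [twist] trades the
    inner inverses for signs, as the corrections lie one step deeper. *)
Lemma cR_jacobi i j k x y z : lc i x -> lc j y -> lc k z ->
  c (i + j + k).+2 [~ x, y, z]%g + c (i + j + k).+2 [~ y, z, x]%g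
    + c (i + j + k).+2 [~ z, x, y]%g = 0.
Proof.
pose n := (i + j + k)%N; rewrite -/n.
have twist (i' j' k' : nat) (u v w : T) : (i' + j' + k')%N = n ->
    lc i' u -> lc j' v -> lc k' w ->
    lc n.+2 [~ u, v^-1, w]%g /\ c n.+2 [~ u, v^-1, w]%g = - c n.+2 [~ u, v, w]%g.
  move=> En Hu Hv Hw; have Fv' : F (v^-1)%g by apply: FV; apply: lc_F Hv.
  have Huv := lcRR Fg Hu Hv; have HuV := lcV Huv.
  have Enn : n.+2 = ((i' + j').+1 + k').+1 by lia.
  rewrite commgVJ conjg_mulR Enn; set t := [~ u, v]^-1%g in HuV *.
  have Ht : lc (i' + j').+1 [~ t, v^-1]%g by apply: lc_decr => //; apply: lcR.
  split; first by apply: lcRR => //; apply: lcM.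
  rewrite cRMl // /t cRVl // -[RHS]addr0; congr (_ + _); apply/c_eq0; first exact: lcRR.
  apply: lc_K; have h := lcRR Fg (lcR HuV Fv') Hw.
  by rewrite -addSn.
move=> Hx Hy Hz; have hw := Hall_Witt x y z.
have [h1 e1] := twist i j k x y z erefl Hx Hy Hz.
have [h2 e2] := twist j k i y z x ltac:(rewrite /n; lia) Hy Hz Hx.
have [h3 e3] := twist k i j z x y ltac:(rewrite /n; lia) Hz Hx Hy.
have Fx := lc_F Fg Hx; have Fy := lc_F Fg Hy; have Fz := lc_F Fg Hz.
have : c n.+2 ([~ x, y^-1, z] ^ y * [~ y, z^-1, x] ^ z * [~ z, x^-1, y] ^ x)%g = 0.
  by rewrite hw c1.
have hJ u v : lc n.+2 u -> F v -> lc n.+2 (u ^ v)%g by apply: lcJ.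
have j1 := hJ _ _ h1 Fy; have j2 := hJ _ _ h2 Fz; have j3 := hJ _ _ h3 Fx.
rewrite (cD (lcM j1 j2) j3) (cD j1 j2) (cJ h1 Fy) (cJ h2 Fz) (cJ h3 Fx) e1 e2 e3 => E.
by apply: oppr_inj; rewrite oppr0 -{}E; zmod.
Qed.

Lemma cR_K n x y : K n x -> F y -> c n.+1 [~ x, y]%g = 0.
Proof. by move=> Kx Fy; apply/c_eq0; [apply: lcR => //; apply: K_lc | apply: KR]. Qed.

Lemma cRDl n x x' y : lc n x -> lc n x' -> F y ->
  c n.+1 [~ x * x', y]%g = c n.+1 [~ x, y]%g + c n.+1 [~ x', y]%g.
Proof. by move=> Hx Hx' Fy; have := @cRMl n 0 x x' y Hx Hx' Fy; rewrite addn0. Qed.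

Lemma cR_congr n x y z : lc n x -> lc n y -> c n x = c n y -> F z ->
  c n.+1 [~ x, z]%g = c n.+1 [~ y, z]%g.
Proof.
move=> Hx Hy E Fz; have k := cK Hx Hy E; rewrite -[y in RHS](mulVKg x) cRDl ?(cR_K k) ?addr0 //.
exact: K_lc.
Qed.

Lemma cR_congr_r n x y z : lc n x -> F y -> F z -> K 0 (y^-1 * z)%g ->
  c n.+1 [~ x, y]%g = c n.+1 [~ x, z]%g.
Proof.
move=> Hx Fy Fz k; rewrite -[z in RHS](mulVKg y).
have := @cRMr n 0 x y (y^-1 * z)%g Hx Fy (K_lc k); rewrite addn0 => ->.
rewrite [X in _ + X](_ : _ = 0) ?addr0 //; apply/c_eq0; last exact: RK.
by apply: lcR => //; apply: K_lc k.
Qed.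

Variables (A : zmodType) (V : A -> T).
Hypotheses (VF : forall a, F (V a))
  (VD : forall a b, K 0 ((V (a + b))^-1 * (V a * V b))%g)
  (Vsurj : forall y, F y -> exists a, K 0 (y^-1 * V a)%g).

Definition lng (s : seq A) : T :=
  if s is a :: s' then foldl (fun x b => [~ x, V b]%g) (V a) s' else 1%g.

Lemma lng_rcons s b : (0 < size s)%N -> lng (rcons s b) = [~ lng s, V b]%g.
Proof. by case: s => [//|a s] _; rewrite /lng /= foldl_rcons. Qed.

Lemma lc_lng s n : size s = n.+1 -> lc n (lng s).
Proof.
elim/last_ind: s n => // s b IH n; rewrite size_rcons => -[].
case: s IH => [|a s] IH <-; first exact: VF.
by rewrite lng_rcons //; apply: lcR => //; apply: IH.
Qed.

Lemma lng_cat_cons u x v n : (size u + size v)%N = n -> lc n (lng (u ++ x :: v)).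
Proof. by move=> uv; apply: lc_lng; rewrite size_cat /= addnS uv. Qed.

(** [V] is additive only modulo [K 0]; this suffices because a commutator of [lc n] with [K 0] lies
    in [K n.+1]. *)
Lemma lng_add n : multiadd n.+1 (c n \o lng).
Proof.
move=> u v x y; rewrite addnS => -[] /=.
elim/last_ind: v n => [|v b IH] n.
  rewrite addn0 => <-; case/lastP: u => [|u z] /=.
    have k := VD x y; have E : c 0 (V x * V y)%g = c 0 (V x) + c 0 (V y).
      by apply: cD; exact: VF.
    have V0 : lc 0 (V (x + y)) by exact: VF.
    rewrite -E -[(V x * V y)%g](mulVKg (V (x + y))) (cD V0 (K_lc k)).
    by rewrite (proj2 (c_eq0 (K_lc k)) k) addr0.
  have ru w : lng (rcons u z ++ [:: w]) = [~ lng (rcons u z), V w]%g.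
    by rewrite cats1 lng_rcons // size_rcons.
  rewrite size_rcons !ru.
  have Hu : lc (size u) (lng (rcons u z)) by apply: lc_lng; rewrite size_rcons.
  rewrite (cR_congr_r Hu (VF (x + y)) (FM (VF x) (VF y)) (VD x y)).
  by have := @cRMr (size u) 0 _ _ _ Hu (VF x) (VF y); rewrite addn0.
rewrite size_rcons addnS => <-; have {}IH := IH (size u + size v)%N erefl.
have E w : u ++ w :: rcons v b = rcons (u ++ w :: v) b by rewrite rcons_cat.
rewrite !E !lng_rcons ?size_cat ?addnS //.
rewrite -cRDl //; try exact: lng_cat_cons.
apply: cR_congr => //; try exact: lng_cat_cons.
  by apply: lcM; exact: lng_cat_cons.
by rewrite cD //; exact: lng_cat_cons.
Qed.

Lemma foldl_c0 n x s : lc n x -> c n x = 0 ->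
  c (n + size s)%N (foldl (fun x b => [~ x, V b]%g) x s) = 0.
Proof.
elim: s n x => [|b s IH] n x Hx cx /=; first by rewrite addn0.
rewrite addnS -addSn; apply: IH; first exact: lcR.
by apply: cR_K => //; apply/c_eq0.
Qed.

Lemma foldl_cD n x y s : lc n x -> lc n y ->
  c (n + size s)%N (foldl (fun x b => [~ x, V b]%g) (x * y)%g s) =
  c (n + size s)%N (foldl (fun x b => [~ x, V b]%g) x s)
    + c (n + size s)%N (foldl (fun x b => [~ x, V b]%g) y s).
Proof.
suff H : forall s n x y z, lc n x -> lc n y -> lc n z -> c n z = c n x + c n y ->
    c (n + size s)%N (foldl (fun x b => [~ x, V b]%g) z s) =
    c (n + size s)%N (foldl (fun x b => [~ x, V b]%g) x s)
    + c (n + size s)%N (foldl (fun x b => [~ x, V b]%g) y s).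
  by move=> Hx Hy; apply: H => //; [exact: lcM | exact: cD].
elim=> [|b t IH] {}n {}x {}y z Hx Hy Hz E /=; first by rewrite addn0.
rewrite addnS -addSn; apply: IH; do ?exact: lcR.
by rewrite -cRDl //; apply: cR_congr => //; [exact: lcM | rewrite cD].
Qed.

Lemma lng_lie n : (n <= 3)%N -> lie_fun n.+1 (c n \o lng).
Proof.
move=> n3; have R2 a b : lc 1 [~ V a, V b]%g by apply: (@lcR _ _ 0); exact: VF.
have R3 a b d : lc 2 [~ V a, V b, V d]%g by apply: (@lcR _ _ 1).
(* Applied to a commutator [z], this yields the two identities special to degree 4: the antisymmetry
   of [[a, b], [d, e]], and its vanishing when the two brackets coincide. *)
have c4 (z : T) x y : lc 1 z -> F x -> F y ->
    c 3 [~ z, x, y]%g - c 3 [~ z, y, x]%g = c 3 [~ z, [~ x, y]]%g.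
  move=> Hz Fx Fy; have := @cR_jacobi 1 0 0 z x y Hz Fx Fy.
  have -> : c 3 [~ x, y, z]%g = - c 3 [~ z, [~ x, y]]%g.
    by apply: (@cRN 1 1) => //; apply: (@lcR _ _ 0).
  have -> : c 3 [~ y, z, x]%g = - c 3 [~ z, y, x]%g.
    by rewrite -(invgR z y); apply: (@cRVl 2 0) => //; apply: lcR.
  by move=> E; rewrite -[RHS]add0r -E; zmod.
split=> [a s|a b s|a b d s|n4 a b d e|n4 a b].
- case=> ns /=; rewrite -ns -add1n commgg; apply: foldl_c0; first exact: lc1.
  exact: c1.
- case=> ns /=; rewrite -ns -add1n -(invgR (V b) (V a)).
  apply: (addIr (c (1 + size s)%N (foldl (fun x b => [~ x, V b]%g) [~ V b, V a]%g s))).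
  rewrite addNr -foldl_cD ?mulVg; last exact: R2; last exact: (lcV (R2 _ _)).
  by apply: foldl_c0; [exact: lc1 | exact: c1].
- case=> ns /=; rewrite -ns -add2n; have r1 := R3 a b d; have r2 := R3 b d a.
  have r3 := R3 d a b; have r12 := lcM r1 r2.
  rewrite -(foldl_cD s r1 r2) -(foldl_cD s r12 r3); apply: foldl_c0; first exact: lcM.
  by rewrite (cD r12 r3) (cD r1 r2); apply: (@cR_jacobi 0 0 0); exact: VF.
- case: n4 => ->; rewrite /= (c4 _ _ _ (R2 a b) (VF d) (VF e)).
  rewrite -[RHS]opprB (c4 _ _ _ (R2 d e) (VF a) (VF b)).
  exact: (@cRN 1 1).
- case: n4 => -> /=; apply/eqP; rewrite -subr_eq0; apply/eqP.
  by rewrite (c4 _ _ _ (R2 a b) (VF a) (VF b)) commgg c1.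
Qed.

(** The last clause makes one tensor control both [g] and its brackets with letters, which is what
    the inductive step of [lead_realize] needs. *)
Lemma word_realize n x : homog n.+1 x -> exists g, [/\ lc n g, c n g = wlift (c n \o lng) x
  & forall a, c n.+1 [~ g, V a]%g = wlift (c n.+1 \o lng) (x * word [:: a])].
Proof.
elim=> [_ [s sn ->]||y z _ [g [Hg Eg Bg]] _ [h [Hh Eh Bh]]].
- exists (lng s); split; [exact: lc_lng | by rewrite wliftE | move=> a].
  by rewrite wordM wliftE /= cats1 lng_rcons // sn.
- exists 1%g; split=> [||a]; [exact: lc1 | by rewrite raddf0 c1 |].
  by rewrite mul0r raddf0 comm1g c1.
exists (g * h^-1)%g; split=> [||a]; first by apply: lcM => //; apply: lcV.
  by rewrite cD ?cV ?raddfB ?Eg ?Eh //; apply: lcV.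
rewrite cRDl //; last exact: lcV.
have := @cRVl n 0 h (V a) Hh (VF a); rewrite addn0 => ->.
by rewrite mulrBl raddfB /= Bg Bh.
Qed.

Variable ld : nat -> T -> FR A.
Hypotheses
  (ldM : forall n x y, lc n x -> lc n y -> tens_id (ld n (x * y)%g - (ld n x + ld n y)))
  (ldR : forall n x y, (n < 3)%N -> lc n x -> F y ->
      tens_id (ld n.+1 [~ x, y]%g - com (ld n x) (ld 0 y)))
  (ldK : forall n x, K n x -> tens_id (ld n x))
  (ldV : forall a, tens_id (ld 0 (V a) - word [:: a])).

Let tc := @tens_id_closed A.

Lemma ld1 n : tens_id (ld n 1%g).
Proof. by apply: ldK; have [] := Kg n. Qed.

Lemma ldVg n x : lc n x -> tens_id (ld n (x^-1)%g + ld n x).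
Proof.
move=> Hx; have := zclosedN tc (ldM (lcV Hx) Hx).
rewrite mulVg => /(zclosedD tc (ld1 n)); congr (tens_id _); zmod.
Qed.

Lemma com_congr (x x' y y' : FR A) : tens_id (x - x') -> tens_id (y - y') ->
  tens_id (com x y - com x' y').
Proof.
move=> tx ty; rewrite (_ : _ - _ = (x - x') * y + x' * (y - y')
  - ((y - y') * x + y' * (x - x'))); last by rewrite /com; ncring.
apply: (proj2 tc); apply: (zclosedD tc).
- exact: tens_id_mulr. - exact: tens_id_mull. - exact: tens_id_mulr. - exact: tens_id_mull.
Qed.

Lemma ld0_congr y a : F y -> K 0 (y^-1 * V a)%g -> tens_id (ld 0 y - word [:: a]).
Proof.
move=> Fy k; apply: (zclosed_eq tc _ (ldV a)).
have := zclosedD tc (ldM (n := 0) Fy (K_lc k)) (ldK k); rewrite mulVKg.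
by move/(zclosedN tc); congr (tens_id _); zmod.
Qed.

(** The same tensor [x] gives the class of [g] modulo [K n], by left-normed group commutators, and
    the leading term of [g], by the Dynkin operator. *)
Lemma lead_realize n g : (n <= 3)%N -> lc n g -> exists x,
  [/\ homog n.+1 x, c n g = wlift (c n \o lng) x
  & tens_id (ld n g - lnl A x)].
Proof.
elim: n g => [|n IH] g n3.
  move=> Fg'; have [a k] := Vsurj Fg'; exists (word [:: a]); split.
  - by apply: zgen_in; exists [:: a].
  - rewrite wliftE /= -{1}[g](mulgK (g^-1 * V a)%g).
    apply/esym; rewrite -[V a](mulVKg g) cD //; last exact: K_lc k.
    by rewrite (proj2 (c_eq0 (K_lc k)) k) addr0 mulgK.
  - by rewrite lnlW; apply: ld0_congr.
pose P : set T := [set g | lc n.+1 g /\ exists x,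
  [/\ homog n.+2 x, c n.+1 g = wlift (c n.+1 \o lng) x & tens_id (ld n.+1 g - lnl A x)]].
suff Pg : gclosed P /\ (forall z, (exists x y, [/\ lc n x, F y & z = [~ x, y]%g]) -> P z).
  move=> Hg; suff : P g by case.
  by move: g Hg; rewrite lcS; apply: ggen_sub; case: Pg.
split; [split|].
- split; first exact: lc1.
  exists 0; split; [exact: zgen_0 | by rewrite c1 raddf0 | rewrite raddf0 subr0].
  exact: ld1.
- move=> g1 g2 [H1 [x1 [h1 e1 l1]]] [H2 [x2 [h2 e2 l2]]]; split; first exact: lcM.
  exists (x1 + x2); split; first exact: zclosedD (homog_closed _ _) h1 h2.
    by rewrite cD // raddfD /= e1 e2.
  rewrite raddfD /=; have := zclosedD tc (ldM H1 H2) (zclosedD tc l1 l2).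
  by congr (tens_id _); zmod.
- move=> g1 [H1 [x1 [h1 e1 l1]]]; split; first exact: lcV.
  exists (- x1); split; first exact: zclosedN (homog_closed _ _) h1.
    by rewrite cV // raddfN /= e1.
  rewrite raddfN /=; have := proj2 tc _ _ (ldVg H1) l1.
  by congr (tens_id _); zmod.
- move=> z [x [y [Hx Fy ->]]]; split; first exact: lcR.
  have [X [hX eX lX]] := IH x (ltnW n3) Hx; have [a k] := Vsurj Fy.
  have [u [Hu eu bu]] := word_realize hX.
  exists (X * word [:: a]); split.
  - rewrite -addn1; apply: homogM => //; by apply: zgen_in; exists [:: a].
  - rewrite -bu (cR_congr_r Hx Fy (VF a) k); apply: cR_congr => //.
    by rewrite eX eu.
  - rewrite (lnlM _ hX); apply: (zclosed_eq tc _ (com_congr lX (ld0_congr Fy k))).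
    have := ldR n3 Hx Fy; congr (tens_id _); zmod.
Qed.

(** The class of [g] is the value at [x] of a multiadditive Lie function, and the bracket of [x]
    vanishes as a tensor; [lie_detect] then makes the class zero. *)
Lemma lead_detect n g : (0 < n <= 3)%N -> lc n g -> tens_id (ld n g) -> K n g.
Proof.
move=> /andP[n0 n3] Hg lg; have [x [hx ex lx]] := lead_realize n3 Hg.
apply/(c_eq0 Hg); rewrite ex; apply: (@lie_detect A _ n.+1) => //.
- by rewrite !ltnS n0.
- exact: lng_add.
- exact: lng_lie.
- by have := proj2 tc _ _ lg lx; congr (tens_id _); zmod.
Qed.

End FilteredGroup.

(** * The group generated by the elements (g, 1 + X_g) *)

Section UnitGroup.
Variable R : pzRingType.

(** The inverse is carried as data, which makes group inversion explicit; by [up_eq] it adds no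
    information. *)
Definition unit_pair := {p : R * R | (p.1 * p.2 == 1) && (p.2 * p.1 == 1)}.
HB.instance Definition _ := Choice.on unit_pair.

Definition up_val (u : unit_pair) : R := (val u).1.
Definition up_inv (u : unit_pair) : R := (val u).2.

Lemma up_valV u : up_val u * up_inv u = 1.
Proof. by have /andP[/eqP] := valP u. Qed.

Lemma up_Vval u : up_inv u * up_val u = 1.
Proof. by have /andP[_ /eqP] := valP u. Qed.

Definition up_mk (a b : R) (ab : a * b = 1) (ba : b * a = 1) : unit_pair.
Proof. by exists (a, b); rewrite /= ab ba !eqxx. Defined.

Definition up_one : unit_pair := up_mk (mul1r 1) (mul1r 1).
Definition up_V (u : unit_pair) : unit_pair := up_mk (up_Vval u) (up_valV u).

Lemma up_mul_subproof u v : up_val u * up_val v * (up_inv v * up_inv u) = 1.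
Proof. by rewrite mulrA -(mulrA (up_val u)) up_valV mulr1 up_valV. Qed.

Lemma up_mul_subproof2 u v : up_inv v * up_inv u * (up_val u * up_val v) = 1.
Proof. by rewrite mulrA -(mulrA (up_inv v)) up_Vval mulr1 up_Vval. Qed.

Definition up_mul u v : unit_pair := up_mk (up_mul_subproof u v) (up_mul_subproof2 u v).

Lemma up_eq u v : up_val u = up_val v -> u = v.
Proof.
move=> E; apply/val_inj; have : up_inv u = up_inv v.
  by rewrite -[LHS]mulr1 -(up_valV v) mulrA -E up_Vval mul1r.
by move: E; rewrite /up_val /up_inv; case: (val u) => a b; case: (val v) => c d /= -> ->.
Qed.

Lemma up_mulA : associative up_mul.
Proof. by move=> u v w; apply: up_eq; rewrite /up_val /= mulrA. Qed.
Lemma up_mul1 : left_id up_one up_mul.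
Proof. by move=> u; apply: up_eq; rewrite /up_val /= mul1r. Qed.
Lemma up_mulr1 : right_id up_one up_mul.
Proof. by move=> u; apply: up_eq; rewrite /up_val /= mulr1. Qed.
Lemma up_mulV : left_inverse up_one up_V up_mul.
Proof. by move=> u; apply: up_eq; exact: up_Vval. Qed.
Lemma up_mulrV : right_inverse up_one up_V up_mul.
Proof. by move=> u; apply: up_eq; exact: up_valV. Qed.

HB.instance Definition _ := isGroup.Build unit_pair
  up_mulA up_mul1 up_mulr1 up_mulV up_mulrV.

End UnitGroup.

Section CommutatorExpansion.
Variable R : pzRingType.

Lemma comm_expand (u u' v v' : R) : u' * u = 1 -> v' * v = 1 ->
  u' * v' * (u * v) - 1 = u' * v' * com (u - 1) (v - 1).
Proof.
move=> uu vv; have E : u' * v' * (v * u) = 1 by rewrite mulrA -(mulrA u') vv mulr1 uu.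
by rewrite -{1}E; rewrite /com; ncring.
Qed.

End CommutatorExpansion.

Section BigGroup.
Variable G : groupType.
Notation M := (trunc G 5).
Notation A := (abelianization G).

Definition bigG : groupType := (G * unit_pair M)%type.
Definition um (x : bigG) : M := up_val x.2.
Definition umV (x : bigG) : M := up_inv x.2.

Lemma um1 : um 1%g = 1. Proof. by []. Qed.
Lemma umM x y : um (x * y)%g = um x * um y. Proof. by []. Qed.
Lemma um_inv x : um (x^-1)%g = umV x. Proof. by []. Qed.
Lemma umK x : um x * umV x = 1. Proof. exact: up_valV. Qed.
Lemma umVK x : umV x * um x = 1. Proof. exact: up_Vval. Qed.
Lemma fstM (x y : bigG) : (x * y)%g.1 = (x.1 * y.1)%g. Proof. by []. Qed.
Lemma fstV (x : bigG) : (x^-1)%g.1 = (x.1^-1)%g. Proof. by []. Qed.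

Lemma umR x y : um [~ x, y]%g - 1 = umV x * umV y * com (um x - 1) (um y - 1).
Proof.
by rewrite -(comm_expand (umVK x) (umVK y)) /commg /conjg !umM !um_inv !mulrA.
Qed.

Lemma fil1_geo (g : G) : (1 + X g) * geo (X g) = 1 /\ geo (X g) * (1 + X g) = 1.
Proof. by apply: geo_mul; exact: fil1_X. Qed.

Definition xg (g : G) : bigG :=
  (g, up_mk (proj1 (fil1_geo g)) (proj2 (fil1_geo g))).

Lemma um_xg g : um (xg g) = 1 + X g. Proof. by []. Qed.

Definition Fs : set bigG := ggenerated [set x | exists g, x = xg g].

Lemma Fs_closed : gclosed Fs. Proof. exact: gclosed_gen. Qed.

Lemma Fs_xg g : Fs (xg g). Proof. by apply: ggen_in; exists g. Qed.

Lemma inv_sub1 x : umV x - 1 = - (umV x * (um x - 1)).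
Proof. by rewrite mulrBr umVK mulr1; zmod. Qed.

Let fc n := fil_closed (K := G) (N := 5) n.

Lemma filV n x : fil n (um x - 1) -> fil n (umV x - 1).
Proof.
move=> fx; rewrite inv_sub1; apply: (zclosedN (fc n)).
by rewrite -[n]add0n; apply: filM.
Qed.

Lemma sub1_mul (a b : M) : a * b - 1 = (a - 1) + (b - 1) + (a - 1) * (b - 1).
Proof. ncring. Qed.

Lemma filMu n x y : fil n (um x - 1) -> fil n (um y - 1) -> fil n (um (x * y)%g - 1).
Proof.
move=> fx fy; rewrite umM sub1_mul; apply: (zclosedD (fc n)).
  exact: zclosedD (fc n) fx fy.
by apply: (filW (n := n + n)); rewrite ?leq_addr //; apply: filM.
Qed.

Lemma Fs_fil1 x : Fs x -> fil 1 (um x - 1).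
Proof.
have H : gclosed [set x | fil 1 (um x - 1)].
  split=> [|a b fa fb|a fa]; rewrite /mkset ?um1 ?subrr; first by case: (fc 1).
    exact: filMu.
  by rewrite um_inv; apply: filV.
apply: (ggen_sub H) => _ [g ->]; rewrite /mkset um_xg addrC addKr.
exact: fil1_X.
Qed.

Lemma fil_mul1 m n (a b c d : M) : fil m c -> fil n d -> fil (m + n)%N (a * b * com c d).
Proof.
move=> hc hd; rewrite -[(m + n)%N]add0n; apply: filM => //.
by apply: (proj2 (fc _)); [|rewrite addnC]; apply: filM.
Qed.

Lemma filR m n x y : fil m (um x - 1) -> fil n (um y - 1) ->
  fil (m + n)%N (um [~ x, y]%g - 1).
Proof. by move=> fx fy; rewrite umR; apply: fil_mul1. Qed.

Lemma lc_fil n x : lc Fs n x -> fil n.+1 (um x - 1).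
Proof.
elim: n x => [|n IH] x; first exact: Fs_fil1.
have H : gclosed [set x | fil n.+2 (um x - 1)].
  split=> [|a b fa fb|a fa]; rewrite /mkset ?um1 ?subrr; first by case: (fc n.+2).
    exact: filMu.
  by rewrite um_inv; apply: filV.
apply: (ggen_sub H) => _ [a [b [/IH fa Fb ->]]]; rewrite /mkset -(addn1 n.+1).
by apply: filR => //; apply: Fs_fil1.
Qed.

Lemma umR_lead m n x y : fil m.+1 (um x - 1) -> fil n.+1 (um y - 1) ->
  fil (m + n).+3 (um [~ x, y]%g - 1 - com (um x - 1) (um y - 1)).
Proof.
move=> fx fy; rewrite umR; set w := com _ _.
have fw : fil (m.+1 + n.+1)%N w.
  by apply: (proj2 (fc _)); [|rewrite addnC]; apply: filM.
have fV (z : bigG) k : fil k.+1 (um z - 1) -> fil 1 (umV z - 1).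
  by move=> fz; apply: filV; apply: filW fz.
rewrite (_ : _ - w = (umV x * umV y - 1) * w); last by ncring.
rewrite (_ : (m + n).+3 = 1 + (m.+1 + n.+1))%N; last by lia.
apply: filM => //; rewrite sub1_mul; apply: (zclosedD (fc 1)).
  by apply: (zclosedD (fc 1)); [apply: fV fx | apply: fV fy].
by apply: (filW (n := 1 + 1)) => //; apply: filM; [apply: fV fx | apply: fV fy].
Qed.

(** The letter of the unit is not 0 in M, but [rel 1 1] is (1 + X_1) X_1 and 1 + X_1 is
    invertible. *)
Lemma rr_X1 : rr (X (1%g : G)).
Proof.
have := rr_mull (geo (X 1%g)) (rr_rel (1%g : G) 1%g); congr rr.
have [_ E] := fil1_geo 1%g; rewrite /rel mulg1 mulrBr mulrA E mul1r.
by rewrite addrC addKr.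
Qed.

(** On a generator the difference is 0, and products and inverses respect the congruence because 1 +
    X is multiplicative modulo [rr]. The two components of an element of [Fs] thus describe the same
    element of Z[G], up to truncation. *)
Lemma Fs_rr x : Fs x -> rr (um x - (1 + X x.1)).
Proof.
have c := rr_closed G.
have H : gclosed [set x | rr (um x - (1 + X x.1))].
  have mulC (a b : bigG) : rr (um a - (1 + X a.1)) -> rr (um b - (1 + X b.1)) ->
      rr (um (a * b)%g - (1 + X (a * b)%g.1)).
    move=> ra FR_of_malg; rewrite umM fstM.
    rewrite (_ : _ - _ = (um a - (1 + X a.1)) * um b + (1 + X a.1) * (um b - (1 + X b.1))
      + rel a.1 b.1); last by rewrite /rel; ncring.
    apply: (zclosedD c); last exact: rr_rel.
    by apply: (zclosedD c); [apply: rr_mulr | apply: rr_mull].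
  split=> [|a b|a ra]; rewrite /mkset.
  - by rewrite um1 opprD addNKr; apply: (zclosedN c); exact: rr_X1.
  - exact: mulC.
  rewrite um_inv fstV.
  rewrite (_ : _ - _ = - (umV a * (um a - (1 + X a.1)) * (1 + X (a.1^-1)%g))
     - umV a * (X 1%g + rel a.1 (a.1^-1)%g)); last first.
    by rewrite /rel mulgV [umV a * (_ - _)]mulrBr umVK; ncring.
  apply: (proj2 c); first by apply: (zclosedN c); apply: rr_mulr; apply: rr_mull.
  by apply: rr_mull; apply: (zclosedD c); [exact: rr_X1 | exact: rr_rel].
apply: (ggen_sub H) => _ [g ->]; rewrite /mkset um_xg subrr; exact: (proj1 c).
Qed.

Lemma lc_fst n x : lc Fs n x -> lower_central G n.+1 x.1.
Proof.
elim: n x => [|n IH] x //.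
have H : gclosed [set x : bigG | lower_central G n.+2 x.1].
  have [H1 HM HV] := gclosed_gen [set z | exists x y : G,
    [/\ lower_central G n.+1 x, [set: G] y & z = [~ x, y]%g]].
  by split=> [|a b|a]; [exact: H1 | exact: HM | exact: HV].
apply: (ggen_sub H) => _ [a [b [/IH fa _ ->]]].
by apply: ggen_in; exists a.1, b.1.
Qed.

Lemma lc_lift n g : lower_central G n.+1 g -> exists2 x, lc Fs n x & x.1 = g.
Proof.
elim: n g => [|n IH] g; first by exists (xg g) => //; exact: Fs_xg.
have [H1 HM HV] := lc_closed Fs_closed n.+1.
have H : gclosed [set g | exists2 x, lc Fs n.+1 x & x.1 = g].
  split=> [|_ _ [x Hx <-] [y Hy <-]|_ [x Hx <-]]; first by exists 1%g.
    by exists (x * y)%g => //; apply: (HM).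
  by exists (x^-1)%g => //; apply: (HV).
apply: (ggen_sub H) => _ [a [b [/IH[x Hx <-] _ ->]]].
by exists [~ x, xg b]%g => //; apply: lcR => //; exact: Fs_xg.
Qed.

(** A relator in [lc n] is known to give an element of [rr] of order n + 1. The last clause asks for
    n letters beside the relator, so that the leading term already vanishes over A. *)
Definition Rs n : set bigG :=
  [set x | [/\ lc Fs n x, x.1 = 1%g & rk n.+1 (um x - 1)]].

Let rc n := rk_closed G n.

Lemma Rs_closed n : gclosed (Rs n).
Proof.
have [H1 HM HV] := lc_closed Fs_closed n.
split=> [|x y [Hx x1 rx] [Hy y1 ry]|x [Hx x1 rx]].
- by split=> //; rewrite um1 subrr; case: (rc n.+1).
- split; [exact: HM | by rewrite fstM x1 y1 mulg1 |].
  rewrite umM sub1_mul; apply: (zclosedD (rc _)); first exact: zclosedD (rc _) rx ry.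
  apply: (rkW (l := n.+1 + n.+1)); first exact: leq_addr.
  by apply: rk_mull => //; apply: rk_fil.
- split; [exact: HV | by rewrite fstV x1 invg1 |].
  rewrite um_inv inv_sub1; apply: (zclosedN (rc _)).
  by rewrite -[n.+1]add0n; apply: rk_mull.
Qed.

Lemma rk_mul1 k (a b c : M) : rk k c -> rk k (a * b * c).
Proof. by move=> rc'; rewrite -[k]add0n; apply: rk_mull. Qed.

Lemma Rs_comm n x y : Rs n x -> Fs y -> Rs n.+1 [~ x, y]%g.
Proof.
move=> [Hx x1 rx] Fy; split; first exact: lcR.
  by rewrite -[LHS]/[~ x.1, y.1]%g x1 comm1g.
rewrite umR; apply: rk_mul1; have fy := Fs_fil1 Fy.
apply: (proj2 (rc _)); first by rewrite -(addn1 n.+1); apply: rk_mulr.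
by rewrite -(add1n n.+1); apply: rk_mull.
Qed.

Lemma comm_Rs n x y : lc Fs n x -> Rs 0 y -> Rs n.+1 [~ x, y]%g.
Proof.
move=> Hx [Hy y1 ry]; split; first exact: lcR.
  by rewrite -[LHS]/[~ x.1, y.1]%g y1 commg1.
rewrite umR; apply: rk_mul1; have fx := lc_fil Hx.
apply: (proj2 (rc _)); first by rewrite -(addn1 n.+1); apply: rk_mull.
by rewrite -(add1n n.+1); apply: rk_mulr.
Qed.

(** For n from 1 to 3, [ld_K1] and [detectA] identify this set as the kernel of the leading term
    over A on [lc n]. *)
Definition K1 n : set bigG :=
  [set x | lc Fs n x /\ exists2 r, Rs n r & lc Fs n.+1 (r^-1 * x)%g].

Lemma K1_closed n : gclosed (K1 n).
Proof.
have Fg := Fs_closed; have [H1 HM HV] := lc_closed Fg n.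
have [I1 IM IV] := lc_closed Fg n.+1; have [R1 RM RV] := Rs_closed n.
have FR r : Rs n r -> Fs r by case=> Hr _ _; apply: lc_F Hr.
split=> [|x y [Hx [r Rr h]] [Hy [s Rs' h']]|x [Hx [r Rr h]]].
- by split=> //; exists 1%g; rewrite // mulg1 invg1.
- split; first exact: HM.
  exists (r * s)%g; first exact: RM.
  have -> : ((r * s)^-1 * (x * y) = (r^-1 * x) ^ s * (s^-1 * y))%g.
    by rewrite invgM /conjg !mulgA mulgK.
  by apply: (IM) => //; apply: lcJ => //; apply: FR.
- split; first exact: HV.
  exists (r^-1)%g; first exact: RV.
  have -> : (r^-1^-1 * x^-1 = ((r^-1 * x)^-1) ^ (r^-1))%g.
    by rewrite /conjg invgM !invgK !mulgA mulgK.
  have [_ _ FV] := Fg; apply: lcJ => //; first exact: IV.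
  by apply: (FV); apply: FR.
Qed.

Lemma K1_lc n x : K1 n x -> lc Fs n x. Proof. by case. Qed.

Lemma lc_K1 n x : lc Fs n.+1 x -> K1 n x.
Proof.
move=> Hx; split; first exact: lc_decr Fs_closed _ _ Hx.
by exists 1%g; [case: (Rs_closed n) | rewrite invg1 mul1g].
Qed.

Lemma K1R n x y : K1 n x -> Fs y -> K1 n.+1 [~ x, y]%g.
Proof.
have Fg := Fs_closed.
move=> [Hx [r Rr h]] Fy; split; first exact: lcR.
have Rc := Rs_comm Rr Fy; exists [~ r, y]%g => //.
rewrite -{1}(mulVKg r x) commMgJ; set d := (r^-1 * x)%g in h *.
have Hd : Fs d by apply: lc_F h.
have [_ HM _] := lc_closed Fg n.+2; rewrite mulgA; apply: (HM); last exact: lcR.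
by rewrite conjg_mulR mulKg; apply: lcR => //; case: Rc.
Qed.

Lemma K1_comm n x y : lc Fs n x -> K1 0 y -> K1 n.+1 [~ x, y]%g.
Proof.
have Fg := Fs_closed.
move=> Hx [Hy [r Rr h]]; split; first exact: lcR.
have Rc := comm_Rs Hx Rr; exists [~ x, r]%g => //.
rewrite -{1}(mulVKg r y) commgMJ; set d := (r^-1 * y)%g in h *.
have Hd : Fs d by apply: lc_F h.
have [_ HM _] := lc_closed Fg n.+2.
have [Hc _ _] := Rc.
have -> : ([~ x, r]^-1 * ([~ x, d] * [~ x, r] ^ d) = [~ x, d] ^ [~ x, r] * [~ [~ x, r], d])%g.
  by rewrite (conjg_mulR _ d) [([~ x, d] ^ _)%g]/conjg !mulgA.
apply: (HM); last exact: lcR.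
apply: lcJ => //; last exact: lc_F Hc.
by have := lcRR Fg Hx h; rewrite addn1.
Qed.

End BigGroup.

(** * Leading terms *)

Section Leads.
Variable G : groupType.
Notation M := (trunc G 5).
Notation A := (abelianization G).
Notation Fs := (@Fs G).
Notation lc := (lc Fs).

Let fc n := fil_closed (K := G) (N := 5) n.

Definition lt (B : zmodType) (v : G -> B) : {additive FR G -> FR B} :=
  frlift (fun g => word [:: v g]).

Lemma ltM (B : zmodType) (v : G -> B) x y : lt v (x * y) = lt v x * lt v y.
Proof. exact: frliftM. Qed.

Lemma lt1 (B : zmodType) (v : G -> B) g : lt v (word [:: g]) = word [:: v g].
Proof. exact: frliftU. Qed.

Definition ld (B : zmodType) (v : G -> B) n (x : bigG G) : FR B :=
  lt v (cf n.+1 (um x - 1)).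

Lemma cf_umM n x y : lc n x -> lc n y ->
  cf n.+1 (um (x * y)%g - 1) = cf n.+1 (um x - 1) + cf n.+1 (um y - 1).
Proof.
move=> /lc_fil fx /lc_fil fy; rewrite umM sub1_mul !(raddfD (cf n.+1)).
rewrite (filM fx fy) ?addr0 //; lia.
Qed.

Lemma cf_com m n (a b : M) : (m + n < 5)%N -> fil m a -> fil n b ->
  cf (m + n)%N (com a b) = com (cf m a) (cf n b).
Proof.
move=> mn fa fb; rewrite /com (raddfB (cf (m + n)%N)) cfM_lead // addnC cfM_lead //.
by rewrite addnC.
Qed.

Lemma cf_umR n x y : (n < 3)%N -> lc n x -> Fs y ->
  cf n.+2 (um [~ x, y]%g - 1) = com (cf n.+1 (um x - 1)) (cf 1 (um y - 1)).
Proof.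
move=> n3 /lc_fil fx /Fs_fil1 fy; have := umR_lead fx fy; rewrite addn0 => h.
have := h n.+2 (ltnSn _); rewrite (raddfB (cf n.+2)) => /eqP; rewrite subr_eq0 => /eqP ->.
by rewrite -(cf_com _ fx fy) ?addn1.
Qed.

Section Hyps.
Variables (B : zmodType) (v : G -> B).

Lemma ld_M n x y : lc n x -> lc n y ->
  tens_id (ld v n (x * y)%g - (ld v n x + ld v n y)).
Proof.
move=> Hx Hy; rewrite /ld cf_umM // raddfD subrr.
exact: (proj1 (@tens_id_closed B)).
Qed.

Lemma ld_R n x y : (n < 3)%N -> lc n x -> Fs y ->
  tens_id (ld v n.+1 [~ x, y]%g - com (ld v n x) (ld v 0 y)).
Proof.
move=> n3 Hx Fy; rewrite /ld cf_umR // /com (raddfB (lt v)) !ltM subrr.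
exact: (proj1 (@tens_id_closed B)).
Qed.

End Hyps.

Lemma lt_rr (x : M) : rr x -> tens_id (lt (@cls G) (cf 1 x)).
Proof.
have tc := @tens_id_closed A; have H := zclosed_preim (lt (@cls G)) tc.
apply: (zgen_sub (zclosed_preim (cf 1) H)) => _ [a [b [g [h ->]]]].
have [n /rk_fil r2] := rr_aug a b (rr_rel g h).
have := r2 1 isT; rewrite (raddfB (cf 1)) (raddfMz (cf 1)) => /eqP.
rewrite subr_eq0 => /eqP ->; rewrite (raddfMz (lt (@cls G))); apply: (zclosedMz _ tc).
rewrite relE (raddfD (cf 1)) (raddfB (cf 1)) (raddfD (cf 1)).
rewrite (filM (fil1_X g) (fil1_X h)) // addr0 /X !cfE !dgW /=.
rewrite (raddfB (lt (@cls G))) (raddfD (lt (@cls G))) !lt1 clsM.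
rewrite -[X in tens_id X]opprK; apply: (zclosedN tc); apply: zgen_in.
exists [::], [::], (cls g), (cls h).
by rewrite word0 mul1r mulr1 /trel; zmod.
Qed.

Lemma lt_rk n (x : M) : rk n.+1 x -> tens_id (lt (@cls G) (cf n.+1 x)).
Proof.
have tc := @tens_id_closed A.
have H : zclosed (fun x : M => tens_id (lt (@cls G) (cf n.+1 x))) :=
  zclosed_preim (cf n.+1) (zclosed_preim (lt (@cls G)) tc).
move/rk_word; move: x; apply: (zgen_sub H) => _ [u [w [r [uw Rr ->]]]].
have [n5|/cf_ge ->] := ltnP n.+1 5; last by rewrite raddf0; exact: (proj1 tc).
have fr := rr_fil1 Rr.
have fu : fil (size u) (tr (word u) : M) by exact: fil_tr.
have fw : fil (size w) (tr (word w) : M) by exact: fil_tr.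
have fur := filM fu fr; have E : n.+1 = (size u + 1 + size w)%N by lia.
rewrite E cfM_lead // -?E // cfM_lead //; last lia.
by rewrite !ltM; apply: tens_id_mulr; apply: tens_id_mull; apply: lt_rr.
Qed.

Lemma ld_K1 n x : K1 n x -> tens_id (ld (@cls G) n x).
Proof.
have tc := @tens_id_closed A.
move=> [Hx [r [Hr r1 rkr] h]]; rewrite /ld.
have h' := lc_decr (@Fs_closed G) h.
rewrite -[x](mulVKg r) cf_umM // (lc_fil h) // addr0.
exact: lt_rk.
Qed.

Lemma lin_um x : Fs x -> lin (um x - 1) = cls x.1.
Proof.
move=> /Fs_rr /lin_rr; rewrite opprD addrA (raddfB lin) linX => /eqP.
by rewrite subr_eq0 => /eqP.
Qed.

(** This is degree 0, which [detectA] excludes: [x.1] lies in gamma_2 and lifts to [lc 1], and the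
    quotient of [x] by the lift is a relator. *)
Lemma cls0_K1 x : Fs x -> cls x.1 = 0 -> K1 0 x.
Proof.
move=> Fx /cls_eq0 /lc_lift[d Hd d1]; split=> //.
have [_ FM FV] := @Fs_closed G; have Fd := lc_F (@Fs_closed G) Hd.
exists (x * d^-1)%g; last by rewrite invgM invgK -mulgA mulVg mulg1.
have Fxd : Fs (x * d^-1)%g by apply: (FM) => //; apply: (FV).
have E : (x * d^-1)%g.1 = 1%g by rewrite fstM fstV d1 mulgV.
split=> //; apply: rr_rk; have := Fs_rr Fxd; rewrite E => h.
have := zclosedD (rr_closed G) h (rr_X1 G); congr rr; zmod.
Qed.

Definition VA (a : A) : bigG G := xg (sval (cid (cls_surj a))).

Lemma cls_VA a : cls (VA a).1 = a.
Proof. by rewrite /VA /=; case: cid. Qed.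

Lemma cls_fstM (x y : bigG G) : cls (x * y)%g.1 = cls x.1 + cls y.1.
Proof. by rewrite fstM clsM. Qed.

Lemma detectA n x : (0 < n <= 3)%N -> lc n x -> tens_id (ld (@cls G) n x) -> K1 n x.
Proof.
have [_ FM FV] := @Fs_closed G; have FVA a : Fs (VA a) by exact: Fs_xg.
apply: (lead_detect (@Fs_closed G) (@K1_closed G) (@K1_lc G) (@lc_K1 G) (@K1R G)
  (@K1_comm G) (V := VA) FVA).
- move=> a b; apply: cls0_K1; first by apply: (FM); [exact: FV | exact: FM].
  by rewrite !cls_fstM fstV clsV !cls_VA addNr.
- move=> y Fy; exists (cls y.1); apply: cls0_K1; first by apply: (FM) => //; apply: (FV).
  by rewrite cls_fstM fstV clsV cls_VA addNr.
- exact: ld_M.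
- exact: ld_R.
- exact: ld_K1.
- move=> a; rewrite /ld /VA um_xg [1 + _]addrC addrK /X cfE dgW /= lt1.
  case: cid => g /= <-; rewrite subrr; exact: (proj1 (@tens_id_closed A)).
Qed.

Notation P := {malg G}.

Definition basis (g : G) : P := << g >>.

Lemma word_sub_tens (B : zmodType) (a b : B) :
  tens_id (word [:: a - b] - (word [:: a] - word [:: b])).
Proof.
rewrite -[X in tens_id X]opprK; apply: (zclosedN (@tens_id_closed B)).
apply: zgen_in; exists [::], [::], (a - b), b.
by rewrite word0 mul1r mulr1 /trel subrK; zmod.
Qed.

Lemma word0_tens (B : zmodType) : tens_id (word [:: 0 : B]).
Proof. by have := word_sub_tens (0 : B) 0; rewrite subr0 subrr subr0. Qed.

Definition P_FR : {additive P -> FR G} := fab_lift (fun g => word [:: g]).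

Lemma P_FRU g : P_FR (basis g) = word [:: g]. Proof. exact: fab_liftU. Qed.

Definition FR_P : {additive FR G -> P} :=
  wlift (fun s => if s is [:: g] then basis g else 0).

Lemma P_FRK p : FR_P (P_FR p) = p.
Proof.
apply: (@fab_ext _ _ (FR_P \o P_FR) idfun) => g /=.
by rewrite P_FRU /FR_P wliftE.
Qed.

Lemma FR_PK x : homog 1 x -> P_FR (FR_P x) = x.
Proof.
elim=> [_ [s s1 ->]||y z _ Ey _ Ez].
- by case: s s1 => [|g [|]] // _; rewrite /FR_P wliftE P_FRU.
- by rewrite !raddf0.
- by rewrite (raddfB FR_P) (raddfB P_FR) Ey Ez.
Qed.

Lemma lt_P_FR (B : zmodType) (f : {additive P -> B}) p :
  tens_id (lt (f \o basis) (P_FR p) - word [:: f p]).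
Proof.
have tc := @tens_id_closed B; set g := f \o basis.
apply: (fab_ind (P := fun p => tens_id (lt g (P_FR p) - word [:: f p]))) => {p} [|p q hp hq|k].
- by rewrite !raddf0 sub0r; apply: (zclosedN tc); exact: word0_tens.
- have := zclosedD tc (proj2 tc _ _ hp hq) (zclosedN tc (word_sub_tens (f p) (f q))).
  by congr (tens_id _); rewrite (raddfB P_FR) (raddfB (lt g)) (raddfB f); zmod.
- by rewrite P_FRU lt1 subrr; case: tc.
Qed.

(** The class modulo [lc 1] and the linear part are both homomorphisms on [Fs]. Sending X_g to the
    class of [xg g] recovers the first from the second, since it does so on generators. *)
Lemma cf1_lc1 x : Fs x -> cf 1 (um x - 1) = 0 -> lc 1 x.
Proof.
have Fg := @Fs_closed G; move=> Fx c0.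
have [Q [c [cM c_eq]]] := subgroup_quotient Fg (lc_closed Fg 1)
  (fun x y Hx Hy => lcR (n := 0) Hx Hy).
apply/(c_eq x Fx).
pose k : {additive FR G -> Q} := wlift (fun s => if s is [:: g] then c (xg g) else 0).
have [F1 FM FV] := Fg.
have c1 : c 1%g = 0 by apply: (addIr (c 1%g)); rewrite -cM // mulg1 add0r.
have H : gclosed [set x | Fs x /\ c x = k (cf 1 (um x - 1))].
  split=> [|a b [Fa Ea] [Fb Eb]|a [Fa Ea]]; rewrite /mkset.
  - by split=> //; rewrite um1 subrr (raddf0 (cf 1)) (raddf0 k).
  - split; first exact: FM.
    by rewrite cM // Ea Eb -(raddfD k) -(cf_umM (n := 0)).
  - have FVa := FV _ Fa; split => //; apply: (addIr (c a)).
    rewrite -cM // mulVg c1 Ea -(raddfD k) -(cf_umM (n := 0)) //.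
    by rewrite mulVg um1 subrr (raddf0 (cf 1)) (raddf0 k).
suff [_ ->] : Fs x /\ c x = k (cf 1 (um x - 1)) by rewrite c0 raddf0.
move: x Fx {c0}; apply: (ggen_sub H) => _ [g ->]; split; first exact: Fs_xg.
by rewrite um_xg [1 + _]addrC addrK /X cfE dgW /= /k wliftE.
Qed.

Lemma Fs_P p : exists2 x, Fs x & cf 1 (um x - 1) = P_FR p.
Proof.
have [F1 FM FV] := @Fs_closed G.
apply: (fab_ind (P := fun p => exists2 x, Fs x & cf 1 (um x - 1) = P_FR p)) => {p} [|p q|g].
- by exists 1%g => //; rewrite um1 subrr !raddf0.
- move=> [x Fx Ex] [y Fy Ey]; have FVy := FV _ Fy.
  exists (x * y^-1)%g; first exact: FM.
  rewrite (cf_umM (n := 0)) // Ex (raddfB P_FR) -Ey; congr (_ + _).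
  apply: (addIr (cf 1 (um y - 1))); rewrite -(cf_umM (n := 0)) // mulVg addNr.
  by rewrite um1 subrr raddf0.
- exists (xg g); first exact: Fs_xg.
  by rewrite um_xg [1 + _]addrC addrK /X cfE dgW /= P_FRU.
Qed.

Definition VP (p : P) : bigG G := s2val (cid2 (Fs_P p)).

Lemma Fs_VP p : Fs (VP p). Proof. exact: s2valP. Qed.

Lemma cf1_VP p : cf 1 (um (VP p) - 1) = P_FR p.
Proof. exact: (s2valP' (cid2 (Fs_P p))). Qed.

Lemma cf1_V x : Fs x -> cf 1 (um (x^-1)%g - 1) = - cf 1 (um x - 1).
Proof.
have [F1 FM FV] := @Fs_closed G; move=> Fx; apply: (addIr (cf 1 (um x - 1))).
by rewrite -(cf_umM (n := 0)) ?mulVg ?um1 ?subrr ?raddf0 ?addNr //; apply: (FV).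
Qed.

(** Over the free abelian group on G no relations are divided out, so [lead_detect] with [K n] equal
    to [lc n.+1] compares degree and lower central series inside [Fs] itself. *)
Lemma detectP n x : (0 < n <= 3)%N -> lc n x -> fil n.+2 (um x - 1) -> lc n.+1 x.
Proof.
have Fg := @Fs_closed G; have [_ FM FV] := Fg; have lcc := lc_closed Fg.
move=> n3 Hx fx; move: n3 Hx.
have : tens_id (ld basis n x).
  by rewrite /ld fx // raddf0; case: (@tens_id_closed P).
move=> + n3 Hx; move: n3 Hx.
apply: (lead_detect Fg (K := fun n => lc n.+1) _ _ _ _ _ (V := VP) Fs_VP).
- by move=> k; exact: lcc.
- by move=> k y; exact: lc_decr.
- by [].
- by move=> k y z Hy Fz; exact: lcR.
- by move=> k y z Hy Hz; have := lcRR Fg Hy Hz; rewrite addn1.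
- move=> a b; have Fab := FM _ _ (Fs_VP a) (Fs_VP b); have FVab := FV _ (Fs_VP (a + b)).
  apply: cf1_lc1; first exact: FM.
  rewrite (cf_umM (n := 0)) // (cf_umM (n := 0)) ?cf1_V ?cf1_VP ?(raddfD P_FR) ?addNr //;
  exact: Fs_VP.
- move=> y Fy; exists (FR_P (cf 1 (um y - 1))); have FVy := FV _ Fy.
  apply: cf1_lc1; first by apply: (FM) => //; exact: Fs_VP.
  rewrite (cf_umM (n := 0)) ?cf1_V ?cf1_VP ?FR_PK ?addNr //;
  by [exact: homog_cf | exact: Fs_VP].
- exact: ld_M.
- exact: ld_R.
- move=> k y /lc_fil fy; rewrite /ld fy // raddf0; exact: (proj1 (@tens_id_closed P)).
- by move=> p; rewrite /ld cf1_VP; exact: (lt_P_FR idfun).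
Qed.

End Leads.
Arguments P_FR {G}.
Arguments FR_P {G}.

(** * Relators modulo higher relators *)

Section Relators.
Variable G : groupType.
Notation M := (trunc G 5).
Notation A := (abelianization G).
Notation Fs := (@Fs G).
Notation lc := (lc Fs).
Notation P := {malg G}.

Let fc n := fil_closed (K := G) (N := 5) n.
Let rc n := rk_closed G n.
Let Fg := @Fs_closed G.

Definition near_relator n (s : M) := exists r, [/\ lc n r, r.1 = 1%g & rk n.+1 (s - (um r - 1))].

Lemma um_rr x : Fs x -> x.1 = 1%g -> rr (um x - 1).
Proof.
move=> Fx x1; have := zclosedD (rr_closed G) (Fs_rr Fx) (rr_X1 G); rewrite x1.
by congr rr; zmod.
Qed.

(** Multiplication of relators is addition modulo [rk n.+1]: the cross term is an element of [rr]
    times one of order at least n. *)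
Lemma near_relator_closed n : zclosed (near_relator n).
Proof.
have [H1 HM HV] := lc_closed Fg n.
split=> [|s t [r [Hr r1 rs]] [q [Hq q1 qs]]].
  by exists 1%g; split=> //; rewrite um1 subrr subr0; case: (rc n.+1).
have Hqv := HV _ Hq; have q1v : (q^-1)%g.1 = 1%g by rewrite fstV q1 invg1.
exists (r * q^-1)%g; split; [exact: HM | by rewrite fstM r1 q1v mulg1 |].
have Rr := um_rr (lc_F Fg Hr) r1; have Rqv := um_rr (lc_F Fg Hqv) q1v.
have E : um (q^-1)%g - 1 = - (um q - 1) - (um (q^-1)%g - 1) * (um q - 1).
  have := umVK q; rewrite -um_inv => E; rewrite mulrBl mulrBr E; ncring.
rewrite umM sub1_mul (_ : _ - _ = (s - (um r - 1)) - (t - (um q - 1))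
  + (um (q^-1)%g - 1) * (um q - 1) - (um r - 1) * (um (q^-1)%g - 1)); last first.
  by rewrite {1}E; zmod.
apply: (proj2 (rc _)); last by apply: rk_mulrr => //; exact: filW (leqnSn n) (lc_fil Hr).
apply: (zclosedD (rc _)); first exact: (proj2 (rc _)).
by apply: rk_rrmul => //; exact: filW (leqnSn n) (lc_fil Hq).
Qed.

Definition pA : {additive P -> A} := fab_lift (@cls G).

Lemma pAU g : pA << g >> = cls g. Proof. exact: fab_liftU. Qed.

Lemma lin_pA (x : M) : lin x = pA (FR_P (cf 1 x)).
Proof.
have H : zclosed (fun x : M => lin x = pA (FR_P (cf 1 x))).
  split=> [|y z Ey Ez]; first by rewrite !raddf0.
  by rewrite (raddfB lin) (raddfB (cf 1)) (raddfB FR_P) (raddfB pA) Ey Ez.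
apply: (trunc_ind H) => s; rewrite linW cfE dgW /=.
case: s => [|g [|h s]] /=; rewrite ?raddf0 // /FR_P wliftE.
by rewrite pAU.
Qed.

Lemma pA_rr (x : M) : rr x -> pA (FR_P (cf 1 x)) = 0.
Proof. by move=> Rx; rewrite -lin_pA lin_rr. Qed.

(** A lift with the right linear part has the right component up to gamma_2; a factor from [lc 1]
    corrects the component without touching the linear part. *)
Lemma Fs_lift p g : pA p = cls g -> exists2 x, Fs x & x.1 = g /\ cf 1 (um x - 1) = P_FR p.
Proof.
move=> pg; have [_ FM FV] := Fg; have FVp := Fs_VP p.
have : cls ((VP p).1^-1 * g)%g = 0.
  by rewrite clsM clsV -(lin_um (Fs_VP p)) lin_pA cf1_VP P_FRK pg addNr.
move=> /cls_eq0 /lc_lift[d Hd d1]; have Fd := lc_F Fg Hd.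
exists (VP p * d)%g; first exact: FM.
rewrite fstM d1 mulVKg; split=> //.
by rewrite (cf_umM (n := 0)) // (lc_fil Hd) // addr0 cf1_VP.
Qed.

Lemma relator_lift p : pA p = 0 -> exists2 r, Fs r & r.1 = 1%g /\ cf 1 (um r - 1) = P_FR p.
Proof. by rewrite -(cls1 G); exact: Fs_lift. Qed.

Hypothesis H2 : zmod_trivial (group_homology G 2).

Lemma rr_cf1 (x : M) : rr x -> cf 1 x = 0 -> rk 2 x.
Proof. by move=> Rx c0; apply: rr_fil2 => //; apply: filS => //; exact: rr_fil1. Qed.

Lemma rk_cf1 (x y : M) : rr x -> rr y -> cf 1 x = cf 1 y -> rk 2 (x - y).
Proof.
move=> Rx Ry E; apply: rr_cf1; first exact: (proj2 (rr_closed G) _ _ Rx Ry).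
by rewrite (raddfB (cf 1)) E subrr.
Qed.

(* [op] stands for the multiplication by a letter on either side. *)
Section OneSided.
Variables (op : G -> {additive M -> M}) (op0 : G -> {additive FR G -> FR G})
  (d : G -> {additive FR G -> FR G}).
Hypotheses (op_cf : forall g x, fil 1 x -> cf 2 (op g x) = op0 g (cf 1 x))
  (op_rk : forall g x, rk 2 x -> rk 3 (op g x))
  (dE : forall g h x, homog 1 x -> d h (op0 g x) = if g == h then x else 0).

Definition side (x : M) := zgenerated (fun z => exists g rho, rr rho /\ z = op g rho) x.

(** Terms with the same letter are collected, so that the leading terms of distinct summands are
    independent. *)
Lemma side_grouped x : side x -> exists (S : seq G) (a : G -> M),
  [/\ uniq S, forall g, rr (a g) & x = \sum_(g <- S) op g (a g)].
Proof.
have [r0 rB] := rr_closed G.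
elim=> [_ [g [r [Rr ->]]]||y z _ [S [a [US Ra ->]]] _ [S' [b [US' Rb ->]]]].
- by exists [:: g], (fun=> r); split=> //; rewrite big_seq1.
- by exists [::], (fun=> 0); split=> //; rewrite big_nil.
pose ext (S : seq G) (a : G -> M) g := if g \in S then a g else 0.
have extE (T S1 : seq G) c : uniq T -> uniq S1 -> {subset S1 <= T} ->
    \sum_(g <- S1) op g (c g) = \sum_(g <- T) op g (ext S1 c g).
  move=> UT US1 sub; rewrite [RHS](bigID (mem S1)) /= [X in _ + X]big1 ?addr0; last first.
    by move=> g gS; rewrite /ext (negbTE gS) raddf0.
  rewrite -[RHS]big_filter; rewrite [RHS](perm_big S1).
    by rewrite [LHS]big_seq [RHS]big_seq; apply: eq_bigr => g gS; rewrite /ext gS.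
  apply: uniq_perm => // [|g]; first exact: filter_uniq.
  by rewrite mem_filter /= andb_idr //; apply: sub.
exists (undup (S ++ S')), (fun g => ext S a g - ext S' b g); split.
- exact: undup_uniq.
- by move=> g; apply: rB; rewrite /ext; case: ifP.
rewrite (extE (undup (S ++ S')) S) ?(extE (undup (S ++ S')) S') ?undup_uniq //.
- by rewrite -sumrB; apply: eq_bigr => g _; rewrite raddfB.
- by move=> g gS; rewrite mem_undup mem_cat gS orbT.
- by move=> g gS; rewrite mem_undup mem_cat gS.
Qed.

(** The coefficient of the letter [h] in the leading term is the linear part of [a h]; its vanishing
    puts [a h] into [rk 2] by H_2(G) = 0. *)
Lemma side_cf0 x : side x -> cf 2 x = 0 -> rk 3 x.
Proof.
move=> /side_grouped[S [a [US Ra ->]]] c0; rewrite big_seq.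
apply: zclosed_sum => [|h hS]; first exact: rc.
apply: op_rk; apply: rr_cf1 => //.
have := congr1 (d h) c0; rewrite raddf0 raddf_sum raddf_sum (bigD1_seq h) //=.
rewrite op_cf ?dE ?eqxx //; [|exact: homog_cf|exact: rr_fil1].
rewrite big1 ?addr0 // => g gh; rewrite op_cf ?dE ?(negbTE gh) //; first exact: homog_cf.
exact: rr_fil1.
Qed.

End OneSided.

(** The names tell on which side the relator stands: [mul_right (X g)] puts the letter on the
    right. *)
Definition sideL := side (fun g => mul_right (X g)).
Definition sideR := side (fun g => mul_left (X g)).

Lemma cf1_X g : cf 1 (X g : M) = word [:: g].
Proof. by rewrite /X cfE dgW. Qed.

Lemma sideL_cf0 x : sideL x -> cf 2 x = 0 -> rk 3 x.
Proof.
pose d (g : G) : {additive FR G -> FR G} :=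
  wlift (fun s => if s is [:: a; b] then if b == g then word [:: a] else 0 else 0).
apply: (side_cf0 (op0 := fun g => mul_right (word [:: g])) (d := d)) => [g y fy|g y ry|g h y].
- by rewrite (@cfM_lead G 5 1 1) // ?cf1_X //; exact: fil1_X.
- exact: (@rk_mulr G 2 1 _ _ (fil1_X g)).
elim=> [_ [s s1 ->]||y1 y2 _ E1 _ E2].
- case: s s1 => [|a [|]] // _.
  change (d h (word [:: a] * word [:: g]) = if g == h then word [:: a] else 0).
  by rewrite wordM /d wliftE.
- by rewrite !raddf0 if_same.
- rewrite (raddfB (mul_right (word [:: g]))) (raddfB (d h)) E1 E2.
  by case: eqP => // _; rewrite subrr.
Qed.

Lemma sideR_cf0 x : sideR x -> cf 2 x = 0 -> rk 3 x.
Proof.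
pose d (g : G) : {additive FR G -> FR G} :=
  wlift (fun s => if s is [:: a; b] then if a == g then word [:: b] else 0 else 0).
apply: (side_cf0 (op0 := fun g => mul_left (word [:: g])) (d := d)) => [g y fy|g y ry|g h y].
- by rewrite (@cfM_lead G 5 1 1) // ?cf1_X //; exact: fil1_X.
- exact: (@rk_mull G 2 1 _ _ (fil1_X g)).
elim=> [_ [s s1 ->]||y1 y2 _ E1 _ E2].
- case: s s1 => [|a [|]] // _.
  change (d h (word [:: g] * word [:: a]) = if g == h then word [:: a] else 0).
  by rewrite wordM /d wliftE.
- by rewrite !raddf0 if_same.
- rewrite (raddfB (mul_left (word [:: g]))) (raddfB (d h)) E1 E2.
  by case: eqP => // _; rewrite subrr.
Qed.

Lemma sideL_mul r y : rr r -> fil 1 y -> sideL (r * y).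
Proof.
move=> Rr /fil_word; have Sc : zclosed sideL := zclosed_gen _.
have H := zgen_sub (zclosed_mull r Sc); apply: H => _ [s s1 ->].
case/lastP: s s1 => [//|s g] _; apply: zgen_in; exists g, (r * tr (word s)).
split; first exact: rr_mulr.
by rewrite -cats1 -wordM trM mulrA.
Qed.

Lemma sideR_mul r y : rr r -> fil 1 y -> sideR (y * r).
Proof.
move=> Rr /fil_word; have Sc : zclosed sideR := zclosed_gen _.
have H := zgen_sub (zclosed_mulr r Sc); apply: H => _ [s s1 ->].
case: s s1 => [//|g s] _; apply: zgen_in; exists g, (tr (word s) * r).
split; first exact: rr_mull.
by rewrite -cat1s -wordM trM -mulrA.
Qed.

Lemma rk2_sides s : rk 2 s -> exists a b, [/\ sideL a, sideR b & s = a - b].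
Proof.
move=> /rk_word; have Lc : zclosed sideL := zclosed_gen _.
have Rc : zclosed sideR := zclosed_gen _.
elim=> [_ [u [v [r [uv Rr ->]]]]||y z _ [a [b [La Rb ->]]] _ [a' [b' [La' Rb' ->]]]].
- have [u0|u1] := posnP (size u).
    exists (tr (word u) * r * tr (word v)), 0; rewrite subr0; split=> //; last by case: Rc.
    by apply: sideL_mul; [exact: rr_mull | apply: fil_tr; lia].
  exists 0, (- (tr (word u) * r * tr (word v))); rewrite sub0r opprK; split=> //.
    by case: Lc.
  apply: (zclosedN Rc); rewrite -mulrA; apply: sideR_mul; last exact: fil_tr.
  exact: rr_mulr.
- by exists 0, 0; rewrite subrr; split=> //; [case: Lc | case: Rc].
- exists (a - a'), (b - b'); split; [exact: (proj2 Lc) | exact: (proj2 Rc) | zmod].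
Qed.

(** The quadratic forms that come from relators or from the symbols [tau m x x]. *)
Definition BB (z : FR G) := exists p q, [/\ pA p = 0, pA q = 0 & z = P_FR p * P_FR q].
Definition DD (z : FR G) := exists (m : nat) x, pA (x *+ m) = 0 /\ z = (P_FR x * P_FR x) *+ m.
Definition WW := zgenerated (fun z => BB z \/ DD z).

(** For two relators, their product serves as both lifts. For m (x (x) x), with r a relator of
    linear part m x and v a lift of x, the lifts are (r - 1)(v - 1) and (v - 1)(r - 1). Their
    difference is the main part of [r, v] - 1, and this commutator lies in [lc 2] by [detectP],
    since its degree 2 terms cancel. *)
Lemma WW_lift al : WW al -> exists a b,
  [/\ sideL a, sideR b, cf 2 a = al, cf 2 b = al & near_relator 2 (a - b)].
Proof.
have Lc : zclosed sideL := zclosed_gen _; have Rc : zclosed sideR := zclosed_gen _.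
have Cc := near_relator_closed 2.
elim=> [z||y z _ [a [b [La Rb Ea Eb Cab]]] _ [a' [b' [La' Rb' Ea' Eb' Cab']]]]; last 2 first.
- by exists 0, 0; rewrite subrr raddf0; split=> //; [case: Lc | case: Rc | case: Cc].
- exists (a - a'), (b - b'); rewrite !(raddfB (cf 2)) Ea Ea' Eb Eb'; split=> //.
  + exact: (proj2 Lc). + exact: (proj2 Rc).
  + by have := proj2 Cc _ _ Cab Cab'; congr (near_relator 2 _); zmod.
case=> [[p [q [p0 q0 ->]]]|[m [x [x0 ->]]]].
  have [r Fr [r1 Er]] := relator_lift p0; have [t Ft [t1 Et]] := relator_lift q0.
  have Rr := um_rr Fr r1; have Rt := um_rr Ft t1.
  have fr := rr_fil1 Rr; have ft := rr_fil1 Rt.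
  exists ((um r - 1) * (um t - 1)), ((um r - 1) * (um t - 1)); rewrite subrr.
  have E : cf 2 ((um r - 1) * (um t - 1)) = P_FR p * P_FR q.
    by rewrite (@cfM_lead G 5 1 1) // Er Et.
  by split=> //; [exact: sideL_mul | exact: sideR_mul | case: Cc].
have [r Fr [r1 Er]] := relator_lift x0; have Rr := um_rr Fr r1; have fr := rr_fil1 Rr.
have Fx := Fs_VP x; have fx := Fs_fil1 Fx.
exists ((um r - 1) * (um (VP x) - 1)), ((um (VP x) - 1) * (um r - 1)).
have E1 : cf 2 ((um r - 1) * (um (VP x) - 1)) = (P_FR x * P_FR x) *+ m.
  by rewrite (@cfM_lead G 5 1 1) // Er cf1_VP raddfMn /= mulrnAl.
have E2 : cf 2 ((um (VP x) - 1) * (um r - 1)) = (P_FR x * P_FR x) *+ m.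
  by rewrite (@cfM_lead G 5 1 1) // Er cf1_VP raddfMn /= mulrnAr.
split=> //; [exact: sideL_mul | exact: sideR_mul |].
have Hc : lc 1 [~ r, VP x]%g by apply: (lcR (n := 0)).
exists [~ r, VP x]%g; split.
- apply: detectP => //; apply: filS; first exact: lc_fil.
  by rewrite (cf_umR (n := 0)) // Er cf1_VP /com raddfMn /= mulrnAl mulrnAr subrr.
- by rewrite -[LHS]/[~ r.1, (VP x).1]%g r1 comm1g.
rewrite umR; set w := com (um r - 1) _; change (rk 3 (w - umV r * umV (VP x) * w)).
have Rw : rk 2 w by apply: (proj2 (rc 2)); [apply: rk_rrmul | apply: rk_mulrr].
rewrite (_ : _ - _ = - ((umV r * umV (VP x) - 1) * w)); last by move: w {Rw} => w; ncring.
apply: (zclosedN (rc 3)); apply: (@rk_mull G 2 1) => //.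
have fV y : fil 1 (um y - 1) -> fil 1 (umV y - 1) by exact: filV.
rewrite sub1_mul; apply: (zclosedD (fc 1)).
  by apply: (zclosedD (fc 1)); apply: fV.
by apply: (filW (n := 1 + 1)) => //; apply: filM; apply: fV.
Qed.

(** An element of order 3 has the same degree 2 tensor on its two sides. If that tensor is in [WW],
    the lifts of [WW_lift] agree with the given sides modulo [rk 3]. *)
Lemma rk2_fil3 s : (forall al a b, sideL a -> sideR b -> cf 2 a = al -> cf 2 b = al -> WW al) ->
  rk 2 s -> fil 3 s -> near_relator 2 s.
Proof.
move=> key /rk2_sides[a [b [La Rb ->]]] f3.
have Lc : zclosed sideL := zclosed_gen _; have Rc : zclosed sideR := zclosed_gen _.
have E : cf 2 a = cf 2 b.
  by apply/eqP; rewrite -subr_eq0 -(raddfB (cf 2)) f3.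
have [a' [b' [La' Rb' Ea Eb C]]] := WW_lift (key _ a b La Rb E erefl).
have ra : rk 3 (a - a').
  by apply: sideL_cf0; [exact: (proj2 Lc) | rewrite (raddfB (cf 2)) E Ea subrr].
have FR_of_malg : rk 3 (b - b').
  by apply: sideR_cf0; [exact: (proj2 Rc) | rewrite (raddfB (cf 2)) Eb subrr].
have [r [Hr r1 rs]] := C; exists r; split=> //.
have := zclosedD (rc 3) rs (proj2 (rc 3) _ _ ra FR_of_malg); congr (rk 3 _); zmod.
Qed.

End Relators.

(** * Torsion products *)

Section TorsionForms.
Variable G : groupType.
Notation M := (trunc G 5).
Notation A := (abelianization G).
Notation P := {malg G}.
Notation pA := (@pA G).

Hypothesis ext_tor0 : zmod_trivial (ext_tor A).

Let pA_surj (a : A) : exists p, pA p = a.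
Proof. by have [g ->] := cls_surj a; exists << g >>; rewrite pAU. Qed.

Let sec (a : A) : P := sval (cid (pA_surj a)).
Let secK a : pA (sec a) = a. Proof. by rewrite /sec; case: cid. Qed.

Let tens (x y : P) : FR G := P_FR x * P_FR y.

Let tensBl x x' y : tens (x - x') y = tens x y - tens x' y.
Proof. by rewrite /tens (raddfB P_FR) mulrBl. Qed.
Let tensDl x x' y : tens (x + x') y = tens x y + tens x' y.
Proof. by rewrite /tens (raddfD P_FR) mulrDl. Qed.
Let tensDr x y y' : tens x (y + y') = tens x y + tens x y'.
Proof. by rewrite /tens (raddfD P_FR) mulrDr. Qed.
Let tensBr x y y' : tens x (y - y') = tens x y - tens x y'.
Proof. by rewrite /tens (raddfB P_FR) mulrBr. Qed.
Let tensMl x y m : tens (x *+ m) y = tens x y *+ m.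
Proof. by rewrite /tens raddfMn /= mulrnAl. Qed.
Let tensMr x y m : tens x (y *+ m) = tens x y *+ m.
Proof. by rewrite /tens raddfMn /= mulrnAr. Qed.

Notation Y := (zquot (@BB G)).
Let cl : FR G -> Y := zproj (@BB G).

Let BBl x x' y m : pA x = pA x' -> pA (y *+ m) = 0 -> cl (tens x y *+ m) = cl (tens x' y *+ m).
Proof.
move=> xx ym; apply/eqP; rewrite -subr_eq0 -(raddfB (zproj (@BB G))); apply/eqP/zproj_eq0.
rewrite -mulrnBl -tensBl -tensMr; apply: zgen_in; exists (x - x'), (y *+ m).
by split=> //; rewrite raddfB xx subrr.
Qed.

Let BBr x y y' m : pA y = pA y' -> pA (x *+ m) = 0 -> cl (tens x y *+ m) = cl (tens x y' *+ m).
Proof.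
move=> yy xm; apply/eqP; rewrite -subr_eq0 -(raddfB (zproj (@BB G))); apply/eqP/zproj_eq0.
rewrite -mulrnBl -tensBr -tensMl; apply: zgen_in; exists (x *+ m), (y - y').
by split=> //; rewrite raddfB yy subrr.
Qed.

(** With B the kernel of [pA], this will be the map from Tor(A, A) to P (x) P modulo B (x) B that
    sends tau_m(x, y) to m (x (x) y) for lifts of x and y. Replacing a lift changes the value by B
    (x) B, as m kills both classes. *)
Let tau_form : {additive {malg (tor_symbol A)} -> Y} :=
  fab_lift (fun s : tor_symbol A =>
    cl (tens (sec (val s).1.2) (sec (val s).2) *+ (val s).1.1)).

Let tau_formE m x y (h : tor_ok m x y) :
  tau_form (tor_sym h) = cl (tens (sec x) (sec y) *+ m).
Proof. exact: fab_liftU. Qed.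

Let sec0 m x : x *+ m = 0 -> pA (sec x *+ m) = 0.
Proof. by move=> xm; rewrite raddfMn /= secK. Qed.

Let tau_form_rel r : tor_rel r -> tau_form r = 0.
Proof.
have okP m (x y : A) : tor_ok m x y -> x *+ m = 0 /\ y *+ m = 0.
  by case/and3P=> _ /eqP -> /eqP ->.
have clD a b : cl (a + b) = cl a + cl b by exact: (raddfD (zproj (@BB G))).
have tau2 u v a b : tau_form u = a -> tau_form v = b -> tau_form (u - v) = a - b.
  by move=> <- <-; exact: raddfB.
have tau3 u v w a b c : tau_form u = a -> tau_form v = b -> tau_form w = c ->
    tau_form (u - v - w) = a - b - c.
  by move=> Eu Ev; exact: (tau2 _ _ _ _ (tau2 _ _ _ _ Eu Ev)).
case=> [m x1 x2 y h h1 h2|m x y1 y2 h h1 h2|m n x y h h'|m n x y h h'].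
- have [_ ym] := okP _ _ _ h.
  rewrite (tau3 _ _ _ _ _ _ (tau_formE h) (tau_formE h1) (tau_formE h2)).
  have E : pA (sec (x1 + x2)) = pA (sec x1 + sec x2) by rewrite (raddfD pA) !secK.
  rewrite (BBl E (sec0 ym)).
  by rewrite tensDl mulrnDl clD; zmod.
- have [xm _] := okP _ _ _ h.
  rewrite (tau3 _ _ _ _ _ _ (tau_formE h) (tau_formE h1) (tau_formE h2)).
  have E : pA (sec (y1 + y2)) = pA (sec y1 + sec y2) by rewrite (raddfD pA) !secK.
  rewrite (BBr E (sec0 xm)).
  by rewrite tensDr mulrnDl clD; zmod.
- have [_ ym] := okP _ _ _ h'; rewrite (tau2 _ _ _ _ (tau_formE h) (tau_formE h')).
  have E : pA (sec (x *+ n)) = pA (sec x *+ n) by rewrite (raddfMn pA) !secK.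
  rewrite (BBl E (sec0 ym)).
  by rewrite tensMl -mulrnA mulnC subrr.
- have [xm _] := okP _ _ _ h'; rewrite (tau2 _ _ _ _ (tau_formE h) (tau_formE h')).
  have E : pA (sec (y *+ n)) = pA (sec y *+ n) by rewrite (raddfMn pA) !secK.
  rewrite (BBr E (sec0 xm)).
  by rewrite tensMr -mulrnA mulnC subrr.
Qed.

(** The vanishing exterior torsion product puts tau_m(x, y) into the span of the symbols tau_k(z,
    z), whose values are the forms [DD]; the indeterminacy of the map is [BB]. *)
Lemma tor_WW m x y : pA (x *+ m) = 0 -> pA (y *+ m) = 0 ->
  WW ((P_FR x * P_FR y) *+ m).
Proof.
have [->|m0] := posnP m; first by rewrite mulr0n => _ _; exact: zgen_0.
move=> xm ym; have ok : tor_ok m (pA x) (pA y).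
  by rewrite /tor_ok m0 -!raddfMn /= xm ym eqxx.
pose f : {additive Tor A -> Y} := zlift tau_form_rel.
have fE k u v (h : tor_ok k u v) : f (tau h) = cl (tens (sec u) (sec v) *+ k).
  by rewrite -tau_formE; exact: zliftE.
pose S (t : Tor A) := exists2 w, WW w & f t = cl w.
have clB a b : cl (a - b) = cl a - cl b by exact: (raddfB (zproj (@BB G))).
have Sc : zclosed S.
  split=> [|s t [w Ww Ew] [w' Ww' Ew']]; first by exists 0;
    [exact: zgen_0 | rewrite (raddf0 f) /cl (raddf0 (zproj (@BB G)))].
  by exists (w - w'); [exact: zgen_B | rewrite (raddfB f) Ew Ew' clB].
have [w Ww Ew] : S (tau ok).
  have /zproj_eq0 := ext_tor0 (zproj _ (tau ok)); apply: (zgen_sub Sc).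
  move=> _ [k [z [h ->]]]; exists (tens (sec z) (sec z) *+ k).
    apply: zgen_in; right; exists k, (sec z); split=> //; apply: sec0.
    by case/and3P: h => _ /eqP.
  exact: fE.
have : cl (tens x y *+ m - w) = 0.
  rewrite clB -Ew fE.
  rewrite (@BBl x (sec (pA x))) ?secK // (@BBr _ y (sec (pA y))) ?subrr ?secK //.
  by rewrite sec0 // -raddfMn.
move=> /zproj_eq0 bb; rewrite -[_ *+ m](subrK w); apply: zclosedD => //.
  exact: zclosed_gen.
by apply: zgen_mono bb => z; left.
Qed.

Lemma sideL_data (a : M) : sideL a -> exists (S : seq G) (bs : seq P),
  (forall b, b \in bs -> pA b = 0) /\
  zgenerated (fun z => exists b g, [/\ b \in bs, g \in S & z = tens b << g >>]) (cf 2 a).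
Proof.
elim=> [_ [g [r [Rr ->]]]||y z _ [S [bs [bs0 h]]] _ [S' [bs' [bs0' h']]]].
- exists [:: g], [:: FR_P (cf 1 r)]; split=> [b|]; first by rewrite inE => /eqP ->; exact: pA_rr.
  apply: zgen_in; exists (FR_P (cf 1 r)), g; rewrite !inE !eqxx; split=> //.
  change (cf 2 (r * X g) = tens (FR_P (cf 1 r)) << g >>).
  rewrite (@cfM_lead G 5 1 1) ?cf1_X //; [|exact: rr_fil1|exact: fil1_X].
  by rewrite /tens FR_PK ?P_FRU //; exact: homog_cf.
- by exists [::], [::]; rewrite raddf0; split=> //; exact: zgen_0.
exists (S ++ S'), (bs ++ bs'); split=> [b|].
  by rewrite mem_cat => /orP[/bs0|/bs0'].
rewrite (raddfB (cf 2)); apply: zgen_B.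
  by apply: zgen_mono h => w [b [g [bb gS ->]]]; exists b, g; rewrite !mem_cat bb gS.
by apply: zgen_mono h' => w [b [g [bb gS ->]]]; exists b, g; rewrite !mem_cat bb gS !orbT.
Qed.

Lemma sideR_data (a : M) : sideR a -> exists (S : seq G) (bs : seq P),
  (forall b, b \in bs -> pA b = 0) /\
  zgenerated (fun z => exists b g, [/\ b \in bs, g \in S & z = tens << g >> b]) (cf 2 a).
Proof.
elim=> [_ [g [r [Rr ->]]]||y z _ [S [bs [bs0 h]]] _ [S' [bs' [bs0' h']]]].
- exists [:: g], [:: FR_P (cf 1 r)]; split=> [b|]; first by rewrite inE => /eqP ->; exact: pA_rr.
  apply: zgen_in; exists (FR_P (cf 1 r)), g; rewrite !inE !eqxx; split=> //.
  change (cf 2 (X g * r) = tens << g >> (FR_P (cf 1 r))).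
  rewrite (@cfM_lead G 5 1 1) ?cf1_X //; [|exact: fil1_X|exact: rr_fil1].
  by rewrite /tens FR_PK ?P_FRU //; exact: homog_cf.
- by exists [::], [::]; rewrite raddf0; split=> //; exact: zgen_0.
exists (S ++ S'), (bs ++ bs'); split=> [b|].
  by rewrite mem_cat => /orP[/bs0|/bs0'].
rewrite (raddfB (cf 2)); apply: zgen_B.
  by apply: zgen_mono h => w [b [g [bb gS ->]]]; exists b, g; rewrite !mem_cat bb gS.
by apply: zgen_mono h' => w [b [g [bb gS ->]]]; exists b, g; rewrite !mem_cat bb gS !orbT.
Qed.

(* The meet of B (x) P and P (x) B is spanned by B (x) B and the torsion symbols: in a Smith
   basis f_i of P, with m_i f_i in B, the coefficient of f_i (x) f_j is a multiple of
   lcm(m_i, m_j). *)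
Lemma sides_WW (al : FR G) (a b : M) : sideL a -> sideR b -> cf 2 a = al -> cf 2 b = al -> WW al.
Proof.
move=> /sideL_data[S [bs [bs0 h]]] /sideR_data[S' [bs' [bs0' h']]] Ea Eb.
rewrite {}Ea in h; rewrite {}Eb in h'.
have [|k [f [q [m [pm qS qbs qb]]]]] := @smith_basis G A pA (S ++ S') (bs ++ bs').
  by move=> c; rewrite mem_cat => /orP[/bs0|/bs0'].
pose qq i j : {additive FR G -> int} :=
  wlift (fun s => if s is [:: g; g'] then q i << g >> * q j << g' >> else 0).
have qqE i j x y : qq i j (tens x y) = q i x * q j y.
  apply: (fab_ind (P := fun x => qq i j (tens x y) = q i x * q j y)) => {x} [|x x' E E'|g].
  - by rewrite /tens !raddf0 mul0r raddf0 mul0r.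
  - by rewrite tensBl (raddfB (qq i j)) E E' (raddfB (q i)) mulrBl.
  apply: (fab_ind (P := fun y => qq i j (tens << g >> y) = q i << g >> * q j y)) => {y}
    [|y y' E E'|g'].
  - by rewrite /tens !raddf0 mulr0 raddf0 mulr0.
  - by rewrite tensBr (raddfB (qq i j)) E E' (raddfB (q j)) mulrBr.
  by rewrite /tens !P_FRU wordM /qq wliftE.
have tens_sum x y : x = \sum_i f i *~ q i x -> y = \sum_j f j *~ q j y ->
    tens x y = \sum_i \sum_j tens (f i) (f j) *~ qq i j (tens x y).
  move=> Ex Ey; transitivity (\sum_i \sum_j tens (f i) (f j) *~ (q i x * q j y)).
    rewrite /tens {1}Ex {1}Ey !raddf_sum mulr_suml; apply: eq_bigr => i _.
    rewrite mulr_sumr; apply: eq_bigr => j _.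
    by rewrite !raddfMz /= mulrzAl mulrzAr -mulrzA mulrC.
  by apply: eq_bigr => i _; apply: eq_bigr => j _; rewrite qqE.
have alE : al = \sum_i \sum_j tens (f i) (f j) *~ qq i j al.
  elim: h {h'} => [_ [c [g [cb gS ->]]]||y z _ Ey _ Ez].
  - apply: tens_sum; first by apply: qbs; rewrite mem_cat cb.
    by apply: qS; rewrite mem_cat gS.
  - by rewrite big1 // => i _; rewrite big1 // => j _; rewrite raddf0.
  - rewrite {1}Ey {1}Ez -sumrB; apply: eq_bigr => i _; rewrite -sumrB.
    by apply: eq_bigr => j _; rewrite (raddfB (qq i j)) mulrzBr.
have divl i j : (m i %| qq i j al)%Z.
  elim: h {h' alE} => [_ [c [g [cb gS ->]]]||y z _ Ey _ Ez].
  - have [|e E] := qb c _ i; first by rewrite mem_cat cb.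
    by rewrite qqE E -mulrA mulrCA dvdz_mulr.
  - by rewrite raddf0 dvdz0.
  - by rewrite (raddfB (qq i j)) rpredB.
have divr i j : (m j %| qq i j al)%Z.
  elim: h' {h alE divl} => [_ [c [g [cb gS ->]]]||y z _ Ey _ Ez].
  - have [|e E] := qb c _ j; first by rewrite mem_cat cb orbT.
    by rewrite qqE E mulrA dvdz_mull.
  - by rewrite raddf0 dvdz0.
  - by rewrite (raddfB (qq i j)) rpredB.
have Wc : zclosed (@WW G) := zclosed_gen _.
rewrite alE; apply: zclosed_sum => // i _; apply: zclosed_sum => // j _.
pose L := `|lcmz (m i) (m j)|%N.
have pL t : (m t %| L%:Z)%Z -> pA (f t *+ L) = 0.
  move=> /dvdzP[c E]; have := pm t; rewrite raddfMz raddfMn /= => E'.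
  by rewrite pmulrn E mulrC mulrzA E' mul0rz.
have /dvdzP[c ->] : (L%:Z %| qq i j al)%Z by rewrite /L abszE dvdz_lcm divl divr.
rewrite mulrC mulrzA -pmulrn; apply: zclosedMz => //.
by apply: tor_WW; apply: pL; rewrite /L abszE ?dvdz_lcml ?dvdz_lcmr.
Qed.

Hypothesis H2 : zmod_trivial (group_homology G 2).

Lemma rk2_fil3_near_relator (s : M) : rk 2 s -> fil 3 s -> near_relator 2 s.
Proof. by apply: rk2_fil3 => //; exact: sides_WW. Qed.

End TorsionForms.

(** * Relators of degree three and simplices *)

Section Pairs.
Variable G : groupType.
Notation M := (trunc G 5).

Let fc n := fil_closed (K := G) (N := 5) n.
Let rc n := rk_closed G n.

(* These pairs form a filtered ring, in which leading terms are computed for two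
   evaluations at once. *)
Definition pairfil k (x y : M) := [/\ fil k x, fil k y & rk k (x - y)].

Lemma pairfil0 k : pairfil k 0 0.
Proof. by split; rewrite ?subrr; [case: (fc k) | case: (fc k) | case: (rc k)]. Qed.

Lemma pairfilB k x y x' y' : pairfil k x y -> pairfil k x' y' -> pairfil k (x - x') (y - y').
Proof.
move=> [fx fy r] [fx' fy' r']; split; [exact: (proj2 (fc k)) | exact: (proj2 (fc k)) |].
by have := proj2 (rc k) _ _ r r'; congr (rk k _); zmod.
Qed.

Lemma pairfilD k x y x' y' : pairfil k x y -> pairfil k x' y' -> pairfil k (x + x') (y + y').
Proof.
move=> h h'; have := pairfilB h (pairfilB (pairfil0 k) h').
by rewrite !sub0r !opprK.
Qed.

Lemma pairfilM k l x y x' y' :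
  pairfil k x y -> pairfil l x' y' -> pairfil (k + l)%N (x * x') (y * y').
Proof.
move=> [fx fy r] [fx' fy' r']; split; [exact: filM | exact: filM |].
rewrite (_ : _ - _ = (x - y) * x' + y * (x' - y')); last by ncring.
by apply: (zclosedD (rc _)); [exact: rk_mulr | exact: rk_mull].
Qed.

Lemma pairfilW k l x y : (k <= l)%N -> pairfil l x y -> pairfil k x y.
Proof.
by move=> kl [fx fy r]; split; [exact: filW kl fx | exact: filW kl fy | exact: rkW kl r].
Qed.

Lemma pairfil_com k l x y x' y' :
  pairfil k x y -> pairfil l x' y' -> pairfil (k + l)%N (com x x') (com y y').
Proof. by move=> h h'; apply: pairfilB; [|rewrite addnC]; apply: pairfilM. Qed.

Lemma pairfil_one : pairfil 0 1 1.
Proof. by split; rewrite ?subrr //; case: (rc 0). Qed.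

Lemma pairfil_rr x y : fil 1 x -> fil 1 y -> rr (x - y) -> pairfil 1 x y.
Proof. by move=> fx fy r; split=> //; exact: rr_rk. Qed.

End Pairs.

Lemma pred_add m n : (0 < m -> 0 < n -> (m + n).-1 = (m.-1 + n.-1).+1)%N.
Proof. lia. Qed.

Section LieWords.
Variable K : choiceType.

Fixpoint lexp (w : lie_word K) : FR K :=
  match w with
  | lie_leaf a => word [:: a]
  | lie_node u v => com (lexp u) (lexp v)
  end.

Definition lie3 (x : FR K) := zgenerated (fun z => exists2 w, lie_deg w = 3 & z = lexp w) x.

Lemma homog_word (s : seq K) : homog (size s) (word s).
Proof. by apply: zgen_in; exists s. Qed.

Lemma homog_lexp w : homog (lie_deg w) (lexp w).
Proof.
elim: w => [a|u IHu v IHv] /=; first exact: (homog_word [:: a]).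
by apply: (proj2 (homog_closed _ _)); [|rewrite addnC]; apply: homogM.
Qed.

Lemma homog_lie3 x : lie3 x -> homog 3 x.
Proof.
apply: (zgen_sub (homog_closed K 3)) => _ [w w3 ->]; have := homog_lexp w; rewrite w3; exact.
Qed.

Lemma lie_deg_gt0 (w : lie_word K) : (0 < lie_deg w)%N.
Proof. by elim: w => //= u hu v hv; rewrite addn_gt0 hu. Qed.

End LieWords.

Section Maps.
Variables (A B : choiceType).

Definition fm (f : A -> B) : {additive FR A -> FR B} := frlift (fun a => word [:: f a]).

Lemma fmM f x y : fm f (x * y) = fm f x * fm f y.
Proof. exact: frliftM. Qed.

Lemma fmW f s : fm f (word s) = word (map f s).
Proof.
rewrite /fm frliftW; elim: s => [|a s IH]; first by rewrite big_nil word0.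
by rewrite big_cons IH wordM.
Qed.

Lemma homog_fm f n x : homog n x -> homog n (fm f x).
Proof.
apply: (zgen_sub (zclosed_preim (fm f) (homog_closed B n))) => _ [s <- ->].
by rewrite fmW -(size_map f); apply: zgen_in; exists (map f s).
Qed.

End Maps.

Lemma fm_comp (A B C : choiceType) (f : A -> B) (g : B -> C) x :
  fm g (fm f x) = fm (g \o f) x.
Proof.
apply: (word_ext (f := fm g \o fm f) (g := fm (g \o f))) => s /=.
by rewrite !fmW map_comp.
Qed.

Lemma fm_ext (A B : choiceType) (f g : A -> B) : f =1 g -> fm f =1 fm g.
Proof. by move=> fg; apply: word_ext => s; rewrite !fmW (eq_map fg). Qed.

Section Realize.
Variable G : groupType.
Notation M := (trunc G 5).
Notation A := (abelianization G).
Notation Fs := (@Fs G).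
Notation lc := (lc Fs).
Notation P := {malg G}.
Notation pA := (@pA G).

Let fc n := fil_closed (K := G) (N := 5) n.
Let rc n := rk_closed G n.
Let Fg := @Fs_closed G.

Hypothesis H2 : zmod_trivial (group_homology G 2).

Lemma unif_lift_ex (p : P) : exists2 x, Fs x &
  x.1 = (VA (pA p)).1 /\ cf 1 (um x - 1) = P_FR p.
Proof. by apply: Fs_lift; rewrite cls_VA. Qed.

(* The component in G only depends on the class of p in A, so two such lifts differ by a
   relator as soon as the classes agree. *)
Definition class_lift (p : P) : bigG G := s2val (cid2 (unif_lift_ex p)).

Lemma Fs_class_lift p : Fs (class_lift p). Proof. exact: s2valP. Qed.
Lemma class_lift_fst p : (class_lift p).1 = (VA (pA p)).1.
Proof. by case: (s2valP' (cid2 (unif_lift_ex p))). Qed.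
Lemma cf1_class_lift p : cf 1 (um (class_lift p) - 1) = P_FR p.
Proof. by case: (s2valP' (cid2 (unif_lift_ex p))). Qed.

Lemma Fs_fst_rr x y : Fs x -> Fs y -> x.1 = y.1 -> rr (um x - um y).
Proof.
move=> /Fs_rr rx /Fs_rr ry E; have := proj2 (rr_closed G) _ _ rx ry.
by rewrite E; congr rr; zmod.
Qed.

(** The letters are all elements of P, not a basis of it. The substitution is not additive in its
    letters, and [Phi_trel] measures the defect. *)
Definition lift_eval : {additive FR P -> M} := frlift (fun p => um (class_lift p) - 1).

Lemma lift_evalM x y : lift_eval (x * y) = lift_eval x * lift_eval y. Proof. exact: frliftM. Qed.
Lemma lift_eval1 p : lift_eval (word [:: p]) = um (class_lift p) - 1. Proof. exact: frliftU. Qed.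

Lemma class_lift_pairfil p q :
  pA p = pA q -> pairfil 1 (um (class_lift p) - 1) (um (class_lift q) - 1).
Proof.
move=> pq; have Fp := Fs_class_lift p; have Fq := Fs_class_lift q.
apply: pairfil_rr; [exact: Fs_fil1 Fp | exact: Fs_fil1 Fq |].
have := Fs_fst_rr Fp Fq; rewrite !class_lift_fst pq => /(_ erefl).
by congr rr; zmod.
Qed.

Section Phi.
Variables (X : zmodType) (a1 a0 : {additive X -> P}).
Hypothesis aE : forall x, pA (a1 x) = pA (a0 x).

(** In the application [a1] and [a0] are the faces of a 1-simplex followed by a map to P, so that
    [Phi] is a multiplicative model of the simplicial boundary. *)
Definition Phi (t : FR X) : M := lift_eval (fm a1 t) - lift_eval (fm a0 t).

Lemma Phi_is_zmod_morphism : zmod_morphism Phi.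
Proof.
move=> x y; rewrite /Phi (raddfB (fm a1)) (raddfB (fm a0)) !(raddfB lift_eval); zmod.
Qed.
HB.instance Definition _ := GRing.isZmodMorphism.Build (FR X) M Phi Phi_is_zmod_morphism.

Lemma PhiB x y : Phi (x - y) = Phi x - Phi y. Proof. exact: raddfB. Qed.

Lemma lift_eval_pairfil s :
  pairfil (size s) (lift_eval (fm a1 (word s))) (lift_eval (fm a0 (word s))).
Proof.
elim: s => [|x s IH]; first by rewrite !fmW /= word0 /lift_eval frlift1; exact: pairfil_one.
rewrite -cat1s -wordM !fmM !lift_evalM size_cat; apply: pairfilM => //.
by rewrite !fmW /= !lift_eval1; apply: class_lift_pairfil.
Qed.

Lemma lift_eval_homog n t : homog n t -> pairfil n (lift_eval (fm a1 t)) (lift_eval (fm a0 t)).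
Proof.
elim=> [_ [s <- ->]||y z _ Ey _ Ez]; first exact: lift_eval_pairfil.
- by rewrite !raddf0; exact: pairfil0.
- by rewrite !raddfB; apply: pairfilB.
Qed.

Lemma class_lift_lin p q :
  fil 2 (um (class_lift (p + q)) - 1 - (um (class_lift p) - 1) - (um (class_lift q) - 1)).
Proof.
apply: filS; last by rewrite (raddfB (cf 1)) (raddfB (cf 1)) !cf1_class_lift (raddfD P_FR); zmod.
have h z : fil 1 (um (class_lift z) - 1) by exact: Fs_fil1 (Fs_class_lift z).
by apply: (proj2 (fc 1)) => //; apply: (proj2 (fc 1)).
Qed.

(** Each defect of additivity has order 2, and the two defects agree modulo [rr] because the ends
    agree in A. Here H_2(G) = 0 improves the difference to [rk 2]. *)
Lemma Phi_trel x y : pairfil 2 (lift_eval (fm a1 (trel x y))) (lift_eval (fm a0 (trel x y))).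
Proof.
have E (a : {additive X -> P}) : lift_eval (fm a (trel x y)) =
    um (class_lift (a x + a y)) - 1 - (um (class_lift (a x)) - 1) - (um (class_lift (a y)) - 1).
  by rewrite /trel !(raddfB (fm a)) !fmW /= !(raddfB lift_eval) !lift_eval1 raddfD.
rewrite !E; split; [exact: class_lift_lin | exact: class_lift_lin |].
apply: rr_fil2 => //; last by apply: (proj2 (fc 2)); exact: class_lift_lin.
have h p q (pq : pA p = pA q) : rr (um (class_lift p) - 1 - (um (class_lift q) - 1)).
  by have [_ _ r] := class_lift_pairfil pq; exact: rk_rr r.
have r1 := h (a1 x + a1 y) (a0 x + a0 y) ltac:(by rewrite !raddfD !aE).
have r2 := h _ _ (aE x); have r3 := h _ _ (aE y); have c := rr_closed G.
have := proj2 c _ _ (proj2 c _ _ r1 r2) r3; congr rr; zmod.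
Qed.

Lemma Phi_tens n t : tens_id t -> homog n.+1 t -> rk n.+2 (Phi t).
Proof.
move=> tt ht; rewrite -(dg_homog ht).
have H : zclosed (fun t => rk n.+2 (Phi (dg n.+1 t))).
  exact: (zclosed_preim (dg n.+1) (zclosed_preim (Phi : {additive FR X -> M}) (rc n.+2))).
move: t tt {ht}; apply: (zgen_sub H) => _ [u [v [x [y ->]]]].
have hom : homog (size u + 1 + size v) (word u * trel x y * word v).
  have hw s : homog (size s) (word s : FR X) by apply: zgen_in; exists s.
  apply: homogM => //; apply: homogM => //.
  have c := proj2 (homog_closed X 1).
  by apply: (c); [apply: (c)|]; exact: (hw [:: _]).
rewrite -(dg_homog hom) dg_dg; case: eqP => [En|_]; last first.
  by rewrite raddf0; case: (rc n.+2).
rewrite (dg_homog hom) /Phi !fmM !lift_evalM En.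
have [_ _] := pairfilM (pairfilM (lift_eval_pairfil u) (Phi_trel x y)) (lift_eval_pairfil v).
by apply: rkW; rewrite -addSn leq_add2r -addnS.
Qed.

Lemma pairfil_inv k (g h : bigG G) : pairfil k (um g - 1) (um h - 1) -> rr (um g - um h) ->
  pairfil k (umV g - 1) (umV h - 1).
Proof.
move=> hk r; have c := rr_closed G; rewrite !inv_sub1.
suff z : pairfil k (umV g * (um g - 1)) (umV h * (um h - 1)).
  by have := pairfilB (pairfil0 _ k) z; rewrite !sub0r.
rewrite -[k]add0n; apply: pairfilM => //; split=> //.
rewrite (_ : umV g - umV h = - (umV g * (um g - um h) * umV h)); last first.
  by rewrite mulrBr umVK mulrBl -mulrA umK mulr1 mul1r; zmod.
apply: (zclosedN (rc 0)); apply: (rkW (l := 1)) => //; apply: rr_rk.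
by apply: rr_mulr; apply: rr_mull.
Qed.

Lemma pairfil_mul1 k (a b c a' b' c' : M) :
  pairfil 1 (a - 1) (a' - 1) -> pairfil 1 (b - 1) (b' - 1) ->
  pairfil k c c' -> pairfil k.+1 (a * b * c - c) (a' * b' * c' - c').
Proof.
move=> ha hb hc.
have E (x y z : M) : x * y * z - z = ((x - 1) + (y - 1) + (x - 1) * (y - 1)) * z.
  by rewrite -sub1_mul mulrBl mul1r.
rewrite !E -add1n; apply: pairfilM => //; apply: pairfilD; first exact: pairfilD.
by apply: (pairfilW (l := 1 + 1)) => //; apply: pairfilM.
Qed.

(** Both elements are the same iterated commutator, formed from the lifts of the two ends, which
    explains the common component in G. The bound on the pair records that the two error terms agree
    modulo [rk], more than their orders say. *)
Lemma lie_realize (w : lie_word X) : exists g1 g0 : bigG G,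
  [/\ lc (lie_deg w).-1 g1, lc (lie_deg w).-1 g0, g1.1 = g0.1 &
      pairfil (lie_deg w).+1 (um g1 - 1 - lift_eval (fm a1 (lexp w)))
        (um g0 - 1 - lift_eval (fm a0 (lexp w)))].
Proof.
elim: w => [x|u [g1 [g0 [Hg1 Hg0 gE gp]]] v [h1 [h0 [Hh1 Hh0 hE hp]]]] /=.
  exists (class_lift (a1 x)), (class_lift (a0 x)); split; try exact: Fs_class_lift.
  - by rewrite !class_lift_fst aE.
  - by rewrite !fmW /= !lift_eval1 !subrr; exact: pairfil0.
have hu := lie_deg_gt0 u; have hv := lie_deg_gt0 v.
exists [~ g1, h1]%g, [~ g0, h0]%g; split.
- by rewrite pred_add //; exact: lcRR.
- by rewrite pred_add //; exact: lcRR.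
- by rewrite -[LHS]/[~ g1.1, h1.1]%g gE hE.
have Wu := lift_eval_homog (homog_lexp u); have Wv := lift_eval_homog (homog_lexp v).
set U1 := lift_eval (fm a1 (lexp u)) in gp Wu *; set U0 := lift_eval (fm a0 (lexp u)) in gp Wu *.
set V1 := lift_eval (fm a1 (lexp v)) in hp Wv *; set V0 := lift_eval (fm a0 (lexp v)) in hp Wv *.
have gW : pairfil (lie_deg u) (um g1 - 1) (um g0 - 1).
  by have := pairfilD (pairfilW (leqnSn _) gp) Wu; rewrite !subrK.
have hW : pairfil (lie_deg v) (um h1 - 1) (um h0 - 1).
  by have := pairfilD (pairfilW (leqnSn _) hp) Wv; rewrite !subrK.
have E (a : {additive X -> P}) : lift_eval (fm a (com (lexp u) (lexp v))) =
    com (lift_eval (fm a (lexp u))) (lift_eval (fm a (lexp v))).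
  by rewrite /com (raddfB (fm a)) !fmM (raddfB lift_eval) !lift_evalM.
rewrite !E !umR -/U1 -/V1 -/U0 -/V0.
have comE (x y x' y' c : M) : c * com x y - com x' y' = (c * com x y - com x y)
    + (com (x - x') y + com x' (y - y')).
  by move: (c * com x y) => z; rewrite /com; ncring.
rewrite (comE _ _ U1 V1) (comE _ _ U0 V0); apply: pairfilD.
  have r1 := Fs_fst_rr (lc_F Fg Hg1) (lc_F Fg Hg0) gE.
  have r2 := Fs_fst_rr (lc_F Fg Hh1) (lc_F Fg Hh0) hE.
  apply: pairfil_mul1; last exact: pairfil_com.
    by apply: pairfil_inv => //; apply: pairfilW gW.
  by apply: pairfil_inv => //; apply: pairfilW hW.
by apply: pairfilD; [rewrite -addSn | rewrite -addnS]; apply: pairfil_com.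
Qed.

Lemma lie3_realize l : lie3 l -> exists g1 g0 : bigG G,
  [/\ lc 2 g1, lc 2 g0, g1.1 = g0.1 &
      pairfil 4 (um g1 - 1 - lift_eval (fm a1 l)) (um g0 - 1 - lift_eval (fm a0 l))].
Proof.
have [H1 HM HV] := lc_closed Fg 2.
elim=> [_ [w w3 ->]||y z hy [g1 [g0 [Hg1 Hg0 gE gp]]] hz [h1 [h0 [Hh1 Hh0 hE hp]]]].
- by have := lie_realize w; rewrite w3.
- exists 1%g, 1%g; split=> //; rewrite !raddf0 um1 addr0 subrr; exact: pairfil0.
have HVh1 := HV _ Hh1; have HVh0 := HV _ Hh0.
exists (g1 * h1^-1)%g, (g0 * h0^-1)%g; split.
- exact: HM.
- exact: HM.
- by rewrite !fstM !fstV gE hE.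
have pg : pairfil 3 (um g1 - 1) (um g0 - 1).
  have := pairfilD (pairfilW (leqnSn 3) gp) (lift_eval_homog (homog_lie3 hy)); by rewrite !subrK.
have ph : pairfil 3 (um h1 - 1) (um h0 - 1).
  have := pairfilD (pairfilW (leqnSn 3) hp) (lift_eval_homog (homog_lie3 hz)); by rewrite !subrK.
have r2 := Fs_fst_rr (lc_F Fg Hh1) (lc_F Fg Hh0) hE.
have pv := pairfil_inv ph r2.
rewrite !umM !um_inv !sub1_mul !(raddfB (fm a1)) !(raddfB (fm a0)) !(raddfB lift_eval).
have E2 (g h : bigG G) (W W' : M) :
   um g - 1 + (umV h - 1) + (um g - 1) * (umV h - 1) - (W - W') =
   (um g - 1 - W) - (um h - 1 - W') + ((um g - 1) * (umV h - 1) - (umV h - 1) * (um h - 1)).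
  have : (umV h - 1) * (um h - 1) = - (umV h - 1) - (um h - 1).
    by rewrite mulrBl mulrBr umVK; ncring.
  by move=> ->; zmod.
rewrite !E2; apply: pairfilD; first exact: pairfilB.
by apply: (pairfilW (l := 3 + 3)) => //; apply: pairfilB; apply: pairfilM.
Qed.

(** The relator is g0^-1 g1 for the two realisations of [l]. It agrees with 1 + [Phi l] modulo
    [rk 4], so order 4 lets [detectP] move it from [lc 2] to [lc 3]. *)
Lemma Phi_lie l : lie3 l -> fil 4 (Phi l) -> near_relator 3 (Phi l).
Proof.
move=> hl f4; have [g1 [g0 [Hg1 Hg0 gE gp]]] := lie3_realize hl.
have [H1 HM HV] := lc_closed Fg 2; have HV0 := HV _ Hg0.
pose r := (g0^-1 * g1)%g; have Hr : lc 2 r by exact: HM.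
have [_ _ r3] := pairfilD (pairfilW (leqnSn 3) gp) (lift_eval_homog (homog_lie3 hl)).
have {}r3 : rk 3 (um g1 - um g0) by move: r3; congr (rk 3 _); zmod.
have r4 : rk 4 (Phi l - (um r - 1)).
  have [_ _ h] := gp.
  have E : um r - 1 = (um g1 - um g0) + (umV g0 - 1) * (um g1 - um g0).
    by rewrite /r umM um_inv mulrBl mul1r mulrBr umVK; zmod.
  have h2 : rk 4 ((umV g0 - 1) * (um g1 - um g0)).
    apply: (@rk_mull G 3 1) => //; apply: filV; apply: filW (lc_fil Hg0); lia.
  have := zclosedN (rc 4) (zclosedD (rc 4) h h2); congr (rk 4 _).
  by rewrite E /Phi; zmod.
exists r; split=> //; last by rewrite /r fstM fstV gE mulVg.
apply: detectP => //.
have := proj2 (fc 4) _ _ f4 (rk_fil r4); congr (fil 4 _); zmod.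
Qed.

End Phi.

End Realize.

(** * Comparison with a resolution, and relators from 1-simplices *)

Section EtaClaim.
Variable G : groupType.
Notation M := (trunc G 5).
Notation A := (abelianization G).
Notation Fs := (@Fs G).
Notation lc := (lc Fs).
Notation P := {malg G}.
Notation pA := (@pA G).

Let fc n := fil_closed (K := G) (N := 5) n.
Let rc n := rk_closed G n.
Let Fg := @Fs_closed G.

Hypothesis H2 : zmod_trivial (group_homology G 2).

Section Eta.
Variable f : {additive P -> P}.
Hypothesis fA : forall p, pA (f p) = pA p.

Lemma eta_letter_ex g : exists2 x, Fs x & x.1 = g /\ cf 1 (um x - 1) = P_FR (f (basis g)).
Proof. by apply: Fs_lift; rewrite fA pAU. Qed.

(** The chosen element of [Fs] has component [g], so [eta] is the identity modulo [rr]; its linear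
    part is [f] at [g], so [eta] covers [f]. *)
Definition eta_letter g : M := um (s2val (cid2 (eta_letter_ex g))) - 1.

Lemma eta_letter_rr g : rr (eta_letter g - X g).
Proof.
have := Fs_rr (s2valP (cid2 (eta_letter_ex g))).
by case: (s2valP' (cid2 (eta_letter_ex g))) => -> _; congr rr; rewrite /eta_letter; zmod.
Qed.

Lemma cf1_eta_letter g : cf 1 (eta_letter g) = P_FR (f (basis g)).
Proof. by case: (s2valP' (cid2 (eta_letter_ex g))). Qed.

Lemma fil1_eta_letter g : fil 1 (eta_letter g).
Proof. exact: Fs_fil1 (s2valP (cid2 (eta_letter_ex g))). Qed.

Definition eta : {additive M -> M} := endo fil1_eta_letter.

Lemma etaM x y : eta (x * y) = eta x * eta y. Proof. exact: endoM. Qed.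

Lemma etaX g : eta (X g) = eta_letter g.
Proof. by rewrite /eta /X endoE frliftU. Qed.

Lemma word_consM g s : tr (word (g :: s)) = X g * tr (word s) :> M.
Proof. by rewrite -cat1s -wordM trM. Qed.

Lemma eta_pairfil s : pairfil (size s) (eta (tr (word s))) (tr (word s)).
Proof.
elim: s => [|g s IH]; first by rewrite word0 tr1 /eta endo1; exact: pairfil_one.
rewrite word_consM etaM etaX -[size _]add1n; apply: pairfilM => //.
apply: pairfil_rr; [exact: fil1_eta_letter | exact: fil1_X | exact: eta_letter_rr].
Qed.

Lemma eta_rk n x : fil n x -> rk n (eta x - x).
Proof.
have H : zclosed (fun x => rk n (eta x - x)).
  split=> [|y z hy hz]; first by rewrite (raddf0 eta) subrr; case: (rc n).
  by have := proj2 (rc n) _ _ hy hz; congr (rk n _); rewrite (raddfB eta); zmod.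
move=> /fil_word; apply: (zgen_sub H) => _ [s sn ->].
by case: (eta_pairfil s) => _ _; exact: rkW.
Qed.

Lemma eta_rr x : rr x -> rr (eta x).
Proof.
move=> Rx; have f0 : fil 0 x by move=> i.
have := zclosedD (rr_closed G) (rk_rr (eta_rk f0)) Rx; congr rr; zmod.
Qed.

Lemma cf1_eta x : cf 1 (eta x) = P_FR (f (FR_P (cf 1 x))).
Proof.
have H : zclosed (fun x => cf 1 (eta x) = P_FR (f (FR_P (cf 1 x)))).
  split=> [|y z Ey Ez]; first by rewrite !raddf0.
  rewrite (raddfB eta) (raddfB (cf 1)) (raddfB (cf 1)) Ey Ez.
  by rewrite (raddfB FR_P) (raddfB f) (raddfB P_FR).
apply: (trunc_ind H) => -[|g [|h s]].
- by rewrite word0 tr1 /eta endo1 cf0_1 // !raddf0.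
- by rewrite -/(X g) etaX cf1_eta_letter cfE dgW /= /FR_P wliftE.
- by have [e w _] := eta_pairfil [:: g, h & s]; rewrite e // w // !raddf0.
Qed.

End Eta.

Section Claim.
(** These are the lowest terms of a resolution, with their faces and a degeneracy. [theta] and
    [sigma] compare degree 0 with P over A and need not be inverse to each other. *)
Variables (X0 X1 : zmodType) (d0 d1 : {additive X1 -> X0}) (s0 : {additive X0 -> X1})
  (theta : {additive X0 -> P}) (sigma : {additive P -> X0}).
Hypotheses (d0s : forall x, d0 (s0 x) = x) (d1s : forall x, d1 (s0 x) = x)
  (ts : forall p, pA (theta (sigma p)) = pA p)
  (td : forall n, pA (theta (d1 n)) = pA (theta (d0 n)))
  (ker : forall x, pA (theta x) = 0 -> exists n, d0 n = 0 /\ d1 n = x).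

Let f : {additive P -> P} := theta \o sigma.
Let fts : forall p, pA (f p) = pA p := ts.
Let lift_eval := lift_eval G.
Let sb : G -> X0 := sigma \o @basis G.
Let a1 : {additive X1 -> P} := theta \o d1.
Let a0 : {additive X1 -> P} := theta \o d0.
Let eta := @eta f fts.

(** Both substitutions give the letter X_g an image with linear part [f] at [g], so changing one
    letter changes the value only in a higher degree. *)
Lemma lift_eval_eta s : fil (size s) (lift_eval (fm theta (fm sb (word s)))) /\
  fil (size s).+1 (lift_eval (fm theta (fm sb (word s))) - eta (tr (word s))).
Proof.
elim: s => [|g s [IH1 IH2]].
  rewrite !fmW /= !word0 /lift_eval frlift1 tr1 /eta endo1 subrr.
  by split; [move=> i | case: (fc 1)].
have E : lift_eval (fm theta (fm sb (word (g :: s)))) =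
    (um (class_lift (f (basis g))) - 1) * lift_eval (fm theta (fm sb (word s))).
  by rewrite -cat1s -wordM !fmM /lift_eval lift_evalM; congr (_ * _); rewrite !fmW /= lift_eval1.
have fU : fil 1 (um (class_lift (f (basis g))) - 1) by exact: Fs_fil1 (Fs_class_lift _).
rewrite E word_consM /eta etaM etaX -/eta -[size (g :: s)]add1n.
split; first exact: filM.
rewrite (_ : _ - _ = (um (class_lift (f (basis g))) - 1 - eta_letter fts g)
   * lift_eval (fm theta (fm sb (word s))) + eta_letter fts g *
   (lift_eval (fm theta (fm sb (word s))) - eta (tr (word s)))); last by ncring.
apply: (zclosedD (fc _)).
- apply: (filW (n := (2 + size s)%N)) => //; apply: filM => //.
  apply: filS; first by apply: (proj2 (fc 1)) => //; exact: fil1_eta_letter.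
  by rewrite (raddfB (cf 1)) cf1_class_lift cf1_eta_letter subrr.
- apply: (filW (n := (1 + (size s).+1)%N)) => //.
  by apply: filM => //; exact: fil1_eta_letter.
Qed.

(** In a product u rho v the linear part of rho, moved to X0 by [sigma], dies in A and is the end of
    a 1-simplex [n] starting at 0. The letters of u and v become degenerate simplices, and t is the
    tensor of all of them. *)
Lemma rk3_simplex (s : M) : rk 3 s -> exists t, [/\ homog 3 t, tens_id (fm d0 t),
  tens_id (fm d1 t - fm sb (cf 3 s)) & rk 4 (Phi a1 a0 t - eta s)].
Proof.
pose S s := exists t, [/\ homog 3 t, tens_id (fm d0 t),
  tens_id (fm d1 t - fm sb (cf 3 s)) & rk 4 (Phi a1 a0 t - eta s)].
have tc := @tens_id_closed X0; have hc := homog_closed X1 3.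
have Sc : zclosed S.
  split=> [|x y [t [t1 t2 t3 t4]] [u [u1 u2 u3 u4]]].
    by exists 0; rewrite !raddf0 !addr0; split; [case: hc | case: tc | case: tc | case: (rc 4)].
  exists (t - u); split.
  - exact: (proj2 hc).
  - by rewrite (raddfB (fm d0)); exact: (proj2 tc).
  - have := proj2 tc _ _ t3 u3; congr tens_id.
    by rewrite (raddfB (fm d1)) (raddfB (cf 3)) (raddfB (fm sb)); zmod.
  - have := proj2 (rc 4) _ _ t4 u4; congr (rk 4 _).
    by rewrite PhiB (raddfB eta); zmod.
move=> /rk_word; apply: (zgen_sub Sc) => {s} _ [u [v [rho [uv Rr ->]]]].
pose p := FR_P (cf 1 rho); have p0 : pA (f p) = 0 by rewrite fts /p pA_rr.
have [n [n0 n1]] := ker p0.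
pose S0 := s0 \o sb; exists (word (map S0 u) * word [:: n] * word (map S0 v)).
have E0 w : map d0 (map S0 w) = map sb w.
  by rewrite -map_comp; apply: eq_map => g; rewrite /= d0s.
have E1 w : map d1 (map S0 w) = map sb w.
  by rewrite -map_comp; apply: eq_map => g; rewrite /= d1s.
have fr := rr_fil1 Rr.
have fu : fil (size u) (tr (word u) : M) by exact: fil_tr.
have fv : fil (size v) (tr (word v) : M) by exact: fil_tr.
have c3 k : k = (size u + 1 + size v)%N -> (k < 5)%N ->
    cf k (tr (word u) * rho * tr (word v)) = word u * cf 1 rho * word v.
  move=> -> k5; rewrite cfM_lead //; last exact: filM.
  rewrite cfM_lead //; last lia.
  by rewrite !cfE !dgW !eqxx !ifT //; lia.
split.
- have := homogM (homogM (homog_word (map S0 u)) (homog_word [:: n])) (homog_word (map S0 v)).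
  by rewrite !size_map (_ : (size u + 1 + size v)%N = 3) //; lia.
- rewrite !fmM !fmW /= n0; apply: tens_id_mulr; apply: tens_id_mull; exact: word0_tens.
- rewrite (c3 3) //; last lia.
  rewrite !fmM !fmW /= !E1 n1.
  rewrite (_ : _ - _ = word (map sb u) * (word [:: sigma p] - fm sb (cf 1 rho)) *
    word (map sb v)); last by rewrite mulrBr mulrBl.
  apply: tens_id_mulr; apply: tens_id_mull.
  rewrite -[cf 1 rho](FR_PK (homog_cf _ _)) -opprB; apply: (zclosedN tc).
  exact: lt_P_FR.
have EW (d : {additive X1 -> X0}) : (forall w, map d (map S0 w) = map sb w) ->
   fm (theta \o d) (word (map S0 u) * word [:: n] * word (map S0 v)) =
   fm theta (fm sb (word u)) * word [:: theta (d n)] * fm theta (fm sb (word v)).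
  by move=> Ed; rewrite !fmM !fmW -!Ed -!map_comp.
rewrite /Phi (EW d1 E1) (EW d0 E0) n0 n1 raddf0.
rewrite !lift_evalM !lift_eval1 -/lift_eval /eta !etaM -/eta.
have [wu1 wu2] := lift_eval_eta u; have [wv1 wv2] := lift_eval_eta v.
set Wu := lift_eval _ in wu1 wu2 *; set Wv := lift_eval _ in wv1 wv2 *.
(* [class_lift 0] need not be the identity, so the middle factor is this difference of the values at
   the two ends of [n]. It lies in [rr] and has the linear part of [eta rho], hence they agree
   modulo [rk 2]. *)
pose D := um (class_lift (f p)) - um (class_lift 0) : M.
have DR : rr D by apply: Fs_fst_rr; rewrite ?class_lift_fst ?p0 ?raddf0 //; exact: Fs_class_lift.
have eR := eta_rr fts Rr.
have D2 : rk 2 (D - eta rho).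
  apply: rk_cf1 => //; rewrite cf1_eta -/p.
  have -> : D = (um (class_lift (f p)) - 1) - (um (class_lift 0) - 1) by rewrite /D; zmod.
  by rewrite (raddfB (cf 1)) !cf1_class_lift raddf0 subr0.
have fe : fil (size u) (eta (tr (word u))) by case: (eta_pairfil fts u).
rewrite (_ : _ - _ = (Wu - eta (tr (word u))) * D * Wv
  + eta (tr (word u)) * (D - eta rho) * Wv
  + eta (tr (word u)) * eta rho * (Wv - eta (tr (word v)))); last first.
  by rewrite /D; ncring.
have r4 k x : rk (size u + 2 + size v) x -> rk 4 x by apply: rkW; lia.
apply: (zclosedD (rc 4)); first apply: (zclosedD (rc 4)).
- apply: r4; apply: rk_mulr => //; rewrite addn2; exact: rk_mulrr.
- by apply: r4; apply: rk_mulr => //; apply: rk_mull.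
- apply: (rkW (l := (size u).+1 + (size v).+1)); first lia.
  by apply: rk_mulr => //; apply: rk_mulrr.
Qed.

Variables (X2 : zmodType) (e0 e1 e2 : {additive X2 -> X1}).
Hypotheses (de1 : forall y, d0 (e1 y) = d0 (e0 y)) (de2 : forall y, d0 (e2 y) = d1 (e0 y))
  (de3 : forall y, d1 (e2 y) = d1 (e1 y)).
Hypothesis bound : forall t, homog 3 t -> tens_id (fm d0 t) -> tens_id (fm d1 t) ->
  exists l l0 l1 y, [/\ [/\ lie3 l, lie3 l0, lie3 l1 & homog 3 y], tens_id (fm e0 y - l0),
    tens_id (fm e1 y - l1) & tens_id (t - l - fm e2 y)].

(** Order 4 makes the tensor of [rk3_simplex] a cycle, which [bound] writes as a Lie element plus
    the last face of [y], the other faces being Lie. Tensor relations cost only [rk 4] under [Phi],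
    so [s] becomes the value of [Phi] at one Lie element. *)
Lemma rk3_fil4_near_relator (s : M) : rk 3 s -> fil 4 s -> near_relator 3 s.
Proof.
move=> r3 f4; have [t [ht t0 t1 rt]] := rk3_simplex r3.
have {}t1 : tens_id (fm d1 t) by move: t1; rewrite (f4 3 isT) raddf0 subr0.
have [l [l0 [l1 [y [[hl hl0 hl1 hy] ty0 ty1 ty2]]]]] := bound ht t0 t1.
pose F := Phi a1 a0; have FB x z : F (x - z) = F x - F z by exact: PhiB.
have Ft n x : tens_id x -> homog n.+1 x -> rk n.+2 (F x).
  by apply: Phi_tens => // z; exact: td.
have hB x z : homog 3 x -> homog 3 z -> homog 3 (x - z) := proj2 (homog_closed X1 3) x z.
have he (e : {additive X2 -> X1}) : homog 3 (fm e y) by exact: homog_fm.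
have r0 := Ft 2%N _ ty0 (hB _ _ (he e0) (homog_lie3 hl0)).
have r1 := Ft 2%N _ ty1 (hB _ _ (he e1) (homog_lie3 hl1)).
have r2 := Ft 2%N _ ty2 (hB _ _ (hB _ _ ht (homog_lie3 hl)) (he e2)).
(* The values of [Phi] on the three faces telescope, as for the edges of a triangle. *)
have FE : F (fm e2 y) = F (fm e1 y) - F (fm e0 y).
  rewrite /F /Phi !(fm_comp e0) !(fm_comp e1) !(fm_comp e2).
  rewrite (@fm_ext _ _ (a1 \o e2) (a1 \o e1)) => [|x /=]; last by rewrite de3.
  rewrite (@fm_ext _ _ (a0 \o e2) (a1 \o e0)) => [|x /=]; last by rewrite de2.
  rewrite (@fm_ext _ _ (a0 \o e1) (a0 \o e0)) => [|x /=]; last by rewrite de1.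
  zmod.
pose L := l - (l0 - l1).
have hL : lie3 L by apply: zgen_B => //; apply: zgen_B.
have rL : rk 4 (s - F L).
  have := proj2 (rc 4) _ _ (eta_rk fts f4) (zclosedN (rc 4) rt).
  move=> /(zclosedN (rc 4)) h; have := zclosedD (rc 4) h r2.
  move=> h'; have := proj2 (rc 4) _ _ h' (proj2 (rc 4) _ _ r0 r1); congr (rk 4 _).
  rewrite !FB FE -/F; move: (F t) (F l) (F l0) (F l1) (F (fm e0 y)) (F (fm e1 y)).
  by move: (eta s) => *; zmod.
have aE x : pA (a1 x) = pA (a0 x) by exact: td.
have [|r [Hr r1' rr4]] := Phi_lie aE hL.
  have := proj2 (fc 4) _ _ f4 (rk_fil rL); congr (fil 4 _).
  by rewrite -/F; zmod.
exists r; split=> //; have := zclosedD (rc 4) rL rr4; congr (rk 4 _).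
by rewrite -/F; zmod.
Qed.

End Claim.

End EtaClaim.

(** * Powers of the augmentation ideal *)

Section Augmentation.
Variable G : groupType.
Notation ZG := (group_ring G).
Notation aug := (@aug_ideal G).

Lemma gr_mulUU (g h : G) : gr_of g * gr_of h = gr_of (g * h)%g.
Proof. exact: fab_opUU. Qed.

Lemma gr_ind (P : ZG -> Prop) : zclosed P -> (forall g, P (gr_of g)) -> forall x, P x.
Proof. by move=> [P0 PB]; apply: fab_ind. Qed.

Lemma augB (x y : ZG) : augmentation (x - y) = augmentation x - augmentation y.
Proof. exact: fab_liftB. Qed.

Lemma augU (g : G) : augmentation (gr_of g) = 1.
Proof. exact: fab_liftU. Qed.

Lemma augM (x y : ZG) : augmentation (x * y) = augmentation x * augmentation y.
Proof.
have a0 : augmentation (0 : ZG) = 0 by exact: fab_lift0.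
apply: (gr_ind (P := fun x => augmentation (x * y) = augmentation x * augmentation y)).
  by split=> [|a b Ea Eb]; rewrite ?mul0r ?a0 ?mul0r // mulrBl !augB Ea Eb mulrBl.
move=> g; apply: (gr_ind (P := fun y => augmentation (gr_of g * y) = _ * augmentation y)).
  by split=> [|a b Ea Eb]; rewrite ?mulr0 ?a0 ?mulr0 // mulrBr !augB Ea Eb mulrBr.
by move=> h; rewrite gr_mulUU !augU mulr1.
Qed.

Lemma aug_closed : zclosed aug.
Proof.
split=> [|x y]; rewrite /aug_ideal; first exact: fab_lift0.
by rewrite augB => -> ->; rewrite subrr.
Qed.

Lemma aug_gr (g : G) : aug (gr_of g - 1).
Proof. by rewrite /aug_ideal augB !augU subrr. Qed.

Lemma ideal_exp_closed n : zclosed (ideal_exp aug n).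
Proof. by case: n => [//|n]; exact: zclosed_gen. Qed.

Lemma ideal_exp_mull n a x : ideal_exp aug n x -> ideal_exp aug n (a * x).
Proof.
case: n => [//|n]; apply: (zgen_sub (zclosed_mull a (ideal_exp_closed n.+1))).
move=> _ [y [z [ay hz ->]]]; apply: zgen_in; exists (a * y), z; rewrite mulrA; split=> //.
by rewrite /aug_ideal augM ay mulr0.
Qed.

Lemma ideal_exp_mulr n a x : ideal_exp aug n x -> ideal_exp aug n (x * a).
Proof.
elim: n x => [//|n IH] x; apply: (zgen_sub (zclosed_mulr a (ideal_exp_closed n.+1))).
move=> _ [y [z [ay hz ->]]]; apply: zgen_in; exists y, (z * a); rewrite mulrA; split=> //.
exact: IH.
Qed.

Lemma ideal_expSr n x y : ideal_exp aug n x -> aug y -> ideal_exp aug n.+1 (x * y).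
Proof.
move=> + ay; elim: n x => [|n IH] x.
  move=> _; apply: zgen_in; exists (x * y), 1; rewrite mulr1; split=> //.
  by rewrite /aug_ideal augM ay mulr0.
apply: (zgen_sub (zclosed_mulr y (ideal_exp_closed n.+2))).
move=> _ [a [b [ha hb ->]]]; apply: zgen_in; exists a, (b * y); rewrite mulrA; split=> //.
exact: IH.
Qed.

Lemma dimension_closed n : gclosed (dimension_subgroup G n).
Proof.
have [c0 cB] := ideal_exp_closed n.
rewrite /dimension_subgroup; split=> [|x y|x]; rewrite /mkset.
- by rewrite subrr.
- move=> hx hy; rewrite (_ : _ - 1 = (gr_of x - 1) * gr_of y + (gr_of y - 1)).
    by apply: (zclosedD (ideal_exp_closed n)) => //; exact: ideal_exp_mulr.
  by rewrite mulrBl gr_mulUU mul1r addrA subrK.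
- move=> hx; rewrite (_ : _ - 1 = - (gr_of x^-1%g * (gr_of x - 1))).
    by apply: (zclosedN (ideal_exp_closed n)); exact: ideal_exp_mull.
  by rewrite mulrBr gr_mulUU mulVg mulr1 opprB.
Qed.

Lemma lower_central_dimension n (g : G) :
  lower_central G n.+1 g -> dimension_subgroup G n.+1 g.
Proof.
elim: n g => [|n IH] g.
  move=> _; apply: zgen_in; exists (gr_of g - 1), 1; rewrite mulr1; split=> //.
  exact: aug_gr.
apply: (ggen_sub (dimension_closed n.+2)) => _ [x [y [/IH hx _ ->]]].
have c := ideal_exp_closed n.+2; rewrite /dimension_subgroup /mkset.
have -> : gr_of [~ x, y]%g - 1 = gr_of (x^-1 * y^-1)%g *
    ((gr_of x - 1) * (gr_of y - 1) - (gr_of y - 1) * (gr_of x - 1)).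
  rewrite (_ : _ - (_ * _) = gr_of (x * y)%g - gr_of (y * x)%g); last first.
    by rewrite -!gr_mulUU; ncring.
  rewrite mulrBr !gr_mulUU; congr (gr_of _ - _).
    by rewrite /commg /conjg !mulgA.
  by rewrite -mulgA mulKg mulVg.
apply: ideal_exp_mull; apply: (proj2 c); first exact: ideal_expSr (aug_gr y).
by apply: zgen_in; exists (gr_of y - 1), (gr_of x - 1); split=> //; exact: aug_gr.
Qed.

Notation M := (trunc G 5).

(** This lift of Z[G] is only additive; by [secM] it is multiplicative modulo [rr], which is enough
    to carry powers of the augmentation ideal into the degree filtration modulo [rr]. *)
Definition sec : {additive ZG -> M} := fab_lift (fun g => 1 + X g).

Lemma secU g : sec (gr_of g) = 1 + X g. Proof. exact: fab_liftU. Qed.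

Lemma secM x y : rr (sec (x * y) - sec x * sec y).
Proof.
have [r0 rB] := rr_closed G.
apply: (gr_ind (P := fun x => rr (sec (x * y) - sec x * sec y))).
  split=> [|a b Ea Eb]; first by rewrite mul0r !raddf0 mul0r subrr.
  have := rB _ _ Ea Eb; congr rr; rewrite mulrBl (raddfB sec) (raddfB sec a) mulrBl; zmod.
move=> g; apply: (gr_ind (P := fun y => rr (sec (gr_of g * y) - sec (gr_of g) * sec y))).
  split=> [|a b Ea Eb]; first by rewrite mulr0 !raddf0 mulr0 subrr.
  have := rB _ _ Ea Eb; congr rr; rewrite mulrBr (raddfB sec) (raddfB sec a) mulrBr; zmod.
move=> h; rewrite gr_mulUU !secU -opprB; apply: (zclosedN (rr_closed G)); exact: rr_rel.
Qed.

Lemma sec_aug x : fil 1 (sec x - 1 *~ augmentation x).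
Proof.
have fc := @fil_closed G 5 1.
apply: (gr_ind (P := fun x => fil 1 (sec x - 1 *~ augmentation x))) => [|g].
  split=> [|a b Ea Eb].
    by rewrite (proj1 aug_closed) mulr0z (raddf0 sec) subr0; case: fc.
  by have := proj2 fc _ _ Ea Eb; congr (fil 1 _); rewrite augB mulrzBr (raddfB sec); zmod.
by rewrite secU augU mulr1z [1 + _]addrC addrK; exact: fil1_X.
Qed.

Lemma sec_ideal n x : ideal_exp aug n x -> exists2 y, fil n y & rr (sec x - y).
Proof.
have rc := rr_closed G.
elim: n x => [|n IH] x; first by exists (sec x); rewrite ?subrr //; case: rc.
have fc := fil_closed (K := G) (N := 5) n.+1.
have H : zclosed (fun x => exists2 y, fil n.+1 y & rr (sec x - y)).
  split=> [|a b [u fu ru] [v fv rv]].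
    by exists 0; [case: fc | rewrite raddf0 subrr; case: rc].
  exists (u - v); first exact: (proj2 fc).
  by have := proj2 rc _ _ ru rv; congr rr; rewrite (raddfB sec); zmod.
apply: (zgen_sub H) => _ [a [b [ha /IH[u fu ru] ->]]].
have fa : fil 1 (sec a) by have := sec_aug a; rewrite ha mulr0z subr0.
exists (sec a * u); first exact: (filM fa fu).
have := zclosedD rc (secM a b) (rr_mull (sec a) ru); congr rr; rewrite mulrBr; zmod.
Qed.

(** Elements of order 5 are 0 in M, so membership in the fifth power becomes membership in [rr] with
    no remainder. *)
Lemma dimension_rr g : dimension_subgroup G 5 g -> rr (X g : M).
Proof.
move=> /sec_ideal[y /(fil_ge (leqnn 5)) -> ]; rewrite subr0.
rewrite (raddfB sec) -[1 : ZG]/(gr_of 1%g) !secU => h.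
by have := zclosedD (rr_closed G) h (rr_X1 G); congr rr; zmod.
Qed.

End Augmentation.

(** * The descent along the lower central series *)

Section DimensionFive.
Variable G : groupType.
Notation M := (trunc G 5).
Notation A := (abelianization G).
Notation Fs := (@Fs G).
Notation lc := (lc Fs).

Let fc n := fil_closed (K := G) (N := 5) n.
Let rc n := rk_closed G n.
Let Fg := @Fs_closed G.

Hypotheses (H2 : zmod_trivial (group_homology G 2)) (tor0 : zmod_trivial (ext_tor A)).
Hypothesis J3 : forall s : M, rk 3 s -> fil 4 s -> near_relator 3 s.

Lemma cf_umV n x : lc n x -> cf n.+1 (um (x^-1)%g - 1) = - cf n.+1 (um x - 1).
Proof.
move=> Hx; have [_ _ HV] := lc_closed Fg n; have HVx := HV _ Hx.
apply: (addIr (cf n.+1 (um x - 1))); rewrite -cf_umM //.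
by rewrite mulVg um1 subrr (raddf0 (cf n.+1)) addNr.
Qed.

Lemma rk_near_relator n (s : M) : rk n.+1 s -> near_relator n s.
Proof.
have [H1 _ _] := lc_closed Fg n.
by move=> rs; exists 1%g; split=> //; rewrite um1 subrr subr0.
Qed.

Lemma rr_fil_near_relator n (s : M) : (n <= 3)%N -> rr s -> fil n.+1 s -> near_relator n s.
Proof.
case: n => [|[|[|[|//]]]] _ Rs fs.
- by apply: rk_near_relator; exact: rr_rk.
- by apply: rk_near_relator; exact: rr_fil2.
- by apply: rk2_fil3_near_relator => //; apply: rr_fil2 => //; exact: filW fs.
(* Order 4 is first used as order 3, which yields a relator [r] of [lc 2] only. Its degree 3 term
   vanishes over A because that of [s] does, so r = q r' with [q] in [Rs 2] and [r'] in [lc 3].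
   Subtracting [r'] leaves an element of [rk 3] of order 4, to which [J3] applies. *)
have [r [Hr r1 rs]] : near_relator 2 s.
  have f3 : fil 3 s by exact: filW fs.
  by apply: rk2_fil3_near_relator => //; apply: rr_fil2 => //; exact: filW f3.
have : tens_id (ld (@cls G) 2 r).
  have tc := @tens_id_closed A; have := zclosedN tc (lt_rk rs).
  by rewrite /ld (raddfB (cf 3)) (fs 3) // sub0r (raddfN (lt _)) opprK.
move=> /(detectA (n := 2) isT Hr)[_ [q [Hq q1 rq] Hqr]].
set r' := (q^-1 * r)%g in Hqr.
have r'1 : r'.1 = 1%g by rewrite fstM fstV q1 r1 mulVg.
have E : um r - 1 = (um q - 1) + (um r' - 1) + (um q - 1) * (um r' - 1).
  by rewrite -[r](mulVKg q) umM sub1_mul.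
have C1 : near_relator 3 (um r' - 1).
  by exists r'; split=> //; rewrite subrr; case: (rc 4).
rewrite -[s](subrK (um r' - 1)); apply: (zclosedD (near_relator_closed G 3)) => //; apply: J3.
- have rqr : rk 3 ((um q - 1) * (um r' - 1)).
    apply: (rkW (l := (3 + 4)%N)) => //; apply: rk_mulr => //; exact: lc_fil Hqr.
  have := zclosedD (rc 3) (zclosedD (rc 3) rs rq) rqr; congr (rk 3 _).
  by rewrite E; zmod.
- by apply: (proj2 (fc 4)) => //; exact: lc_fil Hqr.
Qed.

Lemma dimension_step n x : (n <= 3)%N -> rr (X x.1 : M) -> lc n x ->
  exists2 y, lc n.+1 y & y.1 = x.1.
Proof.
move=> n3 Rx Hx; have [_ HM HV] := lc_closed Fg n.
have Rs : rr (um x - 1).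
  have := zclosedD (rr_closed G) (Fs_rr (lc_F Fg Hx)) Rx; congr rr; zmod.
have [r [Hr r1 rk1]] := rr_fil_near_relator n3 Rs (lc_fil Hx); have HVr := HV _ Hr.
have Hy : lc n (r^-1 * x)%g by exact: HM.
have y1 : (r^-1 * x)%g.1 = x.1 by rewrite fstM fstV r1 invg1 mul1g.
have [_ [q [Hq q1 _] h]] : K1 n (r^-1 * x)%g.
  (* In degree 0 the class of [x.1] in A vanishes by [Rx]. In positive degree, dividing by [r]
     leaves the leading term of an element of [rk n.+1], which vanishes over A. *)
  have [n0|n0] := posnP n.
    rewrite n0 in Hx Hy *; apply: cls0_K1 => //.
    by rewrite y1 -linX; exact: lin_rr.
  apply: detectA => //; first by rewrite n0.
  rewrite /ld cf_umM // cf_umV // addrC -(raddfB (cf n.+1)); exact: lt_rk.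
by exists (q^-1 * (r^-1 * x))%g; rewrite // fstM fstV q1 invg1 mul1g.
Qed.

Lemma dimension5 g : dimension_subgroup G 5 g -> lower_central G 5 g.
Proof.
move=> /dimension_rr Rg.
have [x0 H0 E0] : exists2 x, lc 0 x & x.1 = g by exists (xg g) => //; exact: Fs_xg.
have step n x : (n <= 3)%N -> lc n x -> x.1 = g -> exists2 y, lc n.+1 y & y.1 = g.
  by move=> n3 Hx xE; have := dimension_step n3 _ Hx; rewrite xE; apply.
have [x1 H1 E1] := step 0 _ isT H0 E0; have [x2 H2' E2] := step 1 _ isT H1 E1.
have [x3 H3 E3] := step 2 _ isT H2' E2; have [x4 H4 <-] := step 3 _ isT H3 E3.
exact: (lc_fst H4).
Qed.

End DimensionFive.

(** * The functor S_3 and simplicial resolutions *)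

Section TensorBridge.
Variable A : zmodType.

(** The tensor and Lie algebras are presented on the monoid ring of words; this map and its inverse
    transport them to the sealed free ring. *)
Definition malg_of_FR : {additive FR A -> {malg {fmonom A}}} := wlift (fun s => << FMonom s >>).
Definition FR_of_malg : {additive {malg {fmonom A}} -> FR A} :=
  fab_lift (fun w : {fmonom A} => word w).

Lemma malg_of_FRW s : malg_of_FR (word s) = << FMonom s >>. Proof. exact: wliftE. Qed.
Lemma FR_of_malgU w : FR_of_malg << w >> = word w. Proof. exact: fab_liftU. Qed.

Lemma malg_of_FRK x : FR_of_malg (malg_of_FR x) = x.
Proof.
apply: (word_ext (f := FR_of_malg \o malg_of_FR) (g := idfun)) => s /=.
by rewrite malg_of_FRW FR_of_malgU.
Qed.

Lemma FR_of_malgK z : malg_of_FR (FR_of_malg z) = z.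
Proof.
apply: (@fab_ext _ _ (malg_of_FR \o FR_of_malg) idfun) => w /=.
by rewrite FR_of_malgU malg_of_FRW; case: w.
Qed.

Lemma FR_of_malgB x y : FR_of_malg (x - y) = FR_of_malg x - FR_of_malg y. Proof. exact: raddfB. Qed.
Lemma FR_of_malg0 : FR_of_malg 0 = 0. Proof. exact: raddf0. Qed.

Lemma FR_of_malgM x y : FR_of_malg (x * y) = FR_of_malg x * FR_of_malg y.
Proof.
elim/fab_ind: x => [|a b Ea Eb|u].
- by rewrite mul0r FR_of_malg0 mul0r.
- rewrite mulrBl 2!FR_of_malgB.
  exact (etrans (f_equal2 (fun s t => s - t) Ea Eb) (esym (mulrBl _ _ _))).
elim/fab_ind: y => [|a b Ea Eb|v].
- by rewrite mulr0 FR_of_malg0 mulr0.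
- rewrite mulrBr 2!FR_of_malgB.
  exact (etrans (f_equal2 (fun s t => s - t) Ea Eb) (esym (mulrBr _ _ _))).
by rewrite malgM_def fgmulUU mulr1 !FR_of_malgU wordM /mmul /= /fmmul fmE.
Qed.

Lemma malg_of_FRM x y : malg_of_FR (x * y) = malg_of_FR x * malg_of_FR y.
Proof. by rewrite -[RHS]FR_of_malgK FR_of_malgM !malg_of_FRK. Qed.

Lemma tens_rel_malg_of_FR x : tens_id x -> zgenerated (@tens_rel A) (malg_of_FR x).
Proof.
have H := zclosed_preim malg_of_FR (zclosed_gen (@tens_rel A)).
apply: (zgen_sub H) => _ [u [v [a [b ->]]]]; rewrite !malg_of_FRM.
apply: zgen_in; apply: tens_mulr; apply: tens_mull.
rewrite (raddfB malg_of_FR) (raddfB malg_of_FR) !malg_of_FRW; exact: tens_add.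
Qed.

Lemma tens_rel_FR_of_malg z : zgenerated (@tens_rel A) z -> tens_id (FR_of_malg z).
Proof.
have H := zclosed_preim FR_of_malg (@tens_id_closed A).
apply: (zgen_sub H) => r; elim=> {r} [a b|x r _ IH|x r _ IH].
- rewrite 2!FR_of_malgB !FR_of_malgU.
  apply: zgen_in; exists [::], [::], a, b.
  by rewrite word0 mul1r mulr1.
- by rewrite FR_of_malgM; exact: tens_id_mull.
- by rewrite FR_of_malgM; exact: tens_id_mulr.
Qed.

Definition tensor_class : {additive FR A -> tensor_algebra A} := zproj (@tens_rel A) \o malg_of_FR.

Lemma tensor_class_eq0 x : tensor_class x = 0 <-> tens_id x.
Proof.
split=> [/zproj_eq0 /tens_rel_FR_of_malg|/tens_rel_malg_of_FR /zproj_eq0 //].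
by rewrite malg_of_FRK.
Qed.

Lemma tensor_powerP n z : z \in tensor_power A n -> exists2 x, homog n x & z = tensor_class x.
Proof.
move=> /zspanP; elim=> [_ [w wn ->]||y y' _ [x hx ->] _ [x' hx' ->]].
- exists (word w); first by rewrite -wn; exact: homog_word.
  by rewrite /tensor_class /= malg_of_FRW; case: w {wn}.
- by exists 0; [case: (homog_closed A n) | rewrite raddf0].
- by exists (x - x'); [apply: (proj2 (homog_closed A n)) | rewrite (raddfB tensor_class)].
Qed.

Lemma tensor_class_power n x : homog n x -> tensor_class x \in tensor_power A n.
Proof.
elim=> [_ [s sn ->]||y z _ Ey _ Ez].
- by apply/zspanP; apply: zgen_in; exists (FMonom s); rewrite // /tensor_class /= malg_of_FRW.
- by rewrite raddf0 rpred0.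
- by rewrite (raddfB tensor_class) rpredB.
Qed.

Lemma malg_of_FR_lexp w : malg_of_FR (lexp w) = lie_expand w.
Proof.
elim: w => [a|u IHu v IHv] /=; first exact: malg_of_FRW.
by rewrite /com (raddfB malg_of_FR) !malg_of_FRM IHu IHv.
Qed.

Lemma lie_componentP z :
  z \in lie_component A 3 -> exists2 l, lie3 l & lie_to_tensor z = tensor_class l.
Proof.
move=> /zspanP; elim=> [_ [w wn ->]||y y' _ [x hx Ex] _ [x' hx' Ex']].
- exists (lexp w); first by apply: zgen_in; exists w.
  by rewrite lie_to_tensorE fab_liftU /tensor_class /= malg_of_FR_lexp.
- by exists 0; [exact: zgen_0 | rewrite !raddf0].
- exists (x - x'); first exact: zgen_B.
  by rewrite (raddfB lie_to_tensor) Ex Ex' (raddfB tensor_class).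
Qed.

Lemma lie_image_closed n :
  zclosed (fun t => exists2 x, x \in lie_component A n & lie_to_tensor x = t).
Proof.
split=> [|_ _ [x hx <-] [y hy <-]]; first by exists 0; rewrite ?rpred0 ?raddf0.
by exists (x - y); rewrite ?rpredB // raddfB.
Qed.

(** Projecting to degree 3 first makes the class additive on the whole free ring. *)
Definition S3_class_sub (x : FR A) : zsub (tensor_power A 3) :=
  Sub (tensor_class (dg 3 x)) (tensor_class_power (homog_dg 3 x)).

Lemma S3_class_sub_is_zmod_morphism : zmod_morphism S3_class_sub.
Proof.
move=> x y; 
apply/val_inj; rewrite raddfB.
change (tensor_class (dg 3 (x - y)) = tensor_class (dg 3 x) - tensor_class (dg 3 y)).
by rewrite (raddfB (dg 3)) (raddfB tensor_class).
Qed.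
HB.instance Definition _ := GRing.isZmodMorphism.Build (FR A) (zsub (tensor_power A 3))
  S3_class_sub S3_class_sub_is_zmod_morphism.

Definition S3_class : {additive FR A -> Sfun A 3} := zproj _ \o S3_class_sub.

Lemma S3_class_eq0 x : S3_class x = 0 -> exists2 l, lie3 l & tens_id (dg 3 x - l).
Proof.
move=> /zproj_eq0 h.
have [|z hz Ez] := zgen_sub (zclosed_preim val (lie_image_closed 3)) _ h; first by [].
have [l hl El] := lie_componentP hz; exists l => //; apply/tensor_class_eq0.
by rewrite (raddfB tensor_class) -El Ez subrr.
Qed.

Lemma S3_class0 x : tens_id (dg 3 x) -> S3_class x = 0.
Proof.
move=> /tensor_class_eq0 E; rewrite /S3_class /= (_ : S3_class_sub x = 0) ?raddf0 //.
by apply/val_inj; exact: E.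
Qed.

Lemma S3_class_surj q : exists2 x, homog 3 x & q = S3_class x.
Proof.
have [z ->] := zproj_surj q; have [x hx E] := tensor_powerP (valP z).
by exists x => //; congr (zproj _ _); apply/val_inj; rewrite E -[in LHS](dg_homog hx).
Qed.

End TensorBridge.
Arguments malg_of_FR {A}.
Arguments tensor_class {A}.
Arguments S3_class {A}.

Lemma free_ring_map_malg_of_FR (A B : zmodType) (f : {additive A -> B}) x :
  free_ring_map f (malg_of_FR x) = malg_of_FR (fm f x).
Proof.
apply: (word_ext (f := free_ring_map f \o malg_of_FR) (g := malg_of_FR \o fm f)) => s /=.
by rewrite fmW !malg_of_FRW /free_ring_map /= fab_liftU.
Qed.

Lemma fm_dg (A B : choiceType) (f : A -> B) n x : dg n (fm f x) = fm f (dg n x).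
Proof.
apply: (word_ext (f := dg n \o fm f) (g := fm f \o dg n)) => s /=.
by rewrite fmW !dgW size_map; case: eqP; rewrite ?raddf0 // fmW.
Qed.

Lemma Sfun_map_S3_class (A B : zmodType) (f : {additive A -> B}) x :
  Sfun_map f 3 (S3_class x) = S3_class (fm f x).
Proof.
rewrite Sfun_mapE; congr (zproj _ _); apply/val_inj.
change (tens_map f (tensor_class (dg 3 x)) = tensor_class (dg 3 (fm f x))).
by rewrite tens_mapE free_ring_map_malg_of_FR fm_dg.
Qed.

Lemma moore_boundary_closed (X : simplicial_zmod) n : zclosed (@moore_boundary X n).
Proof.
split=> [|_ _ [y hy <-] [z hz <-]]; first by exists 0 => [i _|]; rewrite raddf0.
by exists (y - z) => [i hi|]; rewrite raddfB // hy // hz // subrr.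
Qed.

(** * Low-dimensional simplices of a resolution *)

Section Resolution.
Variable X : simplicial_zmod.

Definition collapse : simplex_map 1 0 :=
  @SimplexMap 1 0 (fun=> ord0) (fun _ _ _ => leqnn _).

Definition degen : {additive X 0 -> X 1} := simp_map X collapse.

Lemma face_degen (i : 'I_2) x : face X i (degen x) = x.
Proof.
have h : (fun j : 'I_1 => j) =1 collapse \o coface i by move=> j; rewrite (ord1 j).
pose c := @SimplexMap 0 0 (fun j => j) (fun _ _ => id).
have := @simp_map_comp X _ _ _ (coface i) collapse c h x; rewrite /= => <-.
exact: (simp_map_id (a := c)).
Qed.

Lemma face_face n (i j : 'I_n.+2) (i' j' : 'I_n.+3) x :
  (forall k : 'I_n.+1, lift i' (lift i k) = lift j' (lift j k)) ->
  face X i (face X i' x) = face X j (face X j' x).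
Proof.
move=> E; pose c (a : simplex_map n n.+1) (b : simplex_map n.+1 n.+2) : simplex_map n n.+2 :=
  @SimplexMap n n.+2 (b \o a) (fun k l kl => @simplex_mono _ _ b _ _ (@simplex_mono _ _ a k l kl)).
have h := @simp_map_comp X _ _ _ (coface i) (coface i') (c (coface i) (coface i'))
  (fun k => erefl) x.
have h' := @simp_map_comp X _ _ _ (coface j) (coface j') (c (coface i) (coface i')) E x.
exact: etrans (esym h) h'.
Qed.

Let d0 : {additive X 1 -> X 0} := face X ord0.
Let d1 : {additive X 1 -> X 0} := face X ord_max.
Let e0 : {additive X 2 -> X 1} := face X ord0.
Let e1 : {additive X 2 -> X 1} := face X (lift ord0 ord0).
Let e2 : {additive X 2 -> X 1} := face X ord_max.

Lemma d0e1 x : d0 (e1 x) = d0 (e0 x).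
Proof. by apply: face_face => k; apply/val_inj; rewrite (ord1 k). Qed.

Lemma d0e2 x : d0 (e2 x) = d1 (e0 x).
Proof. by apply: face_face => k; apply/val_inj; rewrite (ord1 k). Qed.

Lemma d1e2 x : d1 (e2 x) = d1 (e1 x).
Proof. by apply: face_face => k; apply/val_inj; rewrite (ord1 k). Qed.

Lemma homotopy_group0 (A : zmodType) : zmod_isomorphic (homotopy_group X 0) A ->
  exists p : {additive X 0 -> A}, [/\ forall a, exists x, p x = a,
    forall n, p (d1 n) = p (d0 n) &
    forall x, p x = 0 -> exists n, d0 n = 0 /\ d1 n = x].
Proof.
move=> [phi [psi phiK psiK]].
pose B (x : zsub (@moore_cycle X 0)) := moore_boundary (val x).
pose j (x : X 0) : zsub (@moore_cycle X 0) := Sub x isT.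
have jB : zmod_morphism j by move=> x y; apply/val_inj; rewrite raddfB.
have p_zmod : zmod_morphism (fun x => phi (zproj B (j x))).
  by move=> x y; rewrite jB (raddfB (zproj B)) (raddfB phi).
pose p := HB.pack_for {additive X 0 -> A} (fun x => phi (zproj B (j x)))
  (GRing.isZmodMorphism.Build (X 0) A (fun x => phi (zproj B (j x))) p_zmod).
have ker x : moore_boundary x -> p x = 0.
  move=> hx; rewrite /p /= (_ : zproj B (j x) = 0) ?raddf0 //.
  by apply/zproj_eq0; apply: zgen_in.
exists p; split.
- move=> a; have [x E] := zproj_surj (psi a); exists (val x).
  rewrite /p /= -[RHS]psiK E; congr (phi (zproj B _)); exact/val_inj.
- move=> n; apply/eqP; rewrite -subr_eq0 -raddfB; apply/eqP; apply: ker.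
  (* Subtracting the degenerate simplex on the face 0 of [n] makes that face vanish, as
     [moore_boundary] requires; the last face becomes d1 n - d0 n. *)
  exists (n - degen (d0 n)); last by rewrite raddfB face_degen.
  move=> i hi; have -> : i = ord0 by apply/val_inj; case: i hi => -[|[|]].
  by rewrite raddfB face_degen subrr.
- move=> x; rewrite /p /= -(raddf0 phi) => /(can_inj phiK) /zproj_eq0 h.
  have [|y hy Ey] := zgen_sub (zclosed_preim val (@moore_boundary_closed X 0)) _ h; first by [].
  by exists y; split=> //; apply: hy.
Qed.

Lemma free_lift (V A P : zmodType) (f : {additive V -> A}) (g : {additive P -> A}) :
  zmod_free V -> (forall a, exists x, g x = a) ->
  exists h : {additive V -> P}, forall x, g (h x) = f x.
Proof.
move=> [K [b [c bK cK]]] gsurj.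
have cB : zmod_morphism c by move=> x y; apply: (can_inj bK); rewrite cK raddfB !cK.
pose s k := sval (cid (gsurj (f (b << k >>)))).
have hB : zmod_morphism (fun x => fab_lift s (c x)) by move=> x y; rewrite cB raddfB.
exists (HB.pack_for {additive V -> P} (fun x => fab_lift s (c x))
  (GRing.isZmodMorphism.Build V P _ hB)) => x /=.
rewrite -[in RHS](cK x); move: (c x); apply: (@fab_ext _ _ (g \o fab_lift s) (f \o b)) => k /=.
by rewrite fab_liftU /s; case: cid.
Qed.

(** Vanishing in S_3 means being a Lie element up to tensor relations. Hence the two zero faces of
    the bounding 2-simplex, and its equality with [t] on the last face, each leave one Lie element
    behind. *)
Lemma S3_boundary (t : FR (X 1)) : zmod_trivial (derived_functor 1 (S_ 3) X) ->
  homog 3 t -> tens_id (fm d0 t) -> tens_id (fm d1 t) ->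
  exists l l0 l1 y, [/\ [/\ lie3 l, lie3 l0, lie3 l1 & homog 3 y], tens_id (fm e0 y - l0),
    tens_id (fm e1 y - l1) & tens_id (t - l - fm e2 y)].
Proof.
move=> triv ht t0 t1.
have faceE n i (x : FR (X n.+1)) :
    @face (simp_comp (S_ 3) X) n i (S3_class x) = S3_class (fm (face X i) x).
  exact: Sfun_map_S3_class.
have cyc : S3_class t \in @moore_cycle (simp_comp (S_ 3) X) 1.
  apply/forallP => i; rewrite faceE; apply/eqP; apply: S3_class0.
  rewrite fm_dg (dg_homog ht); case: (unliftP ord_max i) => [k ->|-> //].
  by rewrite (ord1 k) (_ : lift ord_max ord0 = ord0) //; exact/val_inj.
have bc := @moore_boundary_closed (simp_comp (S_ 3) X) 1.
have [Y hY EY] := subquot_trivial bc triv cyc.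
have [y hy EYy] := S3_class_surj Y; rewrite EYy in hY EY.
have ez i : i != ord_max -> exists2 l, lie3 l & tens_id (fm (face X i) y - l).
  move=> /hY; rewrite faceE => /S3_class_eq0[l hl]; rewrite (dg_homog (homog_fm _ hy)).
  by exists l.
have [l0 hl0 tl0] := ez ord0 isT; have [l1 hl1 tl1] := ez (lift ord0 ord0) isT.
have : S3_class (t - fm e2 y) = 0 by rewrite (raddfB S3_class) -EY -faceE subrr.
move=> /S3_class_eq0[l hl tl]; exists l, l0, l1, y; split=> //.
move: tl; rewrite (raddfB (dg 3)) (dg_homog ht) (dg_homog (homog_fm _ hy)).
by congr tens_id; zmod.
Qed.

End Resolution.

Theorem theorem8p1 (G : groupType) (X : simplicial_zmod)
  (resX : free_simplicial_resolution X (abelianization G))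
  (H2_trivial : zmod_trivial (group_homology G 2))
  (ext_tor_trivial : zmod_trivial (ext_tor (abelianization G)))
  (D1S3_trivial : zmod_trivial (derived_functor 1 (S_ 3) X)) :
  dimension_subgroup G 5 = lower_central G 5.
Proof.
have [freeX piX _] := resX; have [p [psurj pd pker]] := homotopy_group0 piX.
(* Freeness of X 0 gives [theta], and freeness of the group on G gives [sigma], both over A. *)
have [theta tE] : exists h : {additive X 0 -> {malg G}}, forall x, pA G (h x) = p x.
  apply: free_lift => // a; have [g ->] := cls_surj a.
  by exists << g >>; exact: pAU.
have [sigma sE] : exists h : {additive {malg G} -> X 0}, forall x, p (h x) = pA G x.
  by apply: free_lift => //; exists G, idfun; exists id.
rewrite predeqE => g; split; last exact: lower_central_dimension.
apply: dimension5 => // s.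
apply: (@rk3_fil4_near_relator G H2_trivial (X 0) (X 1) (face X ord0) (face X ord_max) (degen X)
  theta sigma _ _ _ _ _ (X 2) (face X ord0) (face X (lift ord0 ord0)) (face X ord_max)).
- exact: face_degen.
- exact: face_degen.
- by move=> q; rewrite tE sE.
- by move=> n; rewrite !tE.
- by move=> x; rewrite tE; exact: pker.
- exact: d0e1.
- exact: d0e2.
- exact: d1e2.
- by move=> t ht t0 t1; exact: S3_boundary.
Qed.
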